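(* Let $(M,\varphi,\xi,\eta,g)$ be a contact pseudo-metric manifold of dimension $2n+1$, let $h=\frac12\pounds_\xi\varphi$, and let $\tau$ be the $(1,1)$ tensor field determined by $g(\tau X,Y)=(\pounds_\xi g)(X,Y)$ for all $X,Y\in TM$. Then the following statements are true: (i) If $\tau$ is a Codazzi tensor, i.e. $(\nabla_X\tau)Y=(\nabla_Y\tau)X$ for all $X,Y\in TM$, then $h^2=0$ and the Ricci operator $Q$ satisfies $Q\xi=2\varepsilon n\,\xi$. (ii) $M$ is a Sasakian pseudo-metric manifold if and only if both $R(X,Y)\xi=\eta(Y)X-\eta(X)Y$ holds for all $X,Y\in TM$ and $\tau$ is a Codazzi tensor.
   Context: An almost contact pseudo-metric manifold $(M,\varphi,\xi,\eta,g)$ is a smooth connected manifold $M$ of dimension $2n+1$ with a $(1,1)$ tensor field $\varphi$, a vector field $\xi$, a $1$-form $\eta$ and a pseudo-Riemannian metric $g$ such that $\varphi^2=-I+\eta\otimes\xi$, $\eta(\xi)=1$, $\varphi\xi=0$, $\eta\circ\varphi=0$, and $g(\varphi X,\varphi Y)=g(X,Y)-\varepsilon\eta(X)\eta(Y)$ for all $X,Y$, where $\varepsilon=\pm1$ is a fixed sign; this condition is equivalent to $\eta(X)=\varepsilon g(X,\xi)$ together with $g(\varphi X,Y)=-g(X,\varphi Y)$, and so $g(\xi,\xi)=\varepsilon$. It is a contact pseudo-metric manifold if $d\eta=\Phi$, where $\Phi(X,Y)=g(X,\varphi Y)$ and $d\eta(X,Y)=\frac12\big(X\eta(Y)-Y\eta(X)-\eta([X,Y])\big)$.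 $\nabla$ is the Levi-Civita connection of $g$, $R(X,Y)=[\nabla_X,\nabla_Y]-\nabla_{[X,Y]}$, $\pounds$ is the Lie derivative, and $(\nabla_XA)Y=\nabla_X(AY)-A(\nabla_XY)$ for a $(1,1)$ tensor $A$. The Ricci tensor is $S(X,Y)=\sum_{i}\varepsilon_i\,g(R(e_i,X)Y,e_i)$ for a local pseudo-orthonormal basis $\{e_i\}_{i=1}^{2n+1}$ with $\varepsilon_i=g(e_i,e_i)=\pm1$, and the Ricci operator $Q$ is defined by $S(X,Y)=g(QX,Y)$. A contact pseudo-metric manifold is a Sasakian pseudo-metric manifold if the almost complex structure $J\left(X,f\frac{d}{dt}\right)=\left(\varphi X-f\xi,\eta(X)\frac{d}{dt}\right)$ on $M\times\mathbb{R}$ is integrable, where $X\in TM$, $t$ is the coordinate on $\mathbb{R}$ and $f$ is a $C^\infty$ function on $M\times\mathbb{R}$; it is well known that this is equivalent to $(\nabla_X\varphi)Y=g(X,Y)\xi-\varepsilon\eta(Y)X$ for all $X,Y$. *)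

(* Defs.v *)
From HB Require Import structures.
From mathcomp Require Import all_boot all_order all_algebra.
From mathcomp Require Import ring.
From mathcomp Require Import all_classical all_reals all_analysis.
Set Implicit Arguments.
Unset Strict Implicit.
Unset Printing Implicit Defensive.
Import Order.TTheory GRing.Theory Num.Theory.
Import numFieldNormedType.Exports.
Local Open Scope classical_set_scope.
Local Open Scope ring_scope.

(** * Smooth maps between open subsets of normed spaces *)

(* Only used with U open.  Asking for Frechet differentiability of f and of all
   its iterated directional derivatives is, in finite dimension, the same as
   asking for continuous partial derivatives of every order. *)
Section smooth_on.
Context {R : realType} {V W : normedModType R}.

Fixpoint Ck (k : nat) (U : set V) (f : V -> W) : Prop :=
  if k is k'.+1 then
    (forall x, U x -> differentiable f x) /\ (forall v, Ck k' U ('D_v f))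
  else forall x, U x -> {for x, continuous f}.

Definition smooth_on (U : set V) (f : V -> W) : Prop := forall k, Ck k U f.

End smooth_on.

Section smooth_on_theory.
Context {R : realType}.
Implicit Types V W : normedModType R.

Lemma near_eq_differentiable V W (f g : V -> W) x :
  {near x, f =1 g} -> differentiable f x -> differentiable g x.
Proof.
move=> fg df; have -> : g = f + (g - f) by rewrite addrC subrK.
apply: differentiableD => //; set h : V -> W := g - f.
have h0 : {near x, h =1 cst 0}.
  by apply: filterS fg => y fgy; rewrite /h /GRing.add /= /GRing.opp /= fgy subrr.
have hx0 : h x = 0 by exact: nbhs_singleton h0.
have z : h \o shift x = cst (h x) + \0 +o_ 0 id.
  apply/eqaddoP => e e0; rewrite !near_simpl/=.
  move: h0; rewrite (near_shift 0 x) subr0; apply: filterS => y /= hy.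
  rewrite /GRing.add /= /GRing.opp /= hx0 hy /= addr0 subrr normr0.
  by rewrite mulr_ge0// ltW.
have cz : continuous (\0 : V -> W) by move=> ?; apply: (@cst_continuous V W 0).
have e := diff_unique cz z.
by apply/diff_locallyP; rewrite e; split.
Qed.

Lemma eq_Ck V W k (U : set V) (f g : V -> W) : open U ->
  (forall x, U x -> f x = g x) -> Ck k U f -> Ck k U g.
Proof.
move=> oU; elim: k f g => [|k IH] f g fg.
  move=> cf x Ux; have nfg : {near x, g =1 f}.
    by apply: filterS (open_nbhs_nbhs (conj oU Ux)) => y /fg.
  move: (cf x Ux); rewrite /prop_for /continuous_at (fg x Ux).
  move=> cfx; apply: cvg_trans cfx; apply: near_eq_cvg.
  by apply: filterS nfg => y ->.
have nfg x : U x -> {near x, f =1 g}.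
  by move=> Ux; apply: filterS (open_nbhs_nbhs (conj oU Ux)) => y /fg.
move=> [df cf]; split=> [x Ux|v].
  exact: near_eq_differentiable (nfg x Ux) (df x Ux).
by apply: IH (cf v) => x /nfg; exact: near_eq_derive.
Qed.

Lemma Ck_sub V W k (U U' : set V) (f : V -> W) :
  U `<=` U' -> Ck k U' f -> Ck k U f.
Proof.
move=> UU'; elim: k f => [|k IH] f /=; first by move=> c x /UU'/c.
by move=> [df cf]; split=> [x /UU'/df//|v]; exact: IH.
Qed.

Lemma CkW V W k (U : set V) (f : V -> W) : Ck k.+1 U f -> Ck k U f.
Proof.
elim: k f => [|k IH] f [df cf].
  by move=> x Ux; exact: differentiable_continuous (df x Ux).
by split=> // v; exact: IH (cf v).
Qed.

Lemma smooth_on_differentiable V W (U : set V) (f : V -> W) x :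
  smooth_on U f -> U x -> differentiable f x.
Proof. by move=> /(_ 1%N) [df _] /df. Qed.

Lemma Ck_cst V W k (U : set V) (a : W) : Ck k U (cst a).
Proof.
elim: k a => [|k IH] a /=; first by move=> x _; exact: cst_continuous.
split=> [x _ //|v]; rewrite (_ : 'D_v _ = cst 0)//.
by apply/funext => x; rewrite derive_cst.
Qed.

Lemma CkD V W k (U : set V) (f g : V -> W) : open U ->
  Ck k U f -> Ck k U g -> Ck k U (f + g).
Proof.
move=> oU; elim: k f g => [|k IH] f g.
  by move=> cf cg x Ux; apply: continuousD; [exact: cf|exact: cg].
move=> [df cf] [dg cg]; split=> [x Ux|v].
  by apply: differentiableD; [exact: df|exact: dg].
apply: eq_Ck (IH _ _ (cf v) (cg v)) => // x Ux.
by rewrite deriveD//; apply: diff_derivable; [exact: df|exact: dg].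
Qed.

Lemma CkZ V W k (U : set V) (a : R) (f : V -> W) : open U ->
  Ck k U f -> Ck k U (a *: f).
Proof.
move=> oU; elim: k f => [|k IH] f.
  by move=> cf x Ux; apply: continuousZr; exact: cf.
move=> [df cf]; split=> [x Ux|v]; first by apply: differentiableZ; exact: df.
apply: eq_Ck (IH _ (cf v)) => // x Ux.
by rewrite deriveZ//; apply: diff_derivable; exact: df.
Qed.

Lemma CkM V k (U : set V) (f g : V -> R^o) : open U ->
  Ck k U f -> Ck k U g -> Ck k U (f * g).
Proof.
move=> oU; elim: k f g => [|k IH] f g.
  by move=> cf cg x Ux; apply: continuousM; [exact: cf|exact: cg].
move=> fk gk; have [df cf] := fk; have [dg cg] := gk; split=> [x Ux|v].
  by apply: differentiableM; [exact: df|exact: dg].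
apply: (@eq_Ck _ _ _ _ (f * 'D_v g + g * 'D_v f)) => // [x Ux|].
  by rewrite deriveM//; apply: diff_derivable; [exact: df|exact: dg].
by apply: CkD => //; apply: IH; [exact: CkW fk|exact: cg|exact: CkW gk|exact: cf].
Qed.

Lemma Ck_pair V W W' k (U : set V) (f : V -> W) (g : V -> W') : open U ->
  Ck k U f -> Ck k U g -> Ck k U (fun x => (f x, g x)).
Proof.
move=> oU; elim: k f g => [|k IH] f g.
  by move=> cf cg x Ux; apply: cvg_pair; [exact: cf|exact: cg].
move=> [df cf] [dg cg]; split=> [x Ux|v].
  by apply: differentiable_pair; [exact: df|exact: dg].
apply: eq_Ck (IH _ _ (cf v) (cg v)) => // x Ux.
have dfx := df x Ux; have dgx := dg x Ux.
by rewrite !deriveE//; [rewrite diff_pair|exact: differentiable_pair].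
Qed.

Lemma Ck_comp_affine V V' W k (U : set V) (f : V -> W) (A L : V' -> V) :
  open U -> (forall x, is_diff x A L) -> Ck k U f -> Ck k (A @^-1` U) (f \o A).
Proof.
move=> oU AL; have dA x : differentiable A x by have [] := AL x.
have oA : open (A @^-1` U).
  by apply: open_comp => // x _; exact: differentiable_continuous.
elim: k f => [|k IH] f.
  move=> cf x Ux; apply: continuous_comp; last exact: cf.
  exact: differentiable_continuous.
move=> [df cf]; split=> [x Ux|v].
  by apply: differentiable_comp => //; exact: df.
apply: eq_Ck (IH _ (cf (L v))) => // x Ux.
have dfx := df _ Ux; have dfA := differentiable_comp (dA x) dfx.
have [_ eL] := AL x.
by rewrite [RHS]deriveE// diff_comp// /= -eL deriveE.
Qed.

Lemma is_diff_fst V W (x : V * W) : is_diff x (fst : V * W -> V) fst.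
Proof.
have c : continuous (fst : V * W -> V) by move=> ?; exact: cvg_fst.
pose F : {linear (V * W)%type -> V} := fst.
apply: DiffDef.
  exact: (linear_differentiable (f := F)).
exact: (diff_lin (f := F)).
Qed.

Lemma is_diff_snd V W (x : V * W) : is_diff x (snd : V * W -> W) snd.
Proof.
have c : continuous (snd : V * W -> W) by move=> ?; exact: cvg_snd.
pose F : {linear (V * W)%type -> W} := snd.
apply: DiffDef.
  exact: (linear_differentiable (f := F)).
exact: (diff_lin (f := F)).
Qed.

Lemma Ck_id V k (U : set V) : Ck k U (id : V -> V).
Proof.
case: k => [|k]; first by move=> x _.
split=> [x _ //|v]; rewrite (_ : 'D_v _ = cst v); first exact: Ck_cst.
by apply/funext => x; rewrite derive_id.
Qed.

End smooth_on_theory.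

(** * Smooth manifolds *)

(* The maps are total; they only matter on [chart_dom] and on its image. *)
Record chart (R : realType) (E : normedModType R) (T : topologicalType) := Chart {
  chart_dom : set T;
  chart_map : T -> E;
  chart_inv : E -> T;
  chart_dom_open : open chart_dom;
  chart_img_open : open (chart_map @` chart_dom);
  chart_map_cts : forall p, chart_dom p -> {for p, continuous chart_map};
  chart_inv_cts : forall x, (chart_map @` chart_dom) x ->
    {for x, continuous chart_inv};
  chart_mapK : forall p, chart_dom p -> chart_inv (chart_map p) = p }.

Definition chart_img (R : realType) (E : normedModType R) (T : topologicalType)
    (a : chart E T) : set E :=
  chart_map a @` chart_dom a.

Record manifold (R : realType) (E : normedModType R) := Manifold {
  points :> topologicalType;
  atlas : set (chart E points);
  manifold_hausdorff : hausdorff_space points;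
  manifold_second_countable : @second_countable points;
  atlas_cover : forall p : points, exists2 a, atlas a & chart_dom a p;
  atlas_compat : forall a b, atlas a -> atlas b ->
    smooth_on (chart_map a @` (chart_dom a `&` chart_dom b))
              (chart_map b \o chart_inv a) }.

Arguments atlas {R E} m.

(** * The algebra of smooth functions *)

Section smooth_functions.
Context {R : realType} {E : normedModType R} (M : manifold E).

Definition smooth (f : M -> R^o) : Prop :=
  forall a, atlas M a -> smooth_on (chart_img a) (f \o chart_inv a).

Definition smooth_fun_pred : {pred M -> R^o} := fun f => `[< smooth f >].

Record smooth_fun := SmoothFun {
  smooth_fun_val :> M -> R^o;
  smooth_fun_valP : smooth_fun_val \in smooth_fun_pred }.

HB.instance Definition _ := [isSub for smooth_fun_val].
HB.instance Definition _ := gen_eqMixin smooth_fun.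
HB.instance Definition _ := gen_choiceMixin smooth_fun.

Lemma smooth_funP (f : smooth_fun) : smooth f.
Proof. by have /asboolP := smooth_fun_valP f. Qed.

Definition smoothE (f : M -> R^o) (fs : smooth f) : smooth_fun :=
  SmoothFun (asboolT fs : f \in smooth_fun_pred).

Lemma smooth_fun_ext (f g : smooth_fun) : (forall p, f p = g p) -> f = g.
Proof. by move=> fg; apply/val_inj/funext. Qed.

Fact smooth_subring_closed : subring_closed smooth_fun_pred.
Proof.
split=> [|f g|f g].
- by apply/asboolP => a _ k; exact: Ck_cst.
- move=> /asboolP fs /asboolP gs; apply/asboolP => a aM k.
  have -> : (f - g) \o chart_inv a
            = f \o chart_inv a + (-1 : R) *: (g \o chart_inv a).
    by apply/funext => x; rewrite /= {2}/GRing.add/= scaleN1r.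
  apply: CkD; [exact: chart_img_open|exact: fs|].
  by apply: CkZ; [exact: chart_img_open|exact: gs].
- move=> /asboolP fs /asboolP gs; apply/asboolP => a aM k.
  by apply: CkM; [exact: chart_img_open|exact: fs|exact: gs].
Qed.
HB.instance Definition _ :=
  GRing.isSubringClosed.Build (M -> R^o) smooth_fun_pred smooth_subring_closed.

Fact smooth_submod_closed : submod_closed smooth_fun_pred.
Proof.
split; first by apply/asboolP => a _ k; exact: Ck_cst.
move=> c f g /asboolP fs /asboolP gs; apply/asboolP => a aM k.
apply: CkD; [exact: chart_img_open| |exact: gs].
by apply: CkZ; [exact: chart_img_open|exact: fs].
Qed.

HB.instance Definition _ := GRing.SubChoice_isSubComPzRing.Build
  (M -> R^o) smooth_fun_pred smooth_fun smooth_subring_closed.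

HB.instance Definition _ :=
  GRing.isSubmodClosed.Build R (M -> R^o) smooth_fun_pred smooth_submod_closed.
HB.instance Definition _ := [SubZmodule_isSubLmodule of smooth_fun by <:].

End smooth_functions.

(** * Tangent vectors and vector fields *)

Section tangent.
Context {R : realType} {E : normedModType R} (M : manifold E).
Local Notation C := (smooth_fun M).

Definition derivation_at (p : M) (v : C -> R^o) : Prop :=
  (forall (c : R) (f g : C), v (c *: f + g) = c * v f + v g) /\
  (forall f g : C, v (f * g) = f p * v g + g p * v f).

Definition derivation_pred (p : M) : {pred C -> R^o} :=
  fun v => `[< derivation_at p v >].

Record tangent (p : M) := Tangent {
  tangent_val :> C -> R^o;
  tangent_valP : tangent_val \in derivation_pred p }.

HB.instance Definition _ p := [isSub for @tangent_val p].
HB.instance Definition _ p := gen_eqMixin (tangent p).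
HB.instance Definition _ p := gen_choiceMixin (tangent p).

Fact derivation_submod_closed p : submod_closed (derivation_pred p).
Proof.
split=> [|c v w /asboolP[vl vM] /asboolP[wl wM]].
  by apply/asboolP; split=> *; rewrite ?mulr0 addr0.
apply/asboolP; split=> [a f g|f g].
  rewrite -[LHS]/(c * v (a *: f + g) + w (a *: f + g)) vl wl.
  rewrite -[(c *: v + w) f]/(c * v f + w f) -[(c *: v + w) g]/(c * v g + w g); ring.
rewrite -[LHS]/(c * v (f * g) + w (f * g)) vM wM.
rewrite -[(c *: v + w) f]/(c * v f + w f) -[(c *: v + w) g]/(c * v g + w g); ring.
Qed.
HB.instance Definition _ p := GRing.isSubmodClosed.Build R (C -> R^o)
  (derivation_pred p) (derivation_submod_closed p).
HB.instance Definition _ p := [SubChoice_isSubLmodule of tangent p by <:].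

Definition mkTangent p v (vP : derivation_at p v) : tangent p :=
  Tangent (asboolT vP : v \in derivation_pred p).

Lemma tangentP p (v : tangent p) : derivation_at p v.
Proof. by have /asboolP := tangent_valP v. Qed.

Lemma tangent_ext p (v w : tangent p) : (forall f, v f = w f) -> v = w.
Proof. by move=> vw; apply/val_inj/funext. Qed.

Lemma tangentD p (v w : tangent p) f : (v + w) f = v f + w f.
Proof. by []. Qed.

Lemma tangentZ p (c : R) (v : tangent p) f : (c *: v) f = c * v f.
Proof. by []. Qed.

Record vfield := VField {
  vfield_val :> forall p : M, tangent p;
  vfield_smooth : forall f : C, smooth (fun p => vfield_val p f) }.

Lemma vfield_ext (X Y : vfield) : (forall p, X p = Y p) -> X = Y.
Proof.
case: X Y => [X sX] [Y sY] /= XY; have e : X = Y by exact: functional_extensionality_dep.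
by case: _ / e in sY *; congr VField; exact: Prop_irrelevance.
Qed.

Definition vapp (X : vfield) (f : C) : C := smoothE (vfield_smooth X f).

Fact vzero_smooth (f : C) : smooth (fun p => (0 : tangent p) f).
Proof. exact: smooth_funP (0 : C). Qed.
Definition vzero : vfield := VField vzero_smooth.

Fact vadd_smooth (X Y : vfield) (f : C) : smooth (fun p => (X p + Y p) f).
Proof. exact: smooth_funP (vapp X f + vapp Y f). Qed.
Definition vadd (X Y : vfield) : vfield := VField (vadd_smooth X Y).

Fact vscale_smooth (c : R) (X : vfield) (f : C) :
  smooth (fun p => (c *: X p) f).
Proof. exact: smooth_funP (c *: vapp X f). Qed.
Definition vscale (c : R) (X : vfield) : vfield := VField (vscale_smooth c X).

Definition vopp (X : vfield) : vfield := vscale (-1) X.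

HB.instance Definition _ := gen_eqMixin vfield.
HB.instance Definition _ := gen_choiceMixin vfield.

Fact vaddA : associative vadd.
Proof. by move=> X Y Z; apply: vfield_ext => p /=; rewrite addrA. Qed.
Fact vaddC : commutative vadd.
Proof. by move=> X Y; apply: vfield_ext => p /=; rewrite addrC. Qed.
Fact vadd0 : left_id vzero vadd.
Proof. by move=> X; apply: vfield_ext => p /=; rewrite add0r. Qed.
Fact vaddN : left_inverse vzero vopp vadd.
Proof. by move=> X; apply: vfield_ext => p /=; rewrite scaleN1r addNr. Qed.
HB.instance Definition _ := GRing.isZmodule.Build vfield vaddA vaddC vadd0 vaddN.

Fact vscaleA (a b : R) (X : vfield) : vscale a (vscale b X) = vscale (a * b) X.
Proof. by apply: vfield_ext => p /=; rewrite scalerA. Qed.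
Fact vscale1 : left_id 1 vscale.
Proof. by move=> X; apply: vfield_ext => p /=; rewrite scale1r. Qed.
Fact vscaleDr : right_distributive vscale +%R.
Proof. by move=> c X Y; apply: vfield_ext => p /=; rewrite scalerDr. Qed.
Fact vscaleDl (X : vfield) : {morph vscale^~ X : a b / a + b}.
Proof. by move=> a b; apply: vfield_ext => p /=; rewrite scalerDl. Qed.
HB.instance Definition _ :=
  GRing.Zmodule_isLmodule.Build R vfield vscaleA vscale1 vscaleDr vscaleDl.

Fact fscale_smooth (h : C) (X : vfield) (f : C) :
  smooth (fun p => (h p *: X p) f).
Proof. exact: smooth_funP (h * vapp X f). Qed.
Definition fscale (h : C) (X : vfield) : vfield := VField (fscale_smooth h X).

Definition bracket_at (X Y : vfield) (p : M) (f : C) : R^o :=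
  X p (vapp Y f) - Y p (vapp X f).

Fact bracket_derivation X Y p : derivation_at p (bracket_at X Y p).
Proof.
have vappL Z (c : R) f g : vapp Z (c *: f + g) = c *: vapp Z f + vapp Z g.
  by apply: smooth_fun_ext => q; have [h _] := tangentP (Z q); exact: h.
have vappM Z f g : vapp Z (f * g) = f * vapp Z g + g * vapp Z f.
  by apply: smooth_fun_ext => q; have [_ h] := tangentP (Z q); exact: h.
have [Xl XM] := tangentP (X p); have [Yl YM] := tangentP (Y p).
have XD f g : X p (f + g) = X p f + X p g by have := Xl 1 f g; rewrite scale1r mul1r.
have YD f g : Y p (f + g) = Y p f + Y p g by have := Yl 1 f g; rewrite scale1r mul1r.
rewrite /bracket_at; split=> [c f g|f g].
  rewrite !vappL Xl Yl; ring.
rewrite !vappM XD YD !XM !YM /=; ring.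
Qed.

Fact bracket_smooth X Y (f : C) :
  smooth (fun p => mkTangent (bracket_derivation X Y p) f).
Proof. exact: smooth_funP (vapp X (vapp Y f) - vapp Y (vapp X f)). Qed.

Definition bracket (X Y : vfield) : vfield := VField (bracket_smooth X Y).

End tangent.

Arguments derivation_at {R E} M p v.
Arguments tangent {R E} M p.

(** * The product of a manifold with the line *)

Lemma open_prod (S T : topologicalType) (A : set S) (B : set T) :
  open A -> open B -> open (A `*` B).
Proof.
move=> oA oB; rewrite openE => -[x y] [/= Ax By]; exists (A, B) => //=.
by split; apply: open_nbhs_nbhs.
Qed.

Lemma hausdorff_prod (S T : topologicalType) :
  hausdorff_space S -> hausdorff_space T -> hausdorff_space (S * T)%type.
Proof.
move=> hS hT [x y] [x' y'] cl; congr (_, _).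
- apply: hS => A B Ax Bx'.
  have [||z [/= [Az _] [Bz _]]] := cl (A `*` setT) (B `*` setT).
  + by exists (A, setT) => //; split=> //; exact: filterT.
  + by exists (B, setT) => //; split=> //; exact: filterT.
  by exists z.1.
- apply: hT => A B Ay By'.
  have [||z [/= [_ Az] [_ Bz]]] := cl (setT `*` A) (setT `*` B).
  + by exists (setT, A) => //; split=> //; exact: filterT.
  + by exists (setT, B) => //; split=> //; exact: filterT.
  by exists z.2.
Qed.

Lemma second_countable_prod (S T : topologicalType) :
  @second_countable S -> @second_countable T ->
  @second_countable (S * T)%type.
Proof.
move=> [A cA [oA nA]] [B cB [oB nB]].
exists ((fun UV : set S * set T => UV.1 `*` UV.2) @` (A `*` B)).
  by apply: sub_countable (card_image_le _ _) _; exact: countableX.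
split=> [_ [[U V] /= [AU BV] <-]|[x y] W /= [[P Q] /= [Px Qy] PQW]].
  by apply: open_prod; [exact: oA|exact: oB].
have [U [AU Ux] UP] := nA x P Px; have [V [BV Vy] VQ] := nB y Q Qy.
exists (U `*` V); first by split=> //; exists (U, V).
by move=> [u v] [/= Uu Vv]; apply: PQW; split; [exact: UP|exact: VQ].
Qed.

Lemma second_countable_R (R : realType) : @second_countable R^o.
Proof.
pose I (q : rat * rat) : set R^o := [set x : R | ratr q.1 < x < ratr q.2].
exists (I @` setT).
  by apply: sub_countable (card_image_le _ _) _; exact: countableP.
split=> [_ [q _ <-]|x W /= /nbhs_ballP[e /= e0 eW]].
  rewrite /I (_ : [set _ | _] = `](ratr q.1 : R), (ratr q.2)[%classic).
    exact: interval_open.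
  by apply/seteqP; split=> y; rewrite /= in_itv.
have [|a] := @rat_in_itvoo R (x - e) x; first by rewrite ltrBlDr ltrDl.
rewrite in_itv/= => /andP[a1 a2].
have [|b] := @rat_in_itvoo R x (x + e); first by rewrite ltrDl.
rewrite in_itv/= => /andP[b1 b2].
exists (I (a, b)); first by split; [exists (a, b)|rewrite /I/= a2 b1].
move=> y /= /andP[ya yb]; apply: eW; rewrite /ball/= ltr_distlC.
by rewrite (lt_trans a1 ya) (lt_trans yb b2).
Qed.

Section product.
Context {R : realType} {E : normedModType R}.

Section product_chart.
Variables (T : topologicalType) (a : chart E T).

Let dom : set (T * R^o) := chart_dom a `*` setT.
Let map (q : T * R^o) : E * R^o := (chart_map a q.1, q.2).
Let inv (x : E * R^o) : T * R^o := (chart_inv a x.1, x.2).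

Let imgE : map @` dom = chart_img a `*` setT.
Proof.
apply/seteqP; split=> [_ [[p t] [/= ap _] <-]|[x t] [/= [p ap <-] _]].
  by split=> //=; exists p.
by exists (p, t).
Qed.

Fact chart_line_dom_open : open dom.
Proof. by apply: open_prod; [exact: chart_dom_open|exact: openT]. Qed.

Fact chart_line_img_open : open (map @` dom).
Proof.
by rewrite imgE; apply: open_prod; [exact: chart_img_open|exact: openT].
Qed.

Fact chart_line_map_cts q : dom q -> {for q, continuous map}.
Proof.
move=> [dq _].
have c : {for q, continuous (chart_map a \o fst)}.
  by apply: continuous_comp; [exact: cvg_fst|exact: chart_map_cts].
by apply: (@cvg_pair _ _ _ _ (nbhs (chart_map a q.1)) (nbhs q.2)); [exact: c|exact: cvg_snd].
Qed.

Fact chart_line_inv_cts x : (map @` dom) x -> {for x, continuous inv}.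
Proof.
rewrite imgE => -[ax _].
have c : {for x, continuous (chart_inv a \o fst)}.
  by apply: continuous_comp; [exact: cvg_fst|exact: chart_inv_cts].
by apply: (@cvg_pair _ _ _ _ (nbhs (chart_inv a x.1)) (nbhs x.2)); [exact: c|exact: cvg_snd].
Qed.

Fact chart_line_mapK q : dom q -> inv (map q) = q.
Proof. by case: q => p t [/= dp _]; rewrite /inv /map/= chart_mapK. Qed.

Definition chart_line : chart (E * R^o)%type (T * R^o)%type :=
  Chart chart_line_dom_open chart_line_img_open chart_line_map_cts
    chart_line_inv_cts chart_line_mapK.

Lemma chart_line_imgE : chart_img chart_line = chart_img a `*` setT.
Proof. exact: imgE. Qed.

End product_chart.

Variable M : manifold E.

Let atlas_line : set (chart (E * R^o)%type (M * R^o)%type) :=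
  @chart_line M @` atlas M.

Fact line_cover (q : (M * R^o)%type) :
  exists2 a, atlas_line a & chart_dom a q.
Proof.
have [a aM ap] := atlas_cover q.1.
by exists (chart_line a); [exists a|split].
Qed.

Fact line_compat a b : atlas_line a -> atlas_line b ->
  smooth_on (chart_map a @` (chart_dom a `&` chart_dom b))
            (chart_map b \o chart_inv a).
Proof.
move=> [{}a aM <-] [{}b bM <-] k.
set U := chart_map a @` (chart_dom a `&` chart_dom b).
have oU : open U.
  rewrite (_ : U = chart_img a `&` chart_inv a @^-1` chart_dom b).
    rewrite openE => x [ax bx]; apply: filterI.
      exact: open_nbhs_nbhs (conj (chart_img_open a) ax).
    apply: (chart_inv_cts ax); apply: open_nbhs_nbhs.
    by split=> //; exact: chart_dom_open.
  apply/seteqP; split=> [_ [p [ap bp] <-]|x [[p ap <-] /=]].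
    by split; [exists p|rewrite /= chart_mapK].
  by rewrite chart_mapK// => bp; exists p.
have -> : chart_map (chart_line a) @`
            (chart_dom (chart_line a) `&` chart_dom (chart_line b))
          = fst @^-1` U.
  apply/seteqP; split=> [_ [p [[ap _] [bp _]] <-]|[x t] [p [ap bp] /= <-]].
    by exists p.1.
  by exists (p, t).
have oU' : open (fst @^-1` U : set (E * R^o)%type).
  by apply: open_comp => // x _; exact: cvg_fst.
apply: (@Ck_pair _ _ _ _ _ _ (chart_map b \o chart_inv a \o fst) snd) => //.
  apply: Ck_comp_affine (@is_diff_fst _ _ _) _ => //.
  exact: atlas_compat.
have := @Ck_comp_affine _ _ _ _ k setT id _ _ openT (@is_diff_snd _ E R^o).
by move=> /(_ (Ck_id _ _)); apply: Ck_sub.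
Qed.

Definition manifold_line : manifold (E * R^o)%type :=
  @Manifold R (E * R^o)%type (M * R^o)%type atlas_line
    (hausdorff_prod (@manifold_hausdorff _ _ M) (@norm_hausdorff _ R^o))
    (second_countable_prod (@manifold_second_countable _ _ M)
                           (second_countable_R R))
    line_cover line_compat.

End product.

(** * The almost complex structure of M x R *)

Section tangent_product.
Context {R : realType} {E : normedModType R} (M : manifold E).
Local Notation MR := (manifold_line M).

Fact pullback_fst_smooth (f : smooth_fun M) :
  smooth (M := MR) (fun q : M * R^o => f q.1).
Proof.
move=> _ [a aM <-] k; rewrite chart_line_imgE.
have := Ck_comp_affine (chart_img_open a) (@is_diff_fst _ E R^o)
  (smooth_funP f aM k).
by apply: Ck_sub => x [].
Qed.
Definition pullback_fst (f : smooth_fun M) : smooth_fun MR :=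
  smoothE (pullback_fst_smooth f).

Fact line_time_smooth : smooth (M := MR) (fun q : M * R^o => q.2).
Proof.
move=> _ [a aM <-] k; rewrite chart_line_imgE.
have := @Ck_comp_affine _ _ _ _ k setT id _ _ openT (@is_diff_snd _ E R^o).
by move=> /(_ (Ck_id _ _)); apply: Ck_sub.
Qed.
Definition line_time : smooth_fun MR := smoothE line_time_smooth.

Fact line_slice_smooth (F : smooth_fun MR) (t : R) :
  smooth (M := M) (fun p => F (p, t)).
Proof.
move=> a aM k; have aMR : atlas MR (chart_line a) by exists a.
have d (x : E) : is_diff x (fun x => (x, t : R^o)) (fun v => (v, 0)).
  exact: is_diff_pair.
have := Ck_comp_affine (chart_img_open (chart_line a)) d (smooth_funP F aMR k).
apply: Ck_sub => x ax; suff : chart_img (chart_line a) (x, t : R^o) by [].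
by rewrite chart_line_imgE.
Qed.
Definition line_slice (F : smooth_fun MR) (t : R) : smooth_fun M :=
  smoothE (line_slice_smooth F t).

Lemma derivable_time (F : smooth_fun MR) (p : M) (t : R) :
  derivable (fun s : R^o => F (p, s)) t 1.
Proof.
have [a aM ap] := atlas_cover p; have aMR : atlas MR (chart_line a) by exists a.
pose x := chart_map a p.
have -> : (fun s : R^o => F (p, s))
          = (F \o chart_inv (chart_line a)) \o (fun s : R^o => (x, s)).
  by apply/funext => s /=; rewrite /x chart_mapK.
apply: diff_derivable; apply: differentiable_comp.
  exact: differentiable_pair.
apply: (smooth_on_differentiable (smooth_funP F aMR)).
by rewrite chart_line_imgE; split=> //; exists p.
Qed.

(* A tangent vector w at (p,t) is X + f d/dt with X = dfst w and f = dtime w;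
   tan_pair X f is the converse construction. *)
Definition tan_fst (q : M * R^o) (w : tangent MR q) (f : smooth_fun M) : R^o :=
  w (pullback_fst f).

Fact tan_fst_derivation q (w : tangent MR q) : derivation_at M q.1 (tan_fst w).
Proof.
have [wl wM] := tangentP w; split=> [c f g|f g]; rewrite /tan_fst -?wl -?wM.
  by congr (w _); apply: smooth_fun_ext.
have := wM (pullback_fst f) (pullback_fst g) => /= <-.
by congr (w _); apply: smooth_fun_ext.
Qed.
Definition dfst q (w : tangent MR q) : tangent M q.1 :=
  mkTangent (tan_fst_derivation w).

Definition dtime q (w : tangent MR q) : R := w line_time.

Definition tan_pair_at (q : M * R^o) (x : tangent M q.1) (c : R)
    (F : smooth_fun MR) : R^o :=
  x (line_slice F q.2) + c * derive1 (fun s : R^o => F (q.1, s)) q.2.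

Fact tan_pair_derivation (q : M * R^o) (x : tangent M q.1) (c : R) :
  derivation_at MR q (tan_pair_at x c).
Proof.
have scE (u : R) (v : R^o) : u *: v = u * v by [].
have [xl xM] := tangentP x; split=> [a F G|F G].
- rewrite /tan_pair_at.
  have -> : line_slice (a *: F + G) q.2 = a *: line_slice F q.2 + line_slice G q.2.
    exact: smooth_fun_ext.
  have -> : (fun s : R^o => (a *: F + G) (q.1, s))
      = a *: (fun s : R^o => F (q.1, s)) + (fun s : R^o => G (q.1, s)) by [].
  have dF := @derivable_time F q.1 q.2; have dG := @derivable_time G q.1 q.2.
  rewrite xl !derive1E deriveD ?deriveZ//; last exact: derivableZ.
  rewrite !(scE a); ring.
- rewrite /tan_pair_at.
  have -> : line_slice (F * G) q.2 = line_slice F q.2 * line_slice G q.2.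
    exact: smooth_fun_ext.
  have -> : (fun s : R^o => (F * G) (q.1, s))
      = (fun s : R^o => F (q.1, s)) * (fun s : R^o => G (q.1, s)) by [].
  have dF := @derivable_time F q.1 q.2; have dG := @derivable_time G q.1 q.2.
  rewrite xM !derive1E deriveM//= -!surjective_pairing.
  rewrite !scE; ring.
Qed.
Definition tan_pair q (x : tangent M q.1) (c : R) : tangent MR q :=
  mkTangent (tan_pair_derivation x c).

Lemma dfst_pair q (x : tangent M q.1) c : dfst (tan_pair x c) = x.
Proof.
apply: tangent_ext => f; rewrite /= /tan_fst/= /tan_pair_at.
have -> : line_slice (pullback_fst f) q.2 = f by exact: smooth_fun_ext.
by rewrite /= derive1_cst mulr0 addr0.
Qed.

Lemma dtime_pair q (x : tangent M q.1) c : dtime (tan_pair x c) = c.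
Proof.
rewrite /dtime/= /tan_pair_at.
have -> : line_slice line_time q.2 = (q.2 : R) *: (1 : smooth_fun M).
  by apply: smooth_fun_ext => p; rewrite /= -[RHS]/(q.2 * 1) mulr1.
have [xl xM] := tangentP x.
have x1 : x 1 = 0.
  have := xM 1 1; rewrite mulr1 /= mul1r => /eqP.
  by rewrite -subr_eq0 opprD addrA subrr sub0r oppr_eq0 => /eqP.
have -> : x ((q.2 : R) *: (1 : smooth_fun M)) = 0.
  have x0 : x 0 = 0.
    by have := xl (-1) 1 1; rewrite scaleN1r addNr mulN1r addNr.
  by have := xl q.2 1 0; rewrite !addr0 x0 x1 mulr0 addr0.
by rewrite add0r (_ : (fun _ => _) = id)// derive1E derive_id mulr1.
Qed.

End tangent_product.

(** * Tensor fields *)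

Section tensors.
Context {R : realType} {E : normedModType R} (M : manifold E).
Local Notation C := (smooth_fun M).

Record tensor11 := Tensor11 {
  tensor11_val :> forall p : M, {linear tangent M p -> tangent M p};
  tensor11_smooth : forall (X : vfield M) (f : C),
    smooth (fun p => tensor11_val p (X p) f) }.

Definition tensor_app (A : tensor11) (X : vfield M) : vfield M :=
  VField (tensor11_smooth A X).

Record oneform := OneForm {
  oneform_val :> forall p : M, {linear tangent M p -> R^o};
  oneform_smooth : forall X : vfield M, smooth (fun p => oneform_val p (X p)) }.

Definition form_app (eta : oneform) (X : vfield M) : C :=
  smoothE (oneform_smooth eta X).

Record pseudo_metric := PseudoMetric {
  metric_val :> forall p : M, tangent M p -> tangent M p -> R;
  metric_linear : forall (p : M) (c : R) (x y z : tangent M p),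
    metric_val (c *: x + y) z = c * metric_val x z + metric_val y z;
  metric_sym : forall (p : M) (x y : tangent M p),
    metric_val x y = metric_val y x;
  metric_nondegenerate : forall (p : M) (x : tangent M p),
    (forall y, metric_val x y = 0) -> x = 0;
  metric_smooth : forall X Y : vfield M,
    smooth (fun p => metric_val (X p) (Y p)) }.

Definition metric_app (g : pseudo_metric) (X Y : vfield M) : C :=
  smoothE (metric_smooth g X Y).

Definition dform (eta : oneform) (X Y : vfield M) : C :=
  2^-1 *: (vapp X (form_app eta Y) - vapp Y (form_app eta X) - form_app eta (bracket X Y)).

Definition lie_tensor (xi : vfield M) (A : tensor11) (X : vfield M) : vfield M :=
  bracket xi (tensor_app A X) - tensor_app A (bracket xi X).

Definition lie_metric (xi : vfield M) (g : pseudo_metric) (X Y : vfield M) : C :=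
  vapp xi (metric_app g X Y) - metric_app g (bracket xi X) Y - metric_app g X (bracket xi Y).

End tensors.

(** * Levi-Civita connection and curvature *)

Section connection.
Context {R : realType} {E : normedModType R} (M : manifold E).
Implicit Types (nabla : vfield M -> vfield M -> vfield M) (X Y Z : vfield M).

Record levi_civita (g : pseudo_metric M) nabla : Prop := LeviCivita {
  nabla_linear : forall (f : smooth_fun M) X Y Z,
    nabla (fscale f X + Y) Z = fscale f (nabla X Z) + nabla Y Z;
  nabla_additive : forall X Y Z, nabla X (Y + Z) = nabla X Y + nabla X Z;
  nabla_leibniz : forall X (f : smooth_fun M) Y,
    nabla X (fscale f Y) = fscale (vapp X f) Y + fscale f (nabla X Y);
  nabla_torsion_free : forall X Y, nabla X Y - nabla Y X = bracket X Y;
  nabla_metric : forall X Y Z,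
    vapp X (metric_app g Y Z) = metric_app g (nabla X Y) Z + metric_app g Y (nabla X Z) }.

Definition covariant nabla X (A : tensor11 M) Y : vfield M :=
  nabla X (tensor_app A Y) - tensor_app A (nabla X Y).

Definition codazzi nabla (A : tensor11 M) : Prop :=
  forall X Y, covariant nabla X A Y = covariant nabla Y A X.

Definition curvature nabla X Y Z : vfield M :=
  nabla X (nabla Y Z) - nabla Y (nabla X Z) - nabla (bracket X Y) Z.

(* The e i are defined on all of M, so that they can be fed to nabla; only their
   restrictions to U matter. *)
Record pseudo_orthonormal_frame m (g : pseudo_metric M) (U : set M)
    (e : 'I_m -> vfield M) (eps : 'I_m -> R) : Prop := PseudoOrthonormalFrame {
  frame_open : open U;
  frame_sign : forall i, eps i = 1 \/ eps i = -1;
  frame_orthonormal : forall p, U p -> forall i j,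
    g p (e i p) (e j p) = if i == j then eps i else 0;
  frame_span : forall p, U p -> forall x : tangent M p,
    exists c : 'I_m -> R, x = \sum_i c i *: e i p }.

(* S(X,Y) = sum_i eps_i g(R(e_i,X)Y,e_i) on the domain of a local frame around
   each point; by tensoriality the value does not depend on the frame. *)
Definition is_ricci m (g : pseudo_metric M) nabla
    (S : vfield M -> vfield M -> smooth_fun M) : Prop :=
  forall p : M, exists (U : set M) (e : 'I_m -> vfield M) (eps : 'I_m -> R),
    [/\ U p, pseudo_orthonormal_frame g U e eps &
      forall X Y q, U q ->
        S X Y q = \sum_i eps i * g q (curvature nabla (e i) X Y q) (e i q)].

Definition is_ricci_operator m (g : pseudo_metric M) nabla (Q : tensor11 M) :=
  is_ricci m g nabla (fun X Y => metric_app g (tensor_app Q X) Y).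

End connection.

Arguments is_ricci {R E M} m g nabla S.
Arguments is_ricci_operator {R E M} m g nabla Q.

(** * Contact and Sasakian pseudo-metric structures *)

(* Integrability of an almost complex structure is the vanishing of its Nijenhuis
   tensor.  JV and JW stand for the vector fields q |-> J (V q), q |-> J (W q). *)
Definition integrable_structure (R : realType) (E : normedModType R)
    (N : manifold E)
    (J : forall q : N, tangent N q -> tangent N q) : Prop :=
  forall V W JV JW : vfield N,
    (forall q, JV q = J q (V q)) -> (forall q, JW q = J q (W q)) ->
    forall q, bracket JV JW q - J q (bracket JV W q) - J q (bracket V JW q)
              - bracket V W q = 0.

Section contact.
Context {R : realType} {E : normedModType R} (M : manifold E).


(* J(X, f d/dt) = (phi X - f xi, eta(X) d/dt) *)
Definition line_structure (phi : tensor11 M) (xi : vfield M) (eta : oneform M)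
    (q : manifold_line M) (w : tangent (manifold_line M) q) :
    tangent (manifold_line M) q :=
  tan_pair (phi q.1 (dfst w) - dtime w *: xi q.1) (eta q.1 (dfst w)).

Record almost_contact_pseudo_metric (phi : tensor11 M) (xi : vfield M)
    (eta : oneform M) (g : pseudo_metric M) (eps : R) : Prop :=
  AlmostContactPseudoMetric {
  acpm_sign : eps = 1 \/ eps = -1;
  acpm_phi2 : forall p (x : tangent M p), phi p (phi p x) = - x + eta p x *: xi p;
  acpm_eta_xi : forall p, eta p (xi p) = 1;
  acpm_phi_xi : forall p, phi p (xi p) = 0;
  acpm_eta_phi : forall p (x : tangent M p), eta p (phi p x) = 0;
  acpm_compat : forall p (x y : tangent M p),
    g p (phi p x) (phi p y) = g p x y - eps * eta p x * eta p y }.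

Definition contact_pseudo_metric (phi : tensor11 M) (xi : vfield M)
    (eta : oneform M) (g : pseudo_metric M) (eps : R) : Prop :=
  almost_contact_pseudo_metric phi xi eta g eps /\
  forall X Y : vfield M, dform eta X Y = metric_app g X (tensor_app phi Y).

Definition sasakian_pseudo_metric (phi : tensor11 M) (xi : vfield M)
    (eta : oneform M) (g : pseudo_metric M) (eps : R) : Prop :=
  contact_pseudo_metric phi xi eta g eps /\
  integrable_structure (line_structure phi xi eta).

Definition contact_h (phi : tensor11 M) (xi X : vfield M) : vfield M :=
  2^-1 *: lie_tensor xi phi X.

End contact.

(* Main.v *)
Require Import Defs.
From HB Require Import structures.
From mathcomp Require Import all_boot all_order all_algebra.
From mathcomp Require Import ring lra.
From mathcomp Require Import all_classical all_reals all_analysis.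
Set Implicit Arguments.
Unset Strict Implicit.
Unset Printing Implicit Defensive.
Import Order.TTheory GRing.Theory Num.Theory.
Import numFieldNormedType.Exports.
Local Open Scope classical_set_scope.
Local Open Scope ring_scope.

(** The proof has an analytic and an algebraic part.

Tangent vectors are point derivations of the algebra of smooth functions.  By
Hadamard's lemma (hadamard) and cut-off functions (cutoff), a tangent vector
is a combination of the partial derivatives of a chart (derivation_chart).
Hence every tangent vector is the value of a global field (field_extension), so
that the metric is nondegenerate already against fields, and a tangent vector
of M x R is determined by its components along M and along d/dt
(tangent_line_ext).

On a contact pseudo-metric manifold write A X = nabla_X xi and
T(X;Y,Z) = g((nabla_X phi) Y, Z), which is cov_phi below.  From d eta = Phi and
the definition of tau, A = tau / 2 - eps phi (nabla_xi).  The form T is skew in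
Y and Z, its cyclic sum vanishes because d (d eta) = 0 (cov_phi_cyclic), and
differentiating phi^2 = - I + eta xi tells what happens when phi moves from Y
to Z (cov_phi_phi).  The cyclic identity with one argument xi then yields
phi tau = - tau phi and nabla_xi phi = 0 (phi_tau, covariant_xi_phi), so
h = phi tau / 2 and h^2 = tau^2 / 4.

Let tau be a Codazzi tensor.  With Y = xi the Codazzi equation reads
nabla_xi tau = eps tau phi - tau^2 / 2.  Since tau anticommutes with phi and
nabla_xi phi = 0, so does nabla_xi tau; but tau^2 commutes with phi, and
therefore tau^2 = 0 (tau_sqr).  Moreover the Codazzi equation removes tau from
R(X,Y) xi = (nabla_X A) Y - (nabla_Y A) X, and the cyclic identity turns the
rest into g(R(X,Y) xi, Z) = eps T(Z;X,Y) (codazzi_curvature_xi).  Contracting,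
S(xi, Y) is eps times the divergence of phi at Y, and this divergence is
2 n eps eta(Y) (div_phiE).  This is the first statement.

By the same formula, if tau is a Codazzi tensor, then the curvature condition of
the second statement says that T is the form of g(X,Y) xi - eps eta(Y) X
(sasakian_identity).  Conversely, that identity forces tau = 0, which is a
Codazzi tensor.  It remains to compare it with the integrability of J.  Viewing a
field on M x R as a time-dependent field on M with a time-dependent function,
the time derivatives cancel in the Nijenhuis tensor of J, and what is left is
the normality tensor of (phi, xi, eta), the Lie derivative of phi along xi, and
two expressions that vanish on every contact pseudo-metric manifold
(dfst_line_nijenhuis, dtime_line_nijenhuis).  If the normality tensor vanishes,
evaluating it at xi gives tau = 0, and the identity follows from the symmetries
of T (sasakian_identity_of_normality). *)

(** * Operations on smooth maps *)

Lemma continuous_sum (R : realType) (T : topologicalType) (V : normedModType R)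
    (I : Type) (s : seq I) (f : I -> T -> V) (x : T) :
  (forall i, {for x, continuous (f i)}) ->
  {for x, continuous (fun y => \sum_(i <- s) f i y)}.
Proof.
move=> cf; rewrite (_ : (fun _ => _) = \sum_(i <- s) f i); last first.
  by apply/funext => y; rewrite fct_sumE.
apply: (big_ind (fun g : T -> V => {for x, continuous g})) => [|g h|i _].
- exact: cst_continuous.
- exact: continuousD.
- exact: cf.
Qed.

Section Ck_theory.
Context {R : realType}.
Implicit Types V W : normedModType R.

Lemma Ck_local V W k (U : set V) (f : V -> W) :
  (forall x, U x -> exists2 U', U' x & Ck k U' f) -> Ck k U f.
Proof.
elim: k f => [|k IH] f fU; first by move=> x /fU[U' U'x /(_ _ U'x)].
split=> [x /fU[U' U'x [/(_ _ U'x)]]//|v].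
by apply: IH => x /fU[U' U'x [_ /(_ v)]]; exists U'.
Qed.

Lemma Ck_near V W k (U : set V) (f g : V -> W) x : open U -> U x ->
  {near x, f =1 g} -> Ck k U g -> exists2 U', U' x & Ck k U' f.
Proof.
move=> oU Ux /nbhs_ballP[r /= r0 fg] cg; pose U' := U `&` ball x r.
have oU' : open U' by apply: openI => //; exact: ball_open.
exists U'; first by split=> //; exact: ballxx.
apply: (eq_Ck oU' (f := g)); last by apply: Ck_sub cg => y [].
by move=> y [_ /fg].
Qed.

Lemma Ck_sum V W k (U : set V) (I : finType) (f : I -> V -> W) : open U ->
  (forall i, Ck k U (f i)) -> Ck k U (fun x => \sum_i f i x).
Proof.
move=> oU cf; rewrite (_ : (fun _ => _) = \sum_i f i); last first.
  by apply/funext => x; rewrite fct_sumE.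
by apply: big_ind => [|? ?|//]; [exact: Ck_cst|exact: CkD].
Qed.

Lemma Ck_linear V W W' k (U : set V) (f : V -> W) (L : {linear W -> W'}) :
  open U -> continuous L -> Ck k U f -> Ck k U (L \o f).
Proof.
move=> oU cL; elim: k f => [|k IH] f.
  by move=> cf x Ux; apply: continuous_comp; [exact: cf|exact: cL].
move=> [df cf]; have dL y : differentiable L y by exact: linear_differentiable.
split=> [x Ux|v]; first exact: differentiable_comp (df x Ux) (dL _).
apply: eq_Ck (IH _ (cf v)) => // x Ux /=.
have dfx := df x Ux.
have dLfx := differentiable_comp dfx (dL (f x)).
by rewrite [RHS](deriveE _ dLfx) (diff_comp dfx (dL _)) /= (diff_lin _ cL)
  (deriveE _ dfx).
Qed.

Lemma Ck_inv V k (U : set V) (f : V -> R^o) : open U ->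
  (forall x, U x -> f x != 0) -> Ck k U f -> Ck k U (fun x => (f x)^-1).
Proof.
move=> oU f0; elim: k f f0 => [|k IH] f f0.
  by move=> cf x Ux; apply: continuousV; [exact: f0|exact: cf].
move=> fk; have [df cf] := fk.
split=> [x Ux|v]; first by apply: differentiableV; [exact: df|exact: f0].
apply: (@eq_Ck _ _ _ _ _
   ((-1 : R) *: ((fun x => (f x)^-1) * (fun x => (f x)^-1) * 'D_v f))) => //.
  move=> x Ux; rewrite deriveV; [|exact: f0|exact/diff_derivable/df].
  rewrite -[LHS]/(-1 * (((f x)^-1 * (f x)^-1) * 'D_v f x)).
  rewrite -[RHS]/(- (f x ^- 2) * 'D_v f x).
  by rewrite expr2 invfM; ring.
have ck : Ck k U (fun x => (f x)^-1) by apply: IH => //; exact: CkW fk.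
by apply: CkZ => //; apply: CkM => //; [exact: CkM|exact: cf].
Qed.

End Ck_theory.

(** Finite dimension in the form in which it is used: finitely many continuous
linear functions that recover every vector.  This covers row vectors and their
products with the line alike. *)
Record coordinates (R : realType) (E : normedModType R) := Coordinates {
  coord_idx : finType;
  coord_vec : coord_idx -> E;
  coord : coord_idx -> {linear E -> R^o};
  coord_cts : forall i, continuous (coord i);
  coord_sum : forall x, x = \sum_i coord i x *: coord_vec i }.

Section coordinates_theory.
Context {R : realType} {E : normedModType R} (c : coordinates E).
Local Notation I := (coord_idx c).
Local Notation e := (@coord_vec _ _ c).
Local Notation l := (@coord _ _ c).

Lemma derive_coord (f : E -> R^o) x v : differentiable f x ->
  'D_v f x = \sum_i l i v * 'D_(e i) f x.
Proof.
move=> df; rewrite deriveE// {1}(coord_sum c v) linear_sum.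
by apply: eq_bigr => i _; rewrite linearZ deriveE.
Qed.

(** The derivative of the composite is a sum of products of maps of lower order,
so the induction only needs closure under products; the coordinates serve to
write the differential of g as such a sum. *)
Lemma Ck_comp (V : normedModType R) k (U : set V) (U' : set E) (f : V -> E) (g : E -> R^o) :
  open U -> (forall x, U x -> U' (f x)) ->
  Ck k U f -> Ck k U' g -> Ck k U (g \o f).
Proof.
move=> oU UU'; elim: k f g UU' => [|k IH] f g UU'.
  by move=> cf cg x Ux; apply: continuous_comp; [exact: cf|exact/cg/UU'].
move=> fk gk; have [df cf] := fk; have [dg cg] := gk; split=> [x Ux|v].
  by apply: differentiable_comp; [exact: df|exact/dg/UU'].
apply: (@eq_Ck _ _ _ _ _
   (fun x => \sum_i ((l i \o 'D_v f) * ('D_(e i) g \o f)) x)) => //.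
  move=> x Ux; have dfx := df x Ux; have dgx := dg _ (UU' _ Ux).
  rewrite [RHS](deriveE _ (differentiable_comp dfx dgx)) (diff_comp dfx dgx) /=.
  by rewrite -(deriveE _ dgx) (derive_coord _ dgx) -(deriveE _ dfx).
apply: Ck_sum => // i; apply: CkM => //.
  by apply: Ck_linear => //; [exact: coord_cts|exact: cf].
by apply: (IH f) => //; [exact: CkW fk|exact: cg].
Qed.

End coordinates_theory.

(** * Hadamard's lemma *)

Section unit_integral.
Context {R : realType}.
Local Notation mu := (@lebesgue_measure R).

(** Continuity at every point of the segment as functions on the whole line, which
is what compositions with maps defined near the segment provide. *)
Definition segment_cts (u : R -> R) :=
  forall t, t \in `[0, 1] -> {for t, continuous u}.

Definition mean01 (u : R -> R) : R := \int[mu]_(t in `[0, 1]) u t.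

Lemma segment_cts_integrable u : segment_cts u ->
  mu.-integrable `[0, 1]%classic (EFin \o u).
Proof.
move=> cu; apply: continuous_compact_integrable; first exact: segment_compact.
by apply: continuous_in_subspaceT => t /set_mem; exact: cu.
Qed.

Lemma segment_ctsZ a u : segment_cts u -> segment_cts (fun t => a * u t).
Proof. by move=> cu t /cu c; apply: continuousM => //; exact: cst_continuous. Qed.

Lemma segment_ctsB u v :
  segment_cts u -> segment_cts v -> segment_cts (fun t => u t - v t).
Proof. by move=> cu cv t t01; apply: continuousB; [exact: cu|exact: cv]. Qed.

Lemma segment_cts_sum (I : finType) (u : I -> R -> R) :
  (forall i, segment_cts (u i)) -> segment_cts (fun t => \sum_i u i t).
Proof.
by move=> cu t t01; apply: (@continuous_sum R R^o R^o) => i; exact: cu.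
Qed.

Lemma mean01B u v : segment_cts u -> segment_cts v ->
  mean01 (fun t => u t - v t) = mean01 u - mean01 v.
Proof. by move=> cu cv; apply: RintegralB => //; exact: segment_cts_integrable. Qed.

Lemma mean01D u v : segment_cts u -> segment_cts v ->
  mean01 (fun t => u t + v t) = mean01 u + mean01 v.
Proof. by move=> cu cv; apply: RintegralD => //; exact: segment_cts_integrable. Qed.

Lemma mean01Z a u : segment_cts u -> mean01 (fun t => a * u t) = a * mean01 u.
Proof. by move=> cu; apply: RintegralZl => //; exact: segment_cts_integrable. Qed.

Lemma mean01_cst a : mean01 (cst a) = a.
Proof.
rewrite /mean01 Rintegral_cst//= lebesgue_measure_itv/= lte_fin ltr01.
by rewrite -EFinB/= subr0 mulr1.
Qed.

Lemma eq_mean01 u v : (forall t, t \in `[0, 1] -> u t = v t) ->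
  mean01 u = mean01 v.
Proof. by move=> uv; apply: eq_Rintegral => t /set_mem; exact: uv. Qed.

Lemma mean01_sum (I : finType) (u : I -> R -> R) :
  (forall i, segment_cts (u i)) ->
  mean01 (fun t => \sum_i u i t) = \sum_i mean01 (u i).
Proof.
move=> cu; have [s ->] : {s : seq I | index_enum I = s} by exists (index_enum I).
elim: s => [|i s IH].
  rewrite big_nil -[RHS]mean01_cst; apply: eq_mean01 => t _.
  by rewrite big_nil.
rewrite big_cons -IH -mean01D//.
  by apply: eq_mean01 => t _; rewrite big_cons.
by move=> t t01; apply: (@continuous_sum R R^o R^o) => j; exact: cu.
Qed.

Lemma mean01_le u M : segment_cts u -> (forall t, t \in `[0, 1] -> `|u t| <= M) ->
  `|mean01 u| <= M.
Proof.
move=> cu uM; apply: le_trans (le_normr_Rintegral _ _) _ => //.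
  exact: segment_cts_integrable.
rewrite -[leRHS]mean01_cst; apply: le_Rintegral => //.
- apply: (@segment_cts_integrable (fun t => `|u t|)) => t t01.
  by apply: continuous_comp; [exact: cu|exact: norm_continuous].
- by apply: segment_cts_integrable => t _; exact: cst_continuous.
Qed.

Lemma mean01_derive (u v : R -> R) : segment_cts v ->
  (forall t : R, t \in `[0, 1] -> is_derive t 1 u (v t)) -> mean01 v = u 1 - u 0.
Proof.
move=> cv du.
have cu t : t \in `[0, 1] -> {for t, continuous u}.
  move=> /du dut; apply: differentiable_continuous.
  by apply/derivable1_diffP.
rewrite /mean01 /Rintegral (@continuous_FTC2 _ v u)//.
- by apply: continuous_in_subspaceT => t /set_mem; exact: cv.
- split.
  + move=> t t01; have /du [] // : t \in `[0, 1].
    by apply: subset_itv_oo_cc t01.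
  + by apply: cvg_at_right_filter; apply: cu; rewrite in_itv/= lexx ler01.
  + by apply: cvg_at_left_filter; apply: cu; rewrite in_itv/= lexx ler01.
- move=> t t01; rewrite derive1E.
  have /du dut : t \in `[0, 1] by apply: subset_itv_oo_cc t01.
  exact: derive_val.
Qed.

End unit_integral.

Section frechet.
Context {R : realType} {V W : normedModType R}.

Lemma is_diff_eps (f : V -> W) (x : V) (L : {linear V -> W}) : continuous L ->
  (forall eps : R, 0 < eps ->
     \forall h \near (0 : V), `|f (x + h) - f x - L h| <= eps * `|h|) ->
  is_diff x f L.
Proof.
move=> cL fL.
have z : f \o shift x = cst (f x) + L +o_ 0 id.
  apply/eqaddoP => eps e0; apply: filterS (fL _ e0) => h.
  by rewrite /GRing.add /= /GRing.opp /= opprD addrA [h + x]addrC.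
have e := diff_unique cL z; apply: DiffDef => //.
by apply/diff_locallyP; rewrite e; split.
Qed.

End frechet.

Section strict.
Context {R : realType} {E : normedModType R} (c : coordinates E).
Local Notation I := (coord_idx c).
Local Notation e := (@coord_vec _ _ c).
Local Notation l := (@coord _ _ c).

Lemma coord_bounded : exists2 C : R, 0 < C &
  forall h, \sum_i `|l i h| <= C * `|h|.
Proof.
have /all_sig[C lC] i : {C : R | 0 <= C /\ forall h, `|l i h| <= C * `|h|}.
  apply: cid.
  have /linear_bounded_continuous/linear_boundedP[M [_ lM]] := @coord_cts _ _ c i.
  exists (`|M| + 1); split; first by rewrite addr_ge0.
  by apply: lM; rewrite (le_lt_trans (ler_norm _))// ltrDl.
exists (1 + \sum_i C i) => [|h].
  by rewrite ltr_wpDr// sumr_ge0// => i _; have [] := lC i.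
rewrite mulrDl mul1r ler_wpDl// mulr_suml; apply: ler_sum => i _.
by have [_] := lC i; exact.
Qed.

Lemma is_derive_line (F : E -> R^o) (y u : E) (t : R) :
  differentiable F (y + t *: u) ->
  is_derive t 1 (fun s : R => F (y + s *: u)) ('D_u F (y + t *: u)).
Proof.
move=> dF.
have dA : is_diff (t : R^o) (fun s : R^o => y + s *: u) (fun s : R^o => s *: u).
  by apply: is_diff_eq; apply/funext => s; rewrite /GRing.add/= add0r.
have dA' : differentiable (fun s : R^o => y + s *: u) (t : R^o) by [].
have dFA : differentiable (F \o (fun s : R^o => y + s *: u)) (t : R^o).
  exact: differentiable_comp.
apply: DeriveDef; first exact: diff_derivable.
rewrite [LHS](deriveE _ dFA) (diff_comp dA' dF) /= diff_val scale1r.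
by rewrite -(deriveE _ dF).
Qed.

(** A map of class C1 is strictly differentiable: by the mean value theorem the
error is a difference of two values of the derivative at points close to y0.
Here u is the increment. *)
Lemma strict_derive (U : set E) (F : E -> R^o) (y0 : E) (eps : R) :
  open U -> Ck 1 U F -> U y0 -> 0 < eps ->
  \forall y \near y0 & u \near (0 : E),
    `|F (y + u) - F y - 'D_u F y| <= eps * `|u|.
Proof.
move=> oU [dF cF] Uy0 eps0; have [C C0 lC] := coord_bounded.
(* The factor 2 pays for comparing two points with y0. *)
pose d := eps / C / 2; have d0 : 0 < d by rewrite !divr_gt0.
have near_e : \forall y \near y0, U y /\
    forall i, `|'D_(e i) F y - 'D_(e i) F y0| < d.
  apply: filterI; first exact: open_nbhs_nbhs.
  apply: filter_forall => i; have /cvgrPdist_lt/(_ _ d0) := cF (e i) _ Uy0.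
  by apply: filterS => y; rewrite distrC.
have /nbhs_ballP[r /= r0 yr] := near_e.
have r20 : 0 < r / 2 by rewrite divr_gt0.
exists (ball y0 (r / 2), ball 0 (r / 2)).
  by split; exact: nbhsx_ballx.
move=> [y u] /=; rewrite -!ball_normE /ball_/= sub0r normrN => -[yy0 ur].
have Uyu t : t \in `[0, 1] -> ball y0 r (y + t *: u).
  rewrite in_itv/= => /andP[t0 t1]; rewrite -ball_normE/= opprD addrA.
  rewrite (le_lt_trans (ler_normB _ _))// [ltRHS]splitr ltr_leD//.
  by rewrite normrZ ger0_norm// (le_trans _ (ltW ur))// ler_piMl.
have [] := @MVT_segment R (fun s => F (y + s *: u))
    (fun s => 'D_u F (y + s *: u)) 0 1 ler01.
- move=> t t01; apply: is_derive_line; apply: dF; apply: (yr _ _).1.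
  by apply: Uyu; apply: subset_itv_oo_cc t01.
- apply: continuous_in_subspaceT => t /set_mem t01.
  apply: differentiable_continuous; apply/derivable1_diffP.
  have [] // := @is_derive_line F y u t.
  by apply: dF; apply: (yr _ _).1; exact: Uyu.
move=> t t01; rewrite scale1r scale0r addr0 subr0 mulr1 => ->.
have [Ut dt] := yr _ (Uyu _ t01).
have [U0 d'0] : U y /\ forall i, `|'D_(e i) F y - 'D_(e i) F y0| < d.
  by apply: yr; have := Uyu 0; rewrite scale0r addr0; apply; rewrite in_itv/= lexx ler01.
rewrite !(derive_coord c)//; [|exact: dF..].
rewrite -sumrB (le_trans (ler_norm_sum _ _ _))//.
apply: (@le_trans _ _ (\sum_i `|l i u| * (d * 2))).
  apply: ler_sum => i _; rewrite -mulrBr normrM ler_wpM2l//.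
  rewrite mulr_natr mulr2n -(subrKA ('D_(e i) F y0)).
  rewrite (le_trans (ler_normD _ _))// lerD//; first exact: ltW.
  by rewrite distrC ltW.
rewrite -mulr_suml (le_trans (ler_wpM2r _ (lC u)))//; first by rewrite mulr_ge0// ltW.
rewrite /d divfK// mulrAC [C * _]mulrC divfK//.
exact: lt0r_neq0.
Qed.

End strict.

Section hadamard.
Context {R : realType} {E : normedModType R} (c : coordinates E).
Local Notation I := (coord_idx c).
Local Notation e := (@coord_vec _ _ c).
Local Notation l := (@coord _ _ c).
Variables (x0 : E) (r : R).
Let B := ball x0 r.

Definition ray (x : E) (t : R) : E := x0 + t *: (x - x0).

Definition ray_mean (k : nat) (F : E -> R^o) (x : E) : R^o :=
  mean01 (fun t => t ^+ k * F (ray x t)).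

Lemma ray_ball x t : B x -> t \in `[0, 1] -> B (ray x t).
Proof.
rewrite /B -ball_normE/= in_itv/= /ray => xr /andP[t0 t1].
rewrite opprD addrA subrr sub0r normrN normrZ ger0_norm//.
by rewrite (le_lt_trans _ xr)// distrC ler_piMl.
Qed.

Lemma ray_cts x : continuous (ray x).
Proof.
move=> t; apply: cvgD; first exact: cvg_cst.
exact: scalel_continuous.
Qed.

Lemma ray_segment_cts k F x : Ck 0 B F -> B x ->
  segment_cts (fun t => t ^+ k * F (ray x t)).
Proof.
move=> cF Bx t t01; apply: continuousM; first exact: exprn_continuous.
apply: continuous_comp; first exact: ray_cts.
by apply: cF; exact: ray_ball.
Qed.

(** The segment from x0 to x is compact, so the estimate of strict_derive holds
uniformly along it. *)
Lemma ray_strict_derive (F : E -> R^o) x (eps : R) :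
  Ck 1 B F -> B x -> 0 < eps ->
  \forall h \near (0 : E), forall t, t \in `[0, 1] ->
    `|F (ray x t + t *: h) - F (ray x t) - t * 'D_h F (ray x t)| <= eps * `|h|.
Proof.
move=> cF Bx eps0.
have /compact_near_coveringP cov := @segment_compact R 0 1.
(* Parameters near t may exceed 1, but not 2. *)
have eps2 : 0 < eps / 2 by rewrite divr_gt0.
pose P (h : E) (t : R) :=
  `|F (ray x t + t *: h) - F (ray x t) - t * 'D_h F (ray x t)| <= eps * `|h|.
suff near_t (t : R) : t \in `[0, 1] -> \forall s \near t & h \near (0 : E), P h s.
  by apply: filterS (cov E (nbhs (0 : E)) P _ near_t) => h Ph t; exact: Ph.
move=> t01; have Bt : B (ray x t) by exact: ray_ball.
have [_ dF] : True /\ forall y, B y -> differentiable F y by have [] := cF.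
have sd := strict_derive c (ball_open x0 r) cF Bt eps2.
have c1 : {for (t : R^o, 0 : E), continuous (ray x \o (fst : R^o * E -> R^o))}.
  by apply: continuous_comp; [exact: cvg_fst|exact: ray_cts].
have cm : (fun p : R^o * E => (ray x p.1, p.1 *: p.2)) @ (t : R^o, 0 : E) -->
    (ray x t, 0 : E).
  apply: (@cvg_pair _ _ _ _ (nbhs (ray x t)) (nbhs (0 : E))).
    exact: c1.
  have : (fun p : R^o * E => p.1 *: p.2) @ (t : R^o, 0 : E) --> (t *: 0 : E).
    by apply: cvgZ; [exact: cvg_fst|exact: cvg_snd].
  by rewrite scaler0.
have near1 : \forall p \near (t : R^o, 0 : E), `|p.1| <= 2.
  have : (fun p : R^o * E => `|p.1|) @ (t : R^o, 0 : E) --> `|t|.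
    by apply: cvg_norm; exact: cvg_fst.
  move/cvgrPdist_lt/(_ 1 ltr01); apply: filterS => p tp.
  have t1 : `|t| <= 1.
    by move: t01; rewrite in_itv/= => /andP[t0 t1]; rewrite ger0_norm.
  by move: tp; rewrite ltr_norml => /andP[tp _]; lra.
have nearB : \forall p \near (t : R^o, 0 : E), B (ray x p.1).
  by apply: c1; apply: open_nbhs_nbhs; split=> //; exact: ball_open.
have {}sd : \forall p \near (t : R^o, 0 : E),
    `|F (ray x p.1 + p.1 *: p.2) - F (ray x p.1) - 'D_(p.1 *: p.2) F (ray x p.1)|
      <= eps / 2 * `|p.1 *: p.2|.
  exact: (cm _ sd).
near=> p.
rewrite /P.
have -> : p.1 * 'D_p.2 F (ray x p.1) = 'D_(p.1 *: p.2) F (ray x p.1).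
  have dFp : differentiable F (ray x p.1) by apply: dF; near: p.
  by rewrite !deriveE// linearZ.
apply: (@le_trans _ _ (eps / 2 * `|p.1 *: p.2|)); first by near: p.
rewrite normrZ mulrA ler_wpM2r//.
rewrite [leRHS](_ : eps = eps / 2 * 2); last by rewrite divfK.
rewrite ler_wpM2l//; first exact: ltW.
by near: p.
Unshelve. all: by end_near. Qed.

(** Differentiation under the integral sign.  The weight t ^+ k is there because
each derivative of x |-> F (x0 + t (x - x0)) brings out a factor t: with it the
family of all ray_mean k F is closed under differentiation. *)
Lemma is_diff_ray_mean k (F : E -> R^o) x : Ck 1 B F -> B x ->
  is_diff x (ray_mean k F)
    (fun h => \sum_i l i h * ray_mean k.+1 ('D_(e i) F) x).
Proof.
move=> cF Bx; have [dF cdF] := cF; have cF0 := CkW cF.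
pose Lf (h : E) : R^o := \sum_i l i h * ray_mean k.+1 ('D_(e i) F) x.
have Llin : linear Lf.
  move=> a u v; rewrite /Lf scaler_sumr -big_split; apply: eq_bigr => i _.
  by rewrite linearP/= mulrDl -scalerAl.
pose L : {linear E -> R^o} := HB.pack Lf (GRing.isLinear.Build _ _ _ _ Lf Llin).
have cL : continuous L.
  move=> h; apply: (@continuous_sum _ _ R^o) => i.
  by apply: continuousM; [exact: coord_cts|exact: cst_continuous].
apply: (is_diff_eps (L := L)) => // eps eps0.
have nearB : \forall h \near (0 : E), B (x + h).
  have : (fun h => x + h) @ (0 : E) --> x.
    by rewrite -[X in _ --> X]addr0; apply: cvgD; [exact: cvg_cst|exact: cvg_id].
  by apply; apply: open_nbhs_nbhs; split=> //; exact: ball_open.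
near=> h.
have Bxh : B (x + h) by near: h.
have rayD t : ray (x + h) t = ray x t + t *: h.
  by rewrite /ray addrAC scalerDr addrA.
have -> : ray_mean k F (x + h) - ray_mean k F x - L h =
    mean01 (fun t => t ^+ k * F (ray (x + h) t) - t ^+ k * F (ray x t) -
      \sum_i l i h * (t ^+ k.+1 * 'D_(e i) F (ray x t))).
  have cD i : segment_cts (fun t => t ^+ k.+1 * 'D_(e i) F (ray x t)).
    exact: (ray_segment_cts (cdF _)).
  rewrite mean01B; [|apply: segment_ctsB; exact: ray_segment_cts|]; last first.
    by apply: segment_cts_sum => i; exact: segment_ctsZ.
  rewrite mean01B; [|exact: ray_segment_cts..].
  rewrite mean01_sum; last by move=> i; exact: segment_ctsZ.
  congr (_ - _); apply: eq_bigr => i _.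
  by rewrite mean01Z.
apply: mean01_le.
  apply: segment_ctsB; first by apply: segment_ctsB; exact: ray_segment_cts.
  by apply: segment_cts_sum => i; apply: segment_ctsZ; exact: (ray_segment_cts (cdF _)).
move=> t t01.
have -> : \sum_i l i h * (t ^+ k.+1 * 'D_(e i) F (ray x t)) =
    t ^+ k * (t * 'D_h F (ray x t)).
  rewrite (derive_coord c); last by apply: dF; exact: ray_ball.
  rewrite !mulr_sumr; apply: eq_bigr => i _; rewrite exprS; ring.
rewrite rayD -!mulrBr normrM.
have t1 : `|t ^+ k| <= 1.
  move: t01; rewrite in_itv/= => /andP[t0 t1].
  by rewrite ger0_norm ?exprn_ge0// exprn_ile1.
rewrite (le_trans (ler_wpM2r _ t1))// mul1r.
clear t1; move: t t01; near: h; exact: ray_strict_derive.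
Unshelve. all: by end_near. Qed.

Lemma smooth_on_ray_mean k (F : E -> R^o) :
  smooth_on B F -> smooth_on B (ray_mean k F).
Proof.
move=> + j; elim: j k F => [|j IH] k F sF.
  move=> x Bx; have [d _] := is_diff_ray_mean k (sF 1%N) Bx.
  exact: differentiable_continuous d.
split=> [x Bx|v]; first by have [] := is_diff_ray_mean k (sF 1%N) Bx.
have oB : open B by exact: ball_open.
pose g i := l i v *: ray_mean k.+1 ('D_(e i) F).
apply: (@eq_Ck _ _ _ _ _ (fun x => \sum_i g i x)) => //.
  move=> x Bx; have [d eD] := is_diff_ray_mean k (sF 1%N) Bx.
  by rewrite [RHS](deriveE _ d) eD.
apply: Ck_sum => // i; apply: CkZ => //; apply: IH => m.
by have [_ cF] := sF m.+1; exact: cF.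
Qed.

(** The fundamental theorem of calculus along the segment from x0 to x. *)
Lemma hadamard (F : E -> R^o) x : smooth_on B F -> B x ->
  F x = F x0 + \sum_i l i (x - x0) * ray_mean 0 ('D_(e i) F) x.
Proof.
move=> sF Bx; have [dF cF] := sF 1%N.
have cD i : segment_cts (fun t => t ^+ 0 * 'D_(e i) F (ray x t)).
  exact: (ray_segment_cts (cF _)).
pose v t := \sum_i l i (x - x0) * (t ^+ 0 * 'D_(e i) F (ray x t)).
have -> : \sum_i l i (x - x0) * ray_mean 0 ('D_(e i) F) x = mean01 v.
  rewrite mean01_sum; last by move=> i; exact: segment_ctsZ.
  by apply: eq_bigr => i _; rewrite mean01Z.
suff -> : mean01 v = F (ray x 1) - F (ray x 0).
  by rewrite /ray scale1r scale0r addr0 subrKC addrC subrK.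
apply: (@mean01_derive _ (fun t => F (ray x t))).
  by apply: segment_cts_sum => i; exact: segment_ctsZ.
move=> t t01; have dt := dF _ (ray_ball Bx t01).
have -> : v t = 'D_(x - x0) F (ray x t).
  by rewrite (derive_coord c)//; apply: eq_bigr => i _; rewrite expr0 mul1r.
exact: is_derive_line.
Qed.

Lemma ray_mean_center F : ray_mean 0 F x0 = F x0.
Proof.
rewrite /ray_mean -[RHS]mean01_cst; apply: eq_mean01 => t _.
by rewrite expr0 mul1r /ray subrr scaler0 addr0.
Qed.

End hadamard.

(** * Cut-off functions *)

Section smooth_step.
Context {R : realType}.

(** For n = 0 the classical smooth function that is flat at 0.  The powers of
x^-1 appear in its derivatives. *)
Definition flat_exp (n : nat) (x : R) : R :=
  if 0 < x then x^-1 ^+ n * expR (- x^-1) else 0.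

(** The Taylor bound y ^+ n.+1 / n.+1`! <= expR y at y = x^-1. *)
Lemma flat_exp_le n (x : R) : `|flat_exp n x| <= n.+1`!%:R * `|x|.
Proof.
rewrite /flat_exp; case: ifP => x0; last by rewrite normr0 mulr_ge0.
have y0 : 0 < x^-1 by rewrite invr_gt0.
rewrite [`|x|]gtr0_norm// -[x in leRHS]invrK expRN.
move: (x^-1) y0 => y y0.
rewrite gtr0_norm; last by rewrite mulr_gt0 ?exprn_gt0// invr_gt0 expR_gt0.
rewrite ler_pdivrMr ?expR_gt0// mulrAC ler_pdivlMr// -exprSr.
have f0 : (0 : R) < (n.+1)`!%:R by rewrite ltr0n fact_gt0.
rewrite -ler_pdivrMl// mulrC (le_trans _ (expR_ge1Dxn n (ltW y0)))//.
by rewrite lerDr.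
Qed.

Lemma flat_expS n (x : R) : flat_exp n x = x * flat_exp n.+1 x.
Proof.
rewrite /flat_exp; case: ifP => x0; last by rewrite mulr0.
by rewrite exprS -!mulrA mulVKf// gt_eqF.
Qed.

Lemma is_derive_flat_exp n (x : R) :
  is_derive x 1 (flat_exp n) (flat_exp n.+2 x - n%:R * flat_exp n.+1 x).
Proof.
have [x0|x0|->] := ltgtP x 0.
- apply: (@near_eq_is_derive _ _ _ (cst 0)).
    have : \forall y \near x, y < 0 by exact: lt_nbhsl.
    by apply: filterS => y y0; rewrite /flat_exp ltNge (ltW y0).
  rewrite /flat_exp ltNge (ltW x0)/= mulr0 subr0; exact: is_derive_cst.
- apply: (@near_eq_is_derive _ _ _ (fun y : R => y^-1 ^+ n * expR (- y^-1))).
    have : \forall y \near x, 0 < y by exact: lt_nbhsr.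
    by apply: filterS => y y0; rewrite /flat_exp y0.
  have xn0 : x != 0 by rewrite gt_eqF.
  have dV : is_derive x 1 (fun y : R => y^-1) (- x^-1 ^+ 2).
    apply: is_derive_eq; first exact: (is_deriveV (f := id)).
    by rewrite -[LHS]/(- x ^- 2 * 1) mulr1 exprVn.
  rewrite /flat_exp x0.
  have dE : is_derive x 1 (fun y : R => expR (- y^-1))
      (expR (- x^-1) * x^-1 ^+ 2).
    have -> : x^-1 ^+ 2 = - (- x^-1 ^+ 2) by rewrite opprK.
    exact: (is_derive1_comp (f := expR) (g := fun y => - y^-1)).
  have -> : (fun y : R => y^-1 ^+ n * expR (- y^-1)) =
      (fun y : R => y^-1) ^+ n * (fun y : R => expR (- y^-1)).
    by apply/funext => y; rewrite [RHS]/GRing.mul/= exprfctE.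
  apply: (is_derive_eq (is_deriveM (is_deriveX n dV) dE)).
  rewrite exprfctE; generalize (expR (- x^-1)) (x^-1) => E y; rewrite /GRing.scale/=.
  by case: n => [|n] /=; rewrite !exprS ?expr0; ring.
have -> : flat_exp n.+2 0 - n%:R * flat_exp n.+1 0 = 0 :> R.
  by rewrite /flat_exp ltxx mulr0 subrr.
have dd : is_diff (0 : R^o) (flat_exp n) (\0 : {linear R^o -> R^o}).
  apply: is_diff_eps => [|eps eps0]; first exact: cst_continuous.
  have M0 : 0 < eps / n.+2`!%:R by rewrite divr_gt0// ltr0n fact_gt0.
  have : \forall h \near (0 : R), `|h| < eps / n.+2`!%:R.
    by have := @nbhs0_lt R R^o _ M0.
  apply: filterS => h hM; rewrite add0r.
  have -> : flat_exp n 0 = 0 :> R by rewrite /flat_exp ltxx.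
  rewrite !subr0 flat_expS normrM mulrC ler_wpM2r//.
  rewrite (le_trans (flat_exp_le _ _))// mulrC -ler_pdivlMr; last first.
    by rewrite ltr0n fact_gt0.
  exact: ltW.
apply: DeriveDef; first exact: diff_derivable.
by rewrite deriveE// diff_val.
Qed.

Lemma Ck_flat_exp k n : Ck k setT (flat_exp n).
Proof.
elim: k n => [|k IH] n.
  move=> x _; have [d _] := is_derive_flat_exp n x.
  by apply: differentiable_continuous; apply/derivable1_diffP.
have df x : differentiable (flat_exp n) x.
  by have [d _] := is_derive_flat_exp n x; apply/derivable1_diffP.
split=> // v.
apply: (@eq_Ck _ _ _ _ _
    (v *: (flat_exp n.+2 + (- n%:R : R) *: flat_exp n.+1))) => //.
- exact: openT.
- move=> x _; rewrite deriveE// -[v in RHS]mulr1 -[v * 1]/(v *: 1) linearZ/=.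
  rewrite -deriveE//; have [_ ->] := is_derive_flat_exp n x.
  rewrite -[LHS]/(v * (flat_exp n.+2 x + (- n%:R) * flat_exp n.+1 x)).
  by rewrite mulNr.
- have oT := @openT R^o.
  by apply: CkZ => //; apply: CkD => //; apply: CkZ.
Qed.

Definition smooth_step (x : R) : R :=
  flat_exp 0 x * (flat_exp 0 x + flat_exp 0 (1 - x))^-1.

Lemma flat_exp_ge0 (x : R) : 0 <= flat_exp 0 x.
Proof. by rewrite /flat_exp; case: ifP => // _; rewrite mul1r expR_ge0. Qed.

Lemma flat_exp_gt0 (x : R) : 0 < x -> 0 < flat_exp 0 x.
Proof. by rewrite /flat_exp => ->; rewrite mul1r expR_gt0. Qed.

Lemma flat_exp_eq0 (x : R) : x <= 0 -> flat_exp 0 x = 0.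
Proof. by rewrite /flat_exp leNgt => /negbTE ->. Qed.

Lemma flat_expD_neq0 (x : R) : flat_exp 0 x + flat_exp 0 (1 - x) != 0.
Proof.
have [x0|x0] := ltP 0 x.
  by rewrite gt_eqF// ltr_pwDl// ?flat_exp_gt0// flat_exp_ge0.
by rewrite gt_eqF// ltr_wpDl// ?flat_exp_ge0// flat_exp_gt0//; lra.
Qed.

Lemma smooth_step_eq0 (x : R) : x <= 0 -> smooth_step x = 0.
Proof. by move=> x0; rewrite /smooth_step flat_exp_eq0// mul0r. Qed.

Lemma smooth_step_eq1 (x : R) : 1 <= x -> smooth_step x = 1.
Proof.
move=> x1; rewrite /smooth_step; have := flat_expD_neq0 x.
by rewrite [flat_exp 0 (1 - x)]flat_exp_eq0 ?subr_le0// addr0 => /divff.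
Qed.

Lemma smooth_on_smooth_step : smooth_on setT smooth_step.
Proof.
move=> k; have oT := @openT R^o.
apply: (@CkM _ _ _ _ (flat_exp 0) (fun x => (flat_exp 0 x + flat_exp 0 (1 - x))^-1)) => //.
  exact: Ck_flat_exp.
apply: Ck_inv => // [x _|]; first exact: flat_expD_neq0.
apply: (@CkD _ _ _ _ _ (flat_exp 0) (flat_exp 0 \o (fun x => 1 - x))) => //.
  exact: Ck_flat_exp.
have d (x : R^o) : is_diff x (fun x : R^o => 1 - x) (fun x => - x).
  by apply: is_diff_eq; apply/funext => h; rewrite /GRing.add/= sub0r.
exact: Ck_comp_affine oT d (Ck_flat_exp _ _).
Qed.

End smooth_step.

Lemma open_setI_preimage (S T : topologicalType) (U : set S) (W : set T)
    (f : S -> T) : open U -> (forall x, U x -> {for x, continuous f}) ->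
  open W -> open (U `&` f @^-1` W).
Proof.
move=> oU cf oW; rewrite openE => x [Ux Wx]; apply: filterI.
  exact: open_nbhs_nbhs.
by apply: (cf x Ux); exact: open_nbhs_nbhs.
Qed.

Section coordinate_instances.
Context {R : realType}.

Lemma coord_R_sum (x : R^o) : x = \sum_(i : unit) (idfun : {linear R^o -> R^o}) x *: (1 : R^o).
Proof. by rewrite (big_pred1 tt) => [|[]//]; rewrite -[RHS]/(x * 1) mulr1. Qed.

Definition coordinates_R : coordinates R^o :=
  @Coordinates R R^o unit (fun _ => 1) (fun _ => idfun) (fun _ x => cvg_id) coord_R_sum.

Section row.
Variable n : nat.
Definition row_coord (i : 'I_n) (x : 'rV[R]_n) : R^o := x ord0 i.
Lemma row_coord_linear i : linear (row_coord i).
Proof. by move=> a u v; rewrite /row_coord !mxE. Qed.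
HB.instance Definition _ i :=
  GRing.isLinear.Build _ _ _ _ (row_coord i) (row_coord_linear i).
Lemma row_coord_sum (x : 'rV[R]_n) :
  x = \sum_(i < n) row_coord i x *: (delta_mx ord0 i : 'rV[R]_n).
Proof. exact: row_sum_delta. Qed.
Definition coordinates_row : coordinates 'rV[R]_n :=
  @Coordinates R 'rV[R]_n 'I_n _ (fun i => row_coord i)
    (fun i => @coord_continuous _ _ _ ord0 i) row_coord_sum.
End row.

Lemma sum_option (I : finType) (V : nmodType) (F : option I -> V) :
  \sum_i F i = F None + \sum_i F (Some i).
Proof.
rewrite (bigD1 None)//= (reindex_omap Some id) => [|[]//].
by under eq_bigl do rewrite eqxx.
Qed.

Section line.
Variables (E : normedModType R) (c : coordinates E).
Local Notation I := (coord_idx c).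
Definition line_coord (i : option I) (x : E * R^o) : R^o :=
  if i is Some j then coord j x.1 else x.2.
Definition line_vec (i : option I) : E * R^o :=
  if i is Some j then (coord_vec j, 0) else (0, 1).
Lemma line_coord_linear i : linear (line_coord i).
Proof. by move=> a u v; case: i => [i|] //=; rewrite linearP. Qed.
HB.instance Definition _ i :=
  GRing.isLinear.Build _ _ _ _ (line_coord i) (line_coord_linear i).
Lemma line_coord_cts i : continuous (line_coord i).
Proof.
case: i => [i|] x; last exact: cvg_snd.
apply: (@continuous_comp _ _ _ fst (coord i)); first exact: cvg_fst.
exact: coord_cts.
Qed.
Lemma line_coord_sum (x : E * R^o) :
  x = \sum_(i : option I) line_coord i x *: line_vec i.
Proof.
rewrite sum_option [LHS]surjective_pairing.
have -> : \sum_i line_coord (Some i) x *: line_vec (Some i) = (x.1, 0).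
  rewrite [LHS]surjective_pairing !raddf_sum/= -coord_sum.
  by congr (_, _); apply: big1 => i _; exact: scaler0.
rewrite -[X in _ = X]/(x.2 *: 0 + x.1, x.2 *: 1 + 0) scaler0 add0r addr0.
by rewrite -[x.2 *: 1]/(x.2 * 1) mulr1.
Qed.
Definition coordinates_line : coordinates (E * R^o)%type :=
  @Coordinates R _ (option I) line_vec (fun i => line_coord i)
    line_coord_cts line_coord_sum.
End line.

End coordinate_instances.

Section bump.
Context {R : realType} {E : normedModType R} (c : coordinates E).
Local Notation I := (coord_idx c).
Local Notation e := (@coord_vec _ _ c).
Local Notation l := (@coord _ _ c).
Variable x0 : E.

Definition coord_dist2 (y : E) : R^o := \sum_i (l i y - l i x0) ^+ 2.

Definition bump (s : R) (y : E) : R^o := smooth_step (2 - s^-1 * coord_dist2 y).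

Lemma Ck_coord k U i : open U -> Ck k U (l i).
Proof. by move=> oU; apply: (Ck_linear oU _ (Ck_id k U)); exact: coord_cts. Qed.

Lemma Ck_coord_dist2 k U : open U -> Ck k U coord_dist2.
Proof.
move=> oU; apply: Ck_sum => // i.
pose f : E -> R^o := fun y => l i y - l i x0.
have cf : Ck k U f.
  apply: (@CkD _ _ _ _ _ (l i) (cst (- l i x0))) => //; first exact: Ck_coord.
  exact: Ck_cst.
by rewrite (_ : (fun _ => _) = f * f); [exact: CkM|apply/funext].
Qed.

Lemma smooth_on_bump s : smooth_on setT (bump s).
Proof.
move=> k; have oT := @openT E.
have oTR := @openT R^o.
apply: (@Ck_comp _ _ coordinates_R _ _ _ setT
  (fun y => 2 - s^-1 * coord_dist2 y) (smooth_step : R^o -> R^o)) => //.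
  apply: (@eq_Ck _ _ _ _ _ (cst (2 : R^o) + (- s^-1) *: coord_dist2)) => //.
    move=> y _; rewrite -[LHS]/(2 + - s^-1 * coord_dist2 y); by rewrite mulNr.
  apply: CkD => //; first exact: Ck_cst.
  by apply: CkZ => //; exact: Ck_coord_dist2.
exact: smooth_on_smooth_step.
Qed.

Lemma bump_near s : 0 < s -> \forall y \near x0, bump s y = 1.
Proof.
move=> s0; have c0 : coord_dist2 x0 = 0.
  by rewrite /coord_dist2 big1// => i _; rewrite subrr expr0n.
have cc : coord_dist2 @ x0 --> coord_dist2 x0.
  by apply: (Ck_coord_dist2 0 (@openT E)).
move/cvgrPdist_lt : cc => /(_ s s0); apply: filterS => y.
rewrite c0 sub0r normrN => /(le_lt_trans (ler_norm _)) ys.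
apply: smooth_step_eq1; rewrite lerBrDr -lerBrDl.
by rewrite mulrC ler_pdivrMr// (le_trans (ltW ys))// ; lra.
Qed.

Lemma bump_support s y : 0 < s -> 2 * s <= coord_dist2 y -> bump s y = 0.
Proof.
move=> s0 sy; apply: smooth_step_eq0.
by rewrite subr_le0 mulrC ler_pdivlMr.
Qed.

(** The coordinate ball is a closed part of the image of a cube of coordinates,
and the sizes of the vectors coord_vec bound its diameter. *)
Lemma coord_ball_compact (r : R) : 0 < r ->
  exists2 s, 0 < s & compact [set y | coord_dist2 y <= 2 * s] /\
    [set y | coord_dist2 y <= 2 * s] `<=` ball x0 r.
Proof.
move=> r0; pose N := 1 + \sum_i `|e i|.
have N0 : 0 < N by rewrite ltr_wpDr// sumr_ge0.
pose d := r / N; have d0 : 0 < d by rewrite divr_gt0.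
exists (d ^+ 2 / 2); first by rewrite divr_gt0// exprn_gt0.
rewrite mulrC divfK//.
have ld y i : coord_dist2 y <= d ^+ 2 -> `|l i y - l i x0| <= d.
  move=> yd; rewrite -(@ler_pXn2r _ 2)// ?nnegrE ?(ltW d0)//.
  rewrite real_normK ?num_real//; apply: le_trans yd.
  by rewrite /coord_dist2 (bigD1 i)//= lerDl sumr_ge0// => j _; exact: sqr_ge0.
have lE y : y = x0 + \sum_i (l i y - l i x0) *: e i.
  under eq_bigr do rewrite scalerBl; rewrite sumrB -!coord_sum.
  by rewrite addrC subrK.
split; last first.
  move=> y /= yd; rewrite -ball_normE/= {1}(lE y) opprD addrA subrr sub0r normrN.
  rewrite (le_lt_trans (ler_norm_sum _ _ _))//.
  apply: (@le_lt_trans _ _ (d * \sum_i `|e i|)).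
    rewrite mulr_sumr; apply: ler_sum => i _.
    by rewrite normrZ ler_wpM2r// ld.
  by rewrite /d mulrAC ltr_pdivrMr// ltr_pM2l// /N ltrDr.
pose f (z : 'rV[R]_#|I|) : E := x0 + \sum_i z ord0 (enum_rank i) *: e i.
have cs (z : 'rV[R]_#|I|) :
    {for z, continuous (fun z : 'rV[R]_#|I| => \sum_i z ord0 (enum_rank i) *: e i)}.
  apply: continuous_sum => i.
  apply: (@continuous_comp _ _ _ (fun z : 'rV[R]_#|I| => z ord0 (enum_rank i))
    ( *:%R^~ (e i))); first exact: coord_continuous.
  exact: scalel_continuous.
have cf : continuous f.
  move=> z; have := @continuousD _ _ _ (cst x0) _ z _ (cs z); apply.
  exact: cst_continuous.
have cpt : compact (f @` [set z : 'rV[R]_#|I| | forall i, `[- d, d]%classic (z ord0 i)]).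
  apply: continuous_compact; first exact: (continuous_subspaceT cf).
  exact: (@rV_compact R^o _ (fun=> `[- d, d]%classic)
    (fun=> @segment_compact _ _ _)).
apply: subclosed_compact cpt _.
- have -> : [set y | coord_dist2 y <= d ^+ 2] = coord_dist2 @^-1` [set x | x <= d ^+ 2] by [].
  apply: closed_comp => [y _|]; first exact: (Ck_coord_dist2 0 (@openT E)).
  exact: closed_le.
- move=> y /= yd; exists (\row_i (l (enum_val i) y - l (enum_val i) x0)) => /=.
    by move=> i; rewrite mxE /= in_itv/= -ler_norml ld.
  rewrite /f {2}(lE y); congr (_ + _); apply: eq_bigr => i _.
  by rewrite mxE enum_rankK.
Qed.

End bump.

(** * Smooth functions with support in a chart *)

Section smooth_extension.
Context {R : realType} {E : normedModType R} (c : coordinates E)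
        (M : manifold E).
Local Notation C := (smooth_fun M).
Implicit Types (a b : chart E M) (p q : M).

Lemma chart_imgE a q : chart_dom a q -> chart_img a (chart_map a q).
Proof. by exists q. Qed.

Lemma chart_invK a x : chart_img a x -> chart_map a (chart_inv a x) = x.
Proof. by move=> [q aq <-]; rewrite chart_mapK. Qed.

Lemma chart_inv_dom a x : chart_img a x -> chart_dom a (chart_inv a x).
Proof. by move=> [q aq <-]; rewrite chart_mapK. Qed.

Lemma open_chart_img_preimage a (O : set M) :
  open O -> open (chart_img a `&` chart_inv a @^-1` O).
Proof.
apply: open_setI_preimage; first exact: chart_img_open.
exact: chart_inv_cts.
Qed.

Lemma open_chart_dom_preimage a (W : set E) :
  open W -> open (chart_dom a `&` chart_map a @^-1` W).
Proof.
apply: open_setI_preimage; first exact: chart_dom_open.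
exact: chart_map_cts.
Qed.

(** A function given in one chart on W and extended by zero outside a closed set
K of that chart is smooth in every chart b: at a point of K compose with the
change of charts, and elsewhere the function vanishes on a neighbourhood. *)
Lemma smooth_extension a (W : set E) (K : set M) (u : M -> R^o) :
  atlas M a -> open W -> closed K ->
  (forall q, K q -> chart_dom a q /\ W (chart_map a q)) ->
  (forall q, ~ K q -> u q = 0) ->
  smooth_on W (u \o chart_inv a) -> smooth u.
Proof.
move=> aM oW cK KW u0 su b bM k; apply: Ck_local => x bx.
have [Kq|nKq] := pselect (K (chart_inv b x)); last first.
  pose U := chart_img b `&` chart_inv b @^-1` ~` K.
  have oU : open U by apply: open_chart_img_preimage; exact: closed_openC.
  exists U => //; apply: (@eq_Ck _ _ _ _ _ (cst 0)) => //; last exact: Ck_cst.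
  by move=> y [_ /u0].
have [aq Wq] := KW _ Kq.
pose U := chart_map b @` (chart_dom b `&` chart_dom a).
pose phi := chart_map a \o chart_inv b.
have sphi : smooth_on U phi by exact: atlas_compat.
have UE : U = chart_img b `&` chart_inv b @^-1` chart_dom a.
  apply/seteqP; split=> [_ [q [bq aq'] <-]|y [[q bq <-] /=]].
    by split; [exists q|rewrite /= chart_mapK].
  by rewrite chart_mapK// => aq'; exists q.
have oU : open U.
  by rewrite UE; apply: open_chart_img_preimage; exact: chart_dom_open.
pose U' := U `&` phi @^-1` W.
have oU' : open U' by apply: open_setI_preimage => //; exact: (sphi 0%N).
exists U'; first by split=> //; rewrite UE; split.
apply: (@eq_Ck _ _ _ _ _ ((u \o chart_inv a) \o phi)) => //.
  by move=> y [+ _]; rewrite UE => -[_ /= ay]; rewrite /phi/= chart_mapK.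
apply: (Ck_comp c oU' (U' := W)); last exact: su.
  by move=> y [].
by apply: Ck_sub (sphi k) => y [].
Qed.

(** The set K is the image of a coordinate ball, so it is compact by
coord_ball_compact, and closed because M is Hausdorff. *)
Lemma cutoff a p (W : set E) : atlas M a -> chart_dom a p -> open W ->
  W (chart_map a p) -> W `<=` chart_img a ->
  exists (K : set M) (beta : C), [/\ closed K,
    forall q, K q -> chart_dom a q /\ W (chart_map a q),
    forall q, ~ K q -> beta q = 0 &
    \forall q \near p, beta q = 1].
Proof.
move=> aM ap oW Wp Wa; set x0 := chart_map a p in Wp *.
have /nbhs_ballP[r /= r0 rW] : nbhs x0 W by exact: open_nbhs_nbhs.
have [s s0 [cptD Dr]] := coord_ball_compact c x0 r0.
set D := [set y | _] in cptD Dr.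
have DW : D `<=` W by apply: subset_trans rW.
pose K := chart_inv a @` D.
have cK : closed K.
  apply: compact_closed; first exact: manifold_hausdorff.
  apply: continuous_compact => //; apply: continuous_in_subspaceT => x /set_mem.
  by move=> /DW/Wa; exact: chart_inv_cts.
have KW q : K q -> chart_dom a q /\ W (chart_map a q).
  move=> [y Dy <-]; have ay := Wa _ (DW _ Dy).
  by rewrite chart_invK//; split; [exact: chart_inv_dom|exact: DW].
pose u q : R^o := if `[< K q >] then bump c x0 s (chart_map a q) else 0.
have uK q : ~ K q -> u q = 0 by rewrite /u; case: asboolP.
have ua x : W x -> (u \o chart_inv a) x = bump c x0 s x.
  move=> Wx; have ax := Wa _ Wx; rewrite /u/=; case: asboolP => [_|nK].
    by rewrite chart_invK.
  symmetry; apply: bump_support => //; rewrite leNgt; apply/negP => xs.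
  by apply: nK; exists x => //; exact: ltW.
have su : smooth u.
  apply: (smooth_extension aM oW cK KW uK) => k.
  apply: (@eq_Ck _ _ _ _ _ (bump c x0 s)) => // [x /ua//|].
  by apply: Ck_sub (smooth_on_bump c x0 s k).
exists K, (smoothE su); split=> //.
have n1 : \forall q \near p, bump c x0 s (chart_map a q) = 1.
  exact: (chart_map_cts ap (bump_near c x0 s0)).
have n2 : \forall q \near p, chart_dom a q /\ W (chart_map a q).
  have oo := open_chart_dom_preimage a oW.
  by apply: open_nbhs_nbhs.
apply: filterS2 n1 n2 => q b1 [aq Wq] /=.
by have /= := ua _ Wq; rewrite chart_mapK// => ->.
Qed.

Lemma smooth_cut a (W : set E) (K : set M) (beta : C) (H : E -> R^o) :
  atlas M a -> open W -> W `<=` chart_img a -> closed K ->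
  (forall q, K q -> chart_dom a q /\ W (chart_map a q)) ->
  (forall q, ~ K q -> beta q = 0) ->
  smooth_on W H -> smooth (fun q => beta q * H (chart_map a q)).
Proof.
move=> aM oW Wa cK KW b0 sH; apply: (smooth_extension aM oW cK KW) => [q nK|k].
  by rewrite b0// mul0r.
apply: (@eq_Ck _ _ _ _ _ ((beta \o chart_inv a) * H)) => //.
  by move=> x Wx; rewrite /= chart_invK//; exact: Wa.
by apply: CkM => //; apply: Ck_sub (smooth_funP beta aM k).
Qed.

End smooth_extension.

(** * Tangent vectors in a chart *)

Section tangent_theory.
Context {R : realType} {E : normedModType R} (c : coordinates E)
        (M : manifold E).
Local Notation I := (coord_idx c).
Local Notation e := (@coord_vec _ _ c).
Local Notation l := (@coord _ _ c).
Local Notation C := (smooth_fun M).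
Implicit Types (a b : chart E M) (p q : M).

Section derivation_rules.
Variables (p : M) (v : tangent M p).

Lemma derivationD (f g : C) : v (f + g) = v f + v g.
Proof. by have [/(_ 1 f g)] := tangentP v; rewrite scale1r mul1r. Qed.

Lemma derivation0 : v 0 = 0.
Proof.
have := derivationD 0 0; rewrite addr0 => /eqP.
by rewrite -subr_eq0 opprD addrA subrr sub0r oppr_eq0 => /eqP.
Qed.

Lemma derivationZ (k : R) (f : C) : v (k *: f) = k * v f.
Proof.
by have [/(_ k f 0)] := tangentP v; rewrite !addr0 derivation0 addr0.
Qed.

Lemma derivationM (f g : C) : v (f * g) = f p * v g + g p * v f.
Proof. by have [_] := tangentP v; exact. Qed.

Lemma derivationN (f : C) : v (- f) = - v f.
Proof. by rewrite -scaleN1r derivationZ mulN1r. Qed.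

Lemma derivationB (f g : C) : v (f - g) = v f - v g.
Proof. by rewrite derivationD derivationN. Qed.

Lemma derivation1 : v 1 = 0.
Proof.
have := derivationM 1 1; rewrite mulr1 /= mul1r => /eqP.
by rewrite -subr_eq0 opprD addrA subrr sub0r oppr_eq0 => /eqP.
Qed.

Lemma derivation_sum (J : finType) (f : J -> C) :
  v (\sum_i f i) = \sum_i v (f i).
Proof.
apply: (big_ind2 (fun (g : C) (x : R) => v g = x)) => //.
  exact: derivation0.
by move=> g x h y <- <-; exact: derivationD.
Qed.

End derivation_rules.

(** If beta is a cut-off function with support where f - g = k, then
beta * (f - g - k) = 0, and the Leibniz rule does the rest. *)
Lemma derivation_local p (v : tangent M p) (f g : C) (k : R) :
  (\forall q \near p, f q = g q + k) -> v f = v g.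
Proof.
move=> fg; have [a aM ap] := atlas_cover p.
have [U [oU Up] Ufg] : exists2 U, open_nbhs p U & U `<=` [set q | f q = g q + k].
  by have := fg; rewrite /prop_near1 nbhsE.
pose W := chart_img a `&` chart_inv a @^-1` U.
have oW : open W by exact: open_chart_img_preimage.
have Wp : W (chart_map a p) by split; [exact: chart_imgE|rewrite /= chart_mapK].
have [|K [beta [_ KW b0 b1]]] := cutoff c aM ap oW Wp; first by move=> x [].
have bp : beta p = 1 by exact: nbhs_singleton b1.
pose h := f - g - k *: (1 : C).
have bh : beta * h = 0.
  apply: smooth_fun_ext => q; rewrite -[LHS]/(beta q * (f q - g q - k * 1)).
  have [/KW[aq [_ /=]]|/b0 ->] := pselect (K q); last exact: mul0r.
  by rewrite chart_mapK// => /Ufg ->; rewrite mulr1 addrAC addrK subrr mulr0.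
have hp : h p = 0.
  by rewrite -[LHS]/(f p - g p - k * 1) Ufg// mulr1 addrAC addrK subrr.
have := derivationM v beta h; rewrite bh derivation0 bp hp mul0r addr0 mul1r.
rewrite /h derivationB derivationZ derivation1 mulr0 subr0 derivationB.
by move=> /esym/eqP; rewrite subr_eq0 => /eqP.
Qed.

(** The coordinates of a chart are only defined on its domain; global functions
that agree with them near p, up to constants, do as well for derivations. *)
Definition chart_coordinates a p (z : I -> C) : Prop := forall i,
  exists k : R, \forall q \near p, z i q = l i (chart_map a q) + k.

(** Hadamard's lemma multiplied by the square of a cut-off function is an identity
between global functions, to which the derivation v applies: the factors
zeta i vanish at p, so only their derivatives survive. *)
Lemma derivation_chart a p (v : tangent M p) (z : I -> C) (f : C) :
  atlas M a -> chart_dom a p -> chart_coordinates a p z ->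
  v f = \sum_i v (z i) * 'D_(e i) (f \o chart_inv a) (chart_map a p).
Proof.
move=> aM ap zp; set x0 := chart_map a p; set F := f \o chart_inv a.
have /nbhs_ballP[r /= r0 ra] : nbhs x0 (chart_img a).
  by apply: open_nbhs_nbhs; split; [exact: chart_img_open|exact: chart_imgE].
set B := ball x0 r in ra.
have oB : open B by exact: ball_open.
have Bx : B x0 by exact: ballxx.
have sF : smooth_on B F by move=> k; apply: Ck_sub (smooth_funP f aM k).
have [K [beta [cK KB b0 b1]]] := cutoff c aM ap oB Bx ra.
have bp : beta p = 1 by exact: nbhs_singleton b1.
have sG i : smooth_on B (ray_mean x0 0 ('D_(e i) F)).
  by apply: (smooth_on_ray_mean c) => k; have [_] := sF k.+1; exact.
have sg i := smooth_cut c aM oB ra cK KB b0 (sG i).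
have sz i : smooth (fun q => beta q * (l i (chart_map a q) - l i x0)).
  apply: (smooth_cut c aM oB ra cK KB b0 (H := fun x => l i x - l i x0)) => k.
  apply: (@CkD _ _ _ _ _ (l i) (cst (- l i x0))) => //; first exact: Ck_coord.
  exact: Ck_cst.
pose g i := smoothE (sg i); pose zeta i := smoothE (sz i).
have vzeta i : v (zeta i) = v (z i).
  have [k zk] := zp i.
  apply: (@derivation_local _ _ _ _ (- k - l i x0)).
  by apply: filterS2 zk b1 => q /= -> ->; rewrite mul1r addrA addrK.
have fE : beta * beta * f = f p *: (beta * beta) + \sum_i zeta i * g i.
  apply: smooth_fun_ext => q.
  have ev (h : I -> C) : (\sum_i h i) q = \sum_i h i q.
    by apply: (big_ind2 (fun (h : C) (x : R) => h q = x)) => // ? ? ? ? <- <-.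
  rewrite -[LHS]/(beta q * beta q * f q).
  rewrite -[RHS]/(f p * (beta q * beta q) + (\sum_i zeta i * g i) q) ev.
  have [/KB[aq Bq]|/b0 bq] := pselect (K q); last first.
    rewrite bq !mul0r mulr0 add0r big1// => i _.
    by rewrite -[LHS]/(zeta i q * g i q) /= bq !mul0r.
  have := hadamard c sF Bq; rewrite /F /= !chart_mapK// => ->.
  rewrite mulrDr mulr_sumr; congr (_ + _); first by rewrite mulrC.
  apply: eq_bigr => i _; rewrite -[RHS]/(zeta i q * g i q) /= linearB/=; ring.
have vb : v (beta * beta) = 0.
  rewrite -(derivation1 v); apply: (@derivation_local _ _ _ _ 0).
  by apply: filterS b1 => q bq; rewrite -[LHS]/(beta q * beta q) bq mulr1 addr0.
have := congr1 v fE; rewrite derivationM derivationD derivationZ vb !mulr0 addr0 add0r.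
rewrite -[(beta * beta) p]/(beta p * beta p) bp !mul1r => ->.
rewrite derivation_sum; apply: eq_bigr => i _; rewrite derivationM vzeta.
have -> : zeta i p = 0 by rewrite /= subrr mulr0.
rewrite mul0r add0r mulrC; congr (_ * _).
by rewrite /= bp mul1r ray_mean_center.
Qed.

Lemma chart_coordinates_exist a p : atlas M a -> chart_dom a p ->
  exists z : I -> C, \forall q \near p, chart_dom a q /\ chart_coordinates a q z.
Proof.
move=> aM ap; have oa := chart_img_open a.
have [K [beta [cK Ka b0 b1]]] := cutoff c aM ap oa (chart_imgE ap) (@subset_refl _ _).
have sz i : smooth (fun q => beta q * l i (chart_map a q)).
  by apply: (smooth_cut c aM oa _ cK Ka b0) => // k; exact: Ck_coord.
exists (fun i => smoothE (sz i)); apply: filterI.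
  by apply: open_nbhs_nbhs; split=> //; exact: chart_dom_open.
apply: filterS (near_join b1) => q bq i; exists 0.
by apply: filterS bq => q' /= ->; rewrite mul1r addr0.
Qed.

End tangent_theory.

Section fields.
Context {R : realType} {E : normedModType R} (c : coordinates E)
        (M : manifold E).
Local Notation I := (coord_idx c).
Local Notation e := (@coord_vec _ _ c).
Local Notation C := (smooth_fun M).
Implicit Types (a b : chart E M) (p q : M).

Definition chart_partial a q (i : I) (f : C) : R^o :=
  'D_(e i) (f \o chart_inv a) (chart_map a q).

Lemma chart_partial_derivation a q i : atlas M a -> chart_dom a q ->
  derivation_at M q (chart_partial a q i).
Proof.
move=> aM aq.
have d (f : C) : derivable (f \o chart_inv a) (chart_map a q) (e i).
  apply: diff_derivable; apply: (smooth_on_differentiable (smooth_funP f aM)).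
  exact: chart_imgE.
split=> [k f g|f g]; rewrite /chart_partial.
  rewrite -[_ \o _]/(k *: (f \o chart_inv a) + (g \o chart_inv a)).
  by rewrite deriveD ?deriveZ//; exact: derivableZ.
rewrite -[(f * g : C) \o _]/((f \o chart_inv a) * (g \o chart_inv a)).
by rewrite deriveM//= chart_mapK.
Qed.

Definition chart_basis a q (aM : atlas M a) (aq : chart_dom a q) (i : I) :
    tangent M q :=
  mkTangent (chart_partial_derivation i aM aq).

Lemma tangent_sumE p (J : finType) (w : J -> tangent M p) (f : C) :
  (\sum_i w i) f = \sum_i w i f.
Proof.
by apply: (big_ind2 (fun (g : tangent M p) (x : R) => g f = x)) => // ? ? ? ? <- <-.
Qed.

Lemma tangent_basis p : exists (b : I -> tangent M p) (z : I -> C),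
  forall w : tangent M p, w = \sum_i w (z i) *: b i.
Proof.
have [a aM ap] := atlas_cover p; have [z /nbhs_singleton[_ zp]] := chart_coordinates_exist c aM ap.
exists (chart_basis aM ap), z => w; apply: tangent_ext => f.
rewrite tangent_sumE (derivation_chart w f aM ap zp).
by apply: eq_bigr => i _; rewrite tangentZ.
Qed.

(** Spread the coordinates of v as constants over the chart, and cut off. *)
Lemma field_extension p (v : tangent M p) : exists X : vfield M, X p = v.
Proof.
have [a aM ap] := atlas_cover p; have [z /nbhs_singleton[_ zp]] := chart_coordinates_exist c aM ap.
have oa := chart_img_open a.
have [K [beta [cK Ka b0 b1]]] := cutoff c aM ap oa (chart_imgE ap) (@subset_refl _ _).
pose Xv q (f : C) : R^o := beta q * \sum_i v (z i) * chart_partial a q i f.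
have dX q : derivation_at M q (Xv q).
  have [/Ka[aq _]|/b0 bq] := pselect (K q); last first.
    by rewrite /Xv bq; split=> *; rewrite !mul0r ?mulr0 addr0.
  pose w := beta q *: \sum_i v (z i) *: chart_basis aM aq i.
  have -> : Xv q = w.
    apply/funext => f; rewrite /w tangentZ tangent_sumE.
    by congr (_ * _); apply: eq_bigr => i _; rewrite tangentZ.
  exact: tangentP.
have sX f : smooth (fun q => mkTangent (dX q) f).
  apply: (smooth_cut c aM oa _ cK Ka b0
    (H := fun x => \sum_i v (z i) * 'D_(e i) (f \o chart_inv a) x)) => // k.
  apply: Ck_sum => // i; apply: (CkZ (v (z i)) oa).
  by have [_] := smooth_funP f aM k.+1; exact.
exists (VField sX); apply: tangent_ext => f /=.
rewrite /Xv (nbhs_singleton b1) mul1r (derivation_chart v f aM ap zp).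
by apply: eq_bigr.
Qed.

(** Pointwise differentiability of a curve of derivations suffices because the
tangent space has finite dimension. *)
Lemma is_derive_linear p (L : tangent M p -> R^o) (w : R -> tangent M p)
    (w' : tangent M p) (t : R) : linear L ->
  (forall f, is_derive t 1 (fun s => w s f) (w' f)) ->
  is_derive t 1 (fun s => L (w s)) (L w').
Proof.
move=> Ll dw; have [b [z bz]] := tangent_basis p.
pose Lp : {linear tangent M p -> R^o} := HB.pack L (GRing.isLinear.Build _ _ _ _ L Ll).
have LE x : L x = \sum_i x (z i) * L (b i).
  rewrite -[L]/(Lp : tangent M p -> R^o) {1}(bz x) linear_sum.
  by apply: eq_bigr => i _; rewrite linearZ.
rewrite LE; have -> : (fun s => L (w s)) = \sum_i (fun s => w s (z i) * L (b i)).
  by apply/funext => s; rewrite fct_sumE LE.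
apply: (big_ind2 (fun (f : R -> R^o) (x : R^o) => is_derive t 1 f x)) => [||i _].
- exact: is_derive_cst.
- by move=> f x g y df dg; exact: is_deriveD.
- have -> : (fun s => w s (z i) * L (b i)) = L (b i) *: (fun s => w s (z i) : R^o).
    by apply/funext => s; exact: mulrC.
  by rewrite mulrC; apply: is_deriveZ.
Qed.

End fields.

(** * Tangent vectors of M x R *)

Section line_fields.
Context {R : realType} {E : normedModType R} (c : coordinates E)
        (M : manifold E).
Local Notation I := (coord_idx c).
Local Notation C := (smooth_fun M).
Local Notation MR := (manifold_line M).
Local Notation cl := (coordinates_line c).

(** Coordinates of M x R made of coordinates of M and of time. *)
Definition line_functions (z : I -> C) (i : option I) : smooth_fun MR :=
  if i is Some j then pullback_fst (z j) else line_time M.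

Lemma chart_coordinates_line a (q : MR) (z : I -> C) :
  chart_coordinates (c := c) a q.1 z ->
  chart_coordinates (c := cl) (M := MR) (chart_line a) q (line_functions z).
Proof.
move=> zq [i|]; last first.
  exists 0; apply: (@filterE _ (nbhs (q : points MR))) => q' /=.
  by rewrite addr0.
have [k zk] := zq i; exists k.
exact: (cvg_fst (F := nbhs q.1) (G := nbhs q.2) zk).
Qed.

Lemma tangent_line_ext (q : MR) (w w' : tangent MR q) :
  dfst w = dfst w' -> dtime w = dtime w' -> w = w'.
Proof.
move=> fw tw; apply: tangent_ext => F.
have [a aM aq] := atlas_cover q.1.
have [z /nbhs_singleton[_ zq]] := chart_coordinates_exist c aM aq.
have aMR : atlas MR (chart_line a) by exists a.
have aqR : chart_dom (chart_line a) q by [].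
have Zq := chart_coordinates_line zq.
rewrite (derivation_chart w F aMR aqR Zq) (derivation_chart w' F aMR aqR Zq).
apply: eq_bigr => i _; congr (_ * _); case: i => [i|] //=.
by rewrite -[LHS]/(dfst w (z i)) fw.
Qed.

Lemma tan_pairK (q : MR) (w : tangent MR q) : tan_pair (dfst w) (dtime w) = w.
Proof. by apply: tangent_line_ext; rewrite ?dfst_pair ?dtime_pair. Qed.

(** Near a point, derivation_chart on M x R writes the value of the field on F as
a sum of products of smooth functions. *)
Lemma line_lift_smooth (X : vfield M) (u : C) (F : smooth_fun MR) :
  smooth (M := MR) (fun q => tan_pair (M := M) (q := q) (X q.1) (u q.1) F).
Proof.
move=> _ [a aM <-] k; apply: Ck_local => x ax.
have aMR : atlas MR (chart_line a) by exists a.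
pose q := chart_inv (chart_line a) x.
have aq : chart_dom a q.1 by have [] := chart_inv_dom ax.
have [z zq] := chart_coordinates_exist c aM aq.
pose g (i : option I) : smooth_fun MR :=
  if i is Some j then pullback_fst (vapp X (z j)) else pullback_fst u.
pose G x : R^o := \sum_i g i (chart_inv (chart_line a) x) *
  'D_(coord_vec (c := cl) i) (F \o chart_inv (chart_line a)) x.
have oi := chart_img_open (chart_line a).
apply: (@Ck_near _ _ _ _ (chart_img (chart_line a)) _ G) => //; last first.
  apply: Ck_sum => // i; apply: (@CkM _ _ _ _ (g i \o chart_inv (chart_line a))) => //.
    exact: (smooth_funP (g i) aMR k).
  by have [_] := smooth_funP F aMR k.+1; exact.
have near_q : \forall y \near x, chart_img (chart_line a) y /\
    (chart_dom a (chart_inv (chart_line a) y).1 /\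
     chart_coordinates (c := c) a (chart_inv (chart_line a) y).1 z).
  apply: filterI; first exact: open_nbhs_nbhs.
  have zq' : \forall q' \near q, chart_dom a q'.1 /\
      chart_coordinates (c := c) a q'.1 z.
    exact: (cvg_fst (F := nbhs q.1) (G := nbhs q.2) zq).
  exact: (chart_inv_cts ax zq').
apply: filterS near_q => y [ay [ady zy]].
have aqR : chart_dom (chart_line a) (chart_inv (chart_line a) y) by [].
pose q' := chart_inv (chart_line a) y.
pose w := tan_pair (M := M) (q := q') (X q'.1) (u q'.1).
apply: etrans (derivation_chart w F aMR aqR (chart_coordinates_line zy)) _.
apply: eq_bigr => i _; rewrite chart_invK//; congr (_ * _); case: i => [i|].
  by rewrite -[LHS]/(dfst w (z i)) dfst_pair.
exact: dtime_pair.
Qed.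

Definition line_lift (X : vfield M) (u : C) : vfield MR := VField (line_lift_smooth X u).

End line_fields.

(** * Brackets of fields on M and on M x R *)

Section field_algebra.
Context {R : realType} {E : normedModType R} (M : manifold E).
Local Notation C := (smooth_fun M).
Implicit Types (X Y Z : vfield M) (f h : C) (p : M).

Lemma vfieldD X Y p : (X + Y) p = X p + Y p.
Proof. by []. Qed.

Lemma vfieldN X p : (- X) p = - X p.
Proof. by rewrite -[LHS]/((-1) *: X p) scaleN1r. Qed.

Lemma vfieldB X Y p : (X - Y) p = X p - Y p.
Proof. by rewrite vfieldD vfieldN. Qed.

Lemma vfield0 p : (0 : vfield M) p = 0.
Proof. by []. Qed.

Lemma vfieldZ (k : R) X p : (k *: X) p = k *: X p.
Proof. by []. Qed.

Lemma fscaleE f X p : fscale f X p = f p *: X p.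
Proof. by []. Qed.

Lemma smooth_funD f h p : (f + h) p = f p + h p. Proof. by []. Qed.
Lemma smooth_funN f p : (- f) p = - f p. Proof. by []. Qed.
Lemma smooth_funM f h p : (f * h) p = f p * h p. Proof. by []. Qed.
Lemma smooth_funZ (k : R) f p : (k *: f) p = k * f p. Proof. by []. Qed.
Lemma smooth_fun0 p : (0 : C) p = 0. Proof. by []. Qed.

Lemma tangentB p (v w : tangent M p) f : (v - w) f = v f - w f.
Proof. by []. Qed.

Lemma tangentN p (v : tangent M p) f : (- v) f = - v f.
Proof. by []. Qed.

Lemma tangent0 p f : (0 : tangent M p) f = 0.
Proof. by []. Qed.

Lemma vappE X f p : vapp X f p = X p f.
Proof. by []. Qed.

Lemma vapp_fscale h X f : vapp (fscale h X) f = h * vapp X f.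
Proof. exact: smooth_fun_ext. Qed.

Lemma bracketE X Y p f : bracket X Y p f = X p (vapp Y f) - Y p (vapp X f).
Proof. by []. Qed.

Lemma bracketC X Y : bracket X Y = - bracket Y X.
Proof.
apply: vfield_ext => p; apply: tangent_ext => f.
by rewrite vfieldN tangentN !bracketE opprB.
Qed.

Lemma bracketxx X : bracket X X = 0.
Proof.
apply: vfield_ext => p; apply: tangent_ext => f.
by rewrite bracketE subrr vfield0 tangent0.
Qed.

Lemma bracketDr X Y Z : bracket X (Y + Z) = bracket X Y + bracket X Z.
Proof.
apply: vfield_ext => p; apply: tangent_ext => f.
have e : vapp (Y + Z) f = vapp Y f + vapp Z f by exact: smooth_fun_ext.
rewrite vfieldD tangentD !bracketE e derivationD vfieldD tangentD; ring.
Qed.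

Lemma bracketNr X Y : bracket X (- Y) = - bracket X Y.
Proof.
have := bracketDr X (Y - Y) Y; rewrite subrK => /eqP.
rewrite -subr_eq subrr => /eqP e; have := bracketDr X Y (- Y).
by rewrite -e => /esym/eqP; rewrite addr_eq0 => /eqP ->; rewrite opprK.
Qed.

Lemma bracketBr X Y Z : bracket X (Y - Z) = bracket X Y - bracket X Z.
Proof. by rewrite bracketDr bracketNr. Qed.

Lemma bracketBl X Y Z : bracket (Y - Z) X = bracket Y X - bracket Z X.
Proof. by rewrite bracketC bracketBr opprB [bracket Z X]bracketC
  [bracket Y X]bracketC opprK addrC. Qed.

Lemma bracket_fscaler X f Y :
  bracket X (fscale f Y) = fscale (vapp X f) Y + fscale f (bracket X Y).
Proof.
apply: vfield_ext => p; apply: tangent_ext => h.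
rewrite vfieldD tangentD !fscaleE !tangentZ !bracketE vapp_fscale derivationM.
rewrite fscaleE tangentZ !vappE; ring.
Qed.

Lemma bracket_fscalel X f Y :
  bracket (fscale f X) Y = fscale f (bracket X Y) - fscale (vapp Y f) X.
Proof.
rewrite bracketC bracket_fscaler opprD addrC [bracket Y X]bracketC.
congr (_ - _); apply: vfield_ext => p.
by rewrite vfieldN fscaleE vfieldN scalerN opprK.
Qed.

Lemma jacobi X Y Z :
  bracket (bracket X Y) Z + bracket (bracket Y Z) X + bracket (bracket Z X) Y = 0.
Proof.
apply: vfield_ext => p; apply: tangent_ext => f.
have e U V : vapp (bracket U V) f = vapp U (vapp V f) - vapp V (vapp U f).
  exact: smooth_fun_ext.
rewrite !vfieldD !tangentD !bracketE !e !derivationB vfield0 tangent0; ring.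
Qed.

End field_algebra.

Definition vfieldE := (@vfieldD, @vfieldN, @vfieldZ, @fscaleE, @vfield0).
Definition smooth_funE :=
  (@smooth_funD, @smooth_funN, @smooth_funM, @smooth_funZ, @smooth_fun0).
Definition tangentE := (@tangentD, @tangentN, @tangentZ, @tangent0).

Section time_families.
Context {R : realType} {E : normedModType R} (c : coordinates E)
        (M : manifold E).
Local Notation C := (smooth_fun M).
Local Notation MR := (manifold_line M).
Implicit Types (V W : vfield MR) (p : M) (t : R).

(** A field V on M x R is a time-dependent field fst_field V on M together with a
time-dependent function time_fun V. *)
Definition fst_field V t : vfield M :=
  @VField _ _ M (fun p => dfst (V (p, t)))
    (fun f => line_slice_smooth (vapp V (pullback_fst f)) t).

Definition time_fun V t : C := line_slice (vapp V (line_time M)) t.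

Definition time_derive (F : smooth_fun MR) p t : R^o :=
  derive1 (fun s : R^o => F (p, s)) t.

Lemma is_derive_time (F : smooth_fun MR) p t :
  is_derive (t : R^o) 1 (fun s : R^o => F (p, s)) (time_derive F p t).
Proof.
by apply: DeriveDef; [exact: derivable_time|rewrite -derive1E].
Qed.

Lemma fst_field_derivation V p t :
  derivation_at M p (fun f => time_derive (vapp V (pullback_fst f)) p t).
Proof.
have E1 F g : is_derive (t : R^o) 1 (fun s : R^o => (F : smooth_fun MR) (p, s)) g ->
    time_derive F p t = g.
  by move=> d; rewrite /time_derive derive1E derive_val.
split=> [k f g|f g]; apply: E1.
  rewrite (_ : (fun s => _) = k *: (fun s : R^o => vapp V (pullback_fst f) (p, s))
      + (fun s : R^o => vapp V (pullback_fst g) (p, s))); last first.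
    apply/funext => s /=.
    rewrite (_ : pullback_fst _ = k *: pullback_fst f + pullback_fst g).
      by rewrite derivationD derivationZ.
    exact: smooth_fun_ext.
  by apply: is_deriveD; [apply: is_deriveZ|]; exact: is_derive_time.
rewrite (_ : (fun s => _) = f p *: (fun s : R^o => vapp V (pullback_fst g) (p, s))
      + g p *: (fun s : R^o => vapp V (pullback_fst f) (p, s))); last first.
  apply/funext => s /=.
  rewrite (_ : pullback_fst _ = pullback_fst f * pullback_fst g).
    by rewrite derivationM.
  exact: smooth_fun_ext.
by apply: is_deriveD; apply: is_deriveZ; exact: is_derive_time.
Qed.

Definition fst_field_derive V p t : tangent M p :=
  mkTangent (fst_field_derivation V p t).

Definition time_fun_derive V p t : R := time_derive (vapp V (line_time M)) p t.

Lemma is_derive_fst_field V p t (f : C) :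
  is_derive (t : R^o) 1 (fun s : R^o => fst_field V s p f) (fst_field_derive V p t f).
Proof. exact: (is_derive_time (vapp V (pullback_fst f)) p t). Qed.

Lemma is_derive_time_fun V p t :
  is_derive (t : R^o) 1 (fun s : R^o => time_fun V s p) (time_fun_derive V p t).
Proof. exact: (is_derive_time (vapp V (line_time M)) p t). Qed.

Lemma line_fieldE V p t (F : smooth_fun MR) :
  V (p, t) F = fst_field V t p (line_slice F t) + time_fun V t p * time_derive F p t.
Proof. by rewrite -{1}(tan_pairK c (V (p, t))). Qed.

(** This and the next formula are the bracket [X + a d/dt, Y + b d/dt] for X, Y, a
and b depending on time. *)
Lemma dfst_bracket V W p t :
  dfst (bracket V W (p, t)) = bracket (fst_field V t) (fst_field W t) p
    + time_fun V t p *: fst_field_derive W p t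
    - time_fun W t p *: fst_field_derive V p t.
Proof.
apply: tangent_ext => f.
rewrite -[LHS]/(bracket V W (p, t) (pullback_fst f)) bracketE !line_fieldE.
have e U : line_slice (vapp U (pullback_fst f)) t = vapp (fst_field U t) f.
  exact: smooth_fun_ext.
rewrite !e tangentB tangentD !tangentZ bracketE.
rewrite -[fst_field_derive W p t f]/(time_derive (vapp W (pullback_fst f)) p t).
rewrite -[fst_field_derive V p t f]/(time_derive (vapp V (pullback_fst f)) p t).
ring.
Qed.

Lemma dtime_bracket V W p t :
  dtime (bracket V W (p, t)) =
    fst_field V t p (time_fun W t) + time_fun V t p * time_fun_derive W p t
    - (fst_field W t p (time_fun V t) + time_fun W t p * time_fun_derive V p t).
Proof. by rewrite /dtime bracketE !line_fieldE. Qed.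

End time_families.

(** * The Nijenhuis tensor on M x R *)

Section tensor_algebra.
Context {R : realType} {E : normedModType R} (M : manifold E).
Implicit Types (X Y Z : vfield M) (f : smooth_fun M) (A : tensor11 M)
  (w : oneform M) (g : pseudo_metric M).

Lemma tensor_appE A X p : tensor_app A X p = A p (X p). Proof. by []. Qed.

Lemma tensor_appB A X Y : tensor_app A (X - Y) = tensor_app A X - tensor_app A Y.
Proof.
by apply: vfield_ext => p; rewrite tensor_appE vfieldB linearB vfieldB.
Qed.

Lemma form_appE w X p : form_app w X p = w p (X p). Proof. by []. Qed.

Lemma tensorD A p (x y : tangent M p) : A p (x + y) = A p x + A p y.
Proof. exact: linearD. Qed.
Lemma tensorN A p (x : tangent M p) : A p (- x) = - A p x.
Proof. exact: linearN. Qed.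
Lemma tensorZ A p k (x : tangent M p) : A p (k *: x) = k *: A p x.
Proof. exact: linearZ. Qed.
Lemma tensor0 A p : A p (0 : tangent M p) = 0.
Proof. exact: linear0. Qed.
Lemma formD w p (x y : tangent M p) : w p (x + y) = w p x + w p y.
Proof. exact: linearD. Qed.
Lemma formN w p (x : tangent M p) : w p (- x) = - w p x.
Proof. exact: linearN. Qed.
Lemma formZ w p k (x : tangent M p) : w p (k *: x) = k * w p x.
Proof. exact: linearZ. Qed.
Lemma form0 w p : w p (0 : tangent M p) = 0.
Proof. exact: linear0. Qed.

End tensor_algebra.

Definition tensorE := (@tensorD, @tensorN, @tensorZ, @tensor0).
Definition formE := (@formD, @formN, @formZ, @form0).

Section nijenhuis.
Context {R : realType} {E : normedModType R} (c : coordinates E)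
        (M : manifold E).
Local Notation MR := (manifold_line M).
Variables (phi : tensor11 M) (xi : vfield M) (eta : oneform M).
Hypothesis phi2 :
  forall p (x : tangent M p), phi p (phi p x) = - x + eta p x *: xi p.
Hypothesis eta_xi : forall p, eta p (xi p) = 1.
Hypothesis phi_xi : forall p, phi p (xi p) = 0.
Hypothesis eta_phi : forall p (x : tangent M p), eta p (phi p x) = 0.
Local Notation J := (line_structure phi xi eta).
Local Notation Phi := (tensor_app phi).
Local Notation Eta := (form_app eta).

(** As phi^2 = - I + eta xi, this is the usual tensor [phi,phi] + 2 d eta xi. *)
Definition normality_tensor (X Y : vfield M) : vfield M :=
  bracket (Phi X) (Phi Y) - Phi (bracket (Phi X) Y) - Phi (bracket X (Phi Y))
  - bracket X Y + fscale (vapp X (Eta Y) - vapp Y (Eta X)) xi.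

(** The analogue of normality_tensor along d/dt: it equals
(L_(phi X) eta)(Y) - (L_(phi Y) eta)(X). *)
Definition normality_form (X Y : vfield M) : smooth_fun M :=
  vapp (Phi X) (Eta Y) - Eta (bracket (Phi X) Y)
  - (vapp (Phi Y) (Eta X) - Eta (bracket (Phi Y) X)).

Definition lie_form (X : vfield M) : smooth_fun M :=
  vapp xi (Eta X) - Eta (bracket xi X).

Lemma dfstB (q : MR) (v w : tangent MR q) : dfst (v - w) = dfst v - dfst w.
Proof. exact: tangent_ext. Qed.

Lemma dtimeB (q : MR) (v w : tangent MR q) : dtime (v - w) = dtime v - dtime w.
Proof. by []. Qed.

Section image.
Variables (V JV : vfield MR).
Hypothesis JVE : forall q, JV q = J (V q).

Lemma fst_field_structure t :
  fst_field JV t = Phi (fst_field V t) - fscale (time_fun V t) xi.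
Proof. by apply: vfield_ext => p; rewrite vfieldB /= JVE dfst_pair. Qed.

Lemma time_fun_structure t : time_fun JV t = Eta (fst_field V t).
Proof.
by apply: smooth_fun_ext => p; rewrite -[LHS]/(dtime (JV (p, t))) JVE dtime_pair.
Qed.

Lemma fst_field_derive_structure p t : fst_field_derive JV p t =
  phi p (fst_field_derive V p t) - time_fun_derive V p t *: xi p.
Proof.
apply: tangent_ext => f.
have d : is_derive (t : R^o) 1 (fun s : R^o => fst_field JV s p f)
    (phi p (fst_field_derive V p t) f - time_fun_derive V p t * xi p f).
  rewrite (_ : (fun _ => _) = (fun s : R^o => phi p (fst_field V s p) f)
    - xi p f *: (fun s : R^o => time_fun V s p)); last first.
    apply/funext => s; rewrite fst_field_structure vfieldB tangentB.
    by rewrite fscaleE tangentZ mulrC.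
  rewrite [_ * xi p f]mulrC; apply: is_deriveB; last first.
    by apply: is_deriveZ; exact: is_derive_time_fun.
  apply: (is_derive_linear c (L := fun x => phi p x f)) => [k x y|h].
    by rewrite linearP.
  exact: is_derive_fst_field.
rewrite -[LHS](@derive_val _ _ _ _ _ _ _ (is_derive_fst_field JV p t f)).
by rewrite (@derive_val _ _ _ _ _ _ _ d).
Qed.

Lemma time_fun_derive_structure p t :
  time_fun_derive JV p t = eta p (fst_field_derive V p t).
Proof.
rewrite -[LHS](@derive_val _ _ _ _ _ _ _ (is_derive_time_fun JV p t)).
apply: derive_val.
rewrite (_ : (fun _ => _) = (fun s : R^o => eta p (fst_field V s p))); last first.
  by apply/funext => s; rewrite time_fun_structure.
apply: (is_derive_linear c) => [k x y|h]; first by rewrite linearP.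
exact: is_derive_fst_field.
Qed.

End image.

Variables (V W JV JW : vfield MR).
Hypothesis JVE : forall q, JV q = J (V q).
Hypothesis JWE : forall q, JW q = J (W q).

Definition line_nijenhuis (q : MR) : tangent MR q :=
  bracket JV JW q - J (bracket JV W q) - J (bracket V JW q) - bracket V W q.

(** All time derivatives cancel, and so do the derivatives of the functions
time_fun V and time_fun W. *)
Lemma dfst_line_nijenhuis p t :
  dfst (line_nijenhuis (p, t)) =
    normality_tensor (fst_field V t) (fst_field W t) p
    - time_fun V t p *: lie_tensor xi phi (fst_field W t) p
    + time_fun W t p *: lie_tensor xi phi (fst_field V t) p.
Proof.
rewrite /line_nijenhuis !dfstB !dfst_pair !(dfst_bracket c) !(dtime_bracket c).
rewrite !(fst_field_derive_structure JVE) !(fst_field_derive_structure JWE).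
rewrite !(time_fun_derive_structure JVE) !(time_fun_derive_structure JWE).
rewrite !(fst_field_structure JVE) !(fst_field_structure JWE).
rewrite !(time_fun_structure JVE) !(time_fun_structure JWE).
move: (fst_field V t) (fst_field W t) (time_fun V t) (time_fun W t) => X Y a b.
move: (fst_field_derive V p t) (fst_field_derive W p t) => X' Y'.
move: (time_fun_derive V p t) (time_fun_derive W p t) => a' b'.
rewrite /normality_tensor /lie_tensor.
rewrite !(bracketBl, bracketBr, bracket_fscalel, bracket_fscaler).
rewrite [bracket (Phi X) xi]bracketC [bracket X xi]bracketC bracketxx.
rewrite -[(p, t).1]/p.
move: (bracket (Phi X) (Phi Y)) (bracket (Phi X) Y) (bracket X (Phi Y)) => B1 B2 B3.
move: (bracket X Y) (bracket xi (Phi X)) (bracket xi X) => B4 B5 B6.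
move: (bracket xi (Phi Y)) (bracket xi Y) => B7 B8.
rewrite !(vfieldE, tensor_appE, form_appE, smooth_funE, vappE).
rewrite !(tensorE, phi2, phi_xi).
apply: tangent_ext => f; rewrite !(tangentE, vfieldE, form_appE, tensor_appE).
ring.
Qed.

Lemma dtime_line_nijenhuis p t :
  dtime (line_nijenhuis (p, t)) =
    normality_form (fst_field V t) (fst_field W t) p
    - time_fun V t p * lie_form (fst_field W t) p
    + time_fun W t p * lie_form (fst_field V t) p.
Proof.
rewrite /line_nijenhuis !dtimeB !dtime_pair !(dfst_bracket c) !(dtime_bracket c).
rewrite !(fst_field_derive_structure JVE) !(fst_field_derive_structure JWE).
rewrite !(time_fun_derive_structure JVE) !(time_fun_derive_structure JWE).
rewrite !(fst_field_structure JVE) !(fst_field_structure JWE).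
rewrite !(time_fun_structure JVE) !(time_fun_structure JWE).
move: (fst_field V t) (fst_field W t) (time_fun V t) (time_fun W t) => X Y a b.
move: (fst_field_derive V p t) (fst_field_derive W p t) => X' Y'.
move: (time_fun_derive V p t) (time_fun_derive W p t) => a' b'.
rewrite /normality_form /lie_form.
rewrite !(bracketBl, bracketBr, bracket_fscalel, bracket_fscaler).
rewrite [bracket X xi]bracketC [bracket (Phi Y) X]bracketC -[(p, t).1]/p.
move: (bracket (Phi X) Y) (bracket X (Phi Y)) (bracket xi X) (bracket xi Y) =>
  B1 B2 B3 B4.
rewrite !(smooth_funE, vappE, form_appE, vfieldE, tensor_appE).
rewrite !(formE, eta_xi, eta_phi, tangentE, vfieldE, tensor_appE).
ring.
Qed.

End nijenhuis.

Section integrability.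
Context {R : realType} {E : normedModType R} (c : coordinates E)
        (M : manifold E).
Local Notation MR := (manifold_line M).
Variables (phi : tensor11 M) (xi : vfield M) (eta : oneform M).
Hypothesis phi2 :
  forall p (x : tangent M p), phi p (phi p x) = - x + eta p x *: xi p.
Hypothesis eta_xi : forall p, eta p (xi p) = 1.
Hypothesis phi_xi : forall p, phi p (xi p) = 0.
Hypothesis eta_phi : forall p (x : tangent M p), eta p (phi p x) = 0.
Local Notation J := (line_structure phi xi eta).

Lemma line_lift_structure X q :
  line_lift c (tensor_app phi X) (form_app eta X) q = J (line_lift c X 0 q).
Proof.
rewrite -[LHS]/(tan_pair (M := M) (q := q) (phi q.1 (X q.1)) (eta q.1 (X q.1))).
rewrite /line_structure dfst_pair dtime_pair.
by rewrite -[(0 : smooth_fun M) q.1]/(0 : R) scale0r subr0.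
Qed.

(** Test integrability on the fields of M, extended with no component along
d/dt. *)
Lemma normality_of_integrable : integrable_structure J ->
  forall X Y, normality_tensor phi xi eta X Y = 0.
Proof.
move=> intJ X Y; apply: vfield_ext => p.
pose V := line_lift c X 0; pose W := line_lift c Y 0.
have JV := line_lift_structure X; have JW := line_lift_structure Y.
have := intJ V W _ _ JV JW (p, 0 : R^o) => N0.
have := dfst_line_nijenhuis c phi2 phi_xi JV JW p (0 : R).
rewrite /line_nijenhuis {}N0.
have fE (Z : vfield M) (u : smooth_fun M) : fst_field (line_lift c Z u) 0 = Z.
  by apply: vfield_ext => q; exact: (@dfst_pair _ _ M (q, 0 : R^o) (Z q) (u q)).
have tE (Z : vfield M) (u : smooth_fun M) : time_fun (line_lift c Z u) 0 = u.
  by apply: smooth_fun_ext => q; exact: (@dtime_pair _ _ M (q, 0 : R^o) (Z q) (u q)).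
rewrite !fE !tE -[(0 : smooth_fun M) p]/(0 : R) !scale0r subr0 addr0 => <-.
exact: tangent_ext.
Qed.

Lemma integrable_of_normality :
  (forall X Y, normality_tensor phi xi eta X Y = 0) ->
  (forall X Y, normality_form phi eta X Y = 0) ->
  (forall X, lie_tensor xi phi X = 0) -> (forall X, lie_form xi eta X = 0) ->
  integrable_structure J.
Proof.
move=> nt nf lt lf V W JV JW JVE JWE [p t].
apply: (tangent_line_ext c).
  rewrite [LHS](dfst_line_nijenhuis c phi2 phi_xi JVE JWE p t) nt !lt.
  rewrite !vfield0 !scaler0 subr0 addr0; exact: tangent_ext.
rewrite [LHS](dtime_line_nijenhuis c eta_xi eta_phi JVE JWE p t) nf !lf.
by rewrite !smooth_fun0 !mulr0 subr0 addr0.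
Qed.

End integrability.

(** * Metrics, the Levi-Civita connection and traces *)

Section metric_algebra.
Context {R : realType} {E : normedModType R} (M : manifold E).
Variable g : pseudo_metric M.
Implicit Types (p : M) (X Y Z : vfield M).

Lemma metric_appE X Y p : metric_app g X Y p = g p (X p) (Y p). Proof. by []. Qed.

Lemma metricDl p (x y z : tangent M p) : g p (x + y) z = g p x z + g p y z.
Proof. by have := metric_linear g 1 x y z; rewrite scale1r mul1r. Qed.

Lemma metric0l p (z : tangent M p) : g p 0 z = 0.
Proof.
have := metricDl 0 0 z; rewrite addr0 => /eqP.
by rewrite -subr_eq0 opprD addrA subrr sub0r oppr_eq0 => /eqP.
Qed.

Lemma metricZl p k (x z : tangent M p) : g p (k *: x) z = k * g p x z.
Proof. by have := metric_linear g k x 0 z; rewrite !addr0 metric0l addr0. Qed.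

Lemma metricNl p (x z : tangent M p) : g p (- x) z = - g p x z.
Proof. by rewrite -scaleN1r metricZl mulN1r. Qed.

Lemma metricDr p (x y z : tangent M p) : g p x (y + z) = g p x y + g p x z.
Proof. by rewrite Defs.metric_sym metricDl !(Defs.metric_sym g x). Qed.

Lemma metric0r p (z : tangent M p) : g p z 0 = 0.
Proof. by rewrite Defs.metric_sym metric0l. Qed.

Lemma metricZr p k (x z : tangent M p) : g p x (k *: z) = k * g p x z.
Proof. by rewrite Defs.metric_sym metricZl Defs.metric_sym. Qed.

Lemma metricNr p (x z : tangent M p) : g p x (- z) = - g p x z.
Proof. by rewrite Defs.metric_sym metricNl Defs.metric_sym. Qed.

(** Nondegeneracy against values of global fields, by field_extension. *)
Lemma metric_inj (c : coordinates E) p (x y : tangent M p) :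
  (forall Z, g p x (Z p) = g p y (Z p)) -> x = y.
Proof.
move=> xy; apply/eqP; rewrite -subr_eq0; apply/eqP.
apply: (metric_nondegenerate (p0 := g)) => z.
have [Z <-] := field_extension c z.
by rewrite metricDl metricNl xy subrr.
Qed.

Lemma vfield_metric_inj (c : coordinates E) X Y :
  (forall Z p, g p (X p) (Z p) = g p (Y p) (Z p)) -> X = Y.
Proof. by move=> XY; apply: vfield_ext => p; apply: (metric_inj c) => Z. Qed.

End metric_algebra.

Definition metricE := (@metricDl, @metricNl, @metricZl, @metric0l,
  @metricDr, @metricNr, @metricZr, @metric0r).

Section levi_civita.
Context {R : realType} {E : normedModType R} (M : manifold E).
Variables (g : pseudo_metric M) (nabla : vfield M -> vfield M -> vfield M).
Hypothesis LC : levi_civita g nabla.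
Implicit Types (X Y Z W : vfield M) (p : M) (A : tensor11 M).

Lemma fscale1 X : fscale 1 X = X.
Proof. by apply: vfield_ext => p; rewrite fscaleE scale1r. Qed.

Lemma nablaDl X Y Z : nabla (X + Y) Z = nabla X Z + nabla Y Z.
Proof. by have := nabla_linear LC 1 X Y Z; rewrite !fscale1. Qed.

Lemma nabla0l Z : nabla 0 Z = 0.
Proof.
by have /eqP := nablaDl 0 0 Z; rewrite addr0 -subr_eq0 opprD addrA subrr sub0r
  oppr_eq0 => /eqP.
Qed.

Lemma nablaNl X Z : nabla (- X) Z = - nabla X Z.
Proof. by apply/eqP; rewrite -addr_eq0 -nablaDl addNr nabla0l. Qed.

Lemma nablaDr X Y Z : nabla X (Y + Z) = nabla X Y + nabla X Z.
Proof. exact: (nabla_additive LC). Qed.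

Lemma nabla0r X : nabla X 0 = 0.
Proof.
by have /eqP := nablaDr X 0 0; rewrite addr0 -subr_eq0 opprD addrA subrr sub0r
  oppr_eq0 => /eqP.
Qed.

Lemma nablaNr X Y : nabla X (- Y) = - nabla X Y.
Proof. by apply/eqP; rewrite -addr_eq0 -nablaDr addNr nabla0r. Qed.

Lemma nablaBr X Y Z : nabla X (Y - Z) = nabla X Y - nabla X Z.
Proof. by rewrite nablaDr nablaNr. Qed.

Lemma nablaZr (k : R) X Y : nabla X (k *: Y) = k *: nabla X Y.
Proof.
have fE Z : fscale (k *: (1 : smooth_fun M)) Z = k *: Z.
  by apply: vfield_ext => p; rewrite fscaleE smooth_funZ -[(1 : smooth_fun M) p]/(1 : R) mulr1.
rewrite -fE (nabla_leibniz LC) fE; rewrite (_ : fscale _ _ = 0) ?add0r//.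
apply: vfield_ext => p; rewrite fscaleE vappE derivationZ derivation1 mulr0.
exact: scale0r.
Qed.

Lemma bracket_nabla X Y : bracket X Y = nabla X Y - nabla Y X.
Proof. by rewrite (nabla_torsion_free LC). Qed.

Lemma nabla_metricE X Y Z p : X p (metric_app g Y Z) =
  g p (nabla X Y p) (Z p) + g p (Y p) (nabla X Z p).
Proof. by have /(congr1 (fun f : smooth_fun M => f p)) := nabla_metric LC X Y Z. Qed.

Lemma curvature_skewl X Y Z : curvature nabla X Y Z = - curvature nabla Y X Z.
Proof.
rewrite /curvature [bracket X Y]bracketC nablaNl opprK opprD opprB.
by rewrite opprK.
Qed.

Lemma curvature_skewr X Y Z W p :
  g p (curvature nabla X Y Z p) (W p) = - g p (Z p) (curvature nabla X Y W p).
Proof.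
have e1 (U V : vfield M) : U p (vapp V (metric_app g Z W)) =
    g p (nabla U (nabla V Z) p) (W p) + g p (nabla V Z p) (nabla U W p)
    + (g p (nabla U Z p) (nabla V W p) + g p (Z p) (nabla U (nabla V W) p)).
  rewrite (_ : vapp V _ = metric_app g (nabla V Z) W + metric_app g Z (nabla V W)).
    by rewrite derivationD !nabla_metricE.
  by rewrite (nabla_metric LC).
have := bracketE X Y p (metric_app g Z W).
rewrite !e1 nabla_metricE /curvature !(vfieldE, metricE) => h; lra.
Qed.

Lemma bianchi X Y Z :
  curvature nabla X Y Z + curvature nabla Y Z X + curvature nabla Z X Y = 0.
Proof.
have e (U V W : vfield M) : nabla U (nabla V W) - nabla U (nabla W V) = nabla U (bracket V W).
  by rewrite -nablaBr -bracket_nabla.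
have -> : curvature nabla X Y Z + curvature nabla Y Z X + curvature nabla Z X Y
    = (nabla X (bracket Y Z) - nabla (bracket Y Z) X)
    + (nabla Y (bracket Z X) - nabla (bracket Z X) Y)
    + (nabla Z (bracket X Y) - nabla (bracket X Y) Z).
  rewrite -!e /curvature.
  move: (nabla X (nabla Y Z)) (nabla X (nabla Z Y)) (nabla Y (nabla X Z)) => *.
  move: (nabla Y (nabla Z X)) (nabla Z (nabla X Y)) (nabla Z (nabla Y X)) => *.
  move: (nabla (bracket X Y) Z) (nabla (bracket Y Z) X) (nabla (bracket Z X) Y) => *.
  by apply: vfield_ext => p; apply: tangent_ext => f; rewrite !(vfieldE, tangentE); ring.
rewrite -!bracket_nabla.
rewrite [bracket X (bracket _ _)]bracketC [bracket Y (bracket _ _)]bracketC.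
rewrite [bracket Z (bracket _ _)]bracketC.
rewrite -!opprD; apply/eqP; rewrite oppr_eq0 addrC addrA.
by rewrite jacobi.
Qed.

Lemma curvature_pair_sym X Y Z W p :
  g p (curvature nabla X Y Z p) (W p) = g p (curvature nabla Z W X p) (Y p).
Proof.
pose r (X Y Z W : vfield M) := g p (curvature nabla X Y Z p) (W p).
have sl X' Y' Z' W' : r X' Y' Z' W' = - r Y' X' Z' W'.
  by rewrite /r curvature_skewl vfieldN metricNl.
have sr X' Y' Z' W' : r X' Y' Z' W' = - r X' Y' W' Z'.
  by rewrite /r curvature_skewr Defs.metric_sym.
have bi X' Y' Z' W' : r X' Y' Z' W' + r Y' Z' X' W' + r Z' X' Y' W' = 0.
  by rewrite /r -!metricDl -!vfieldD bianchi vfield0 metric0l.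
(* Summing these four instances, all terms cancel in pairs except those that
   pair X with Y and Z with W. *)
have b1 := bi Y Z X W; have b2 := bi Z X W Y; have b3 := bi X W Y Z.
have b4 := bi W Y Z X; rewrite -!/(r _ _ _ _).
have := sr Y Z X W; have := sr Z X Y W; have := sr X W Z Y; have := sr W Y X Z.
have := sl W Z X Y; have := sl Y X W Z; have := sr X Y W Z; have := sr Z W Y X.
lra.
Qed.

End levi_civita.

Section trace.
Context {R : realType} {V : lmodType R} {m : nat}.
Variables (G : V -> V -> R) (b : 'I_m -> V) (s : 'I_m -> R).

Definition rlinear (l : V -> R) := forall k x y, l (k *: x + y) = k * l x + l y.

Lemma rlinear_sum l (k : 'I_m -> R) : rlinear l ->
  l (\sum_i k i *: b i) = \sum_i k i * l (b i).
Proof.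
move=> ll; have l0 : l 0 = 0.
  by have := ll (-1) 0 0; rewrite scaler0 addr0 mulN1r addNr.
apply: (big_ind2 (fun x r => l x = r)) => // [x r y r' <- <-|i _].
  by have := ll 1 x y; rewrite scale1r mul1r.
by have := ll (k i) (b i) 0; rewrite !addr0 l0 addr0.
Qed.

Hypothesis Gl : forall y, rlinear (G^~ y).
Hypothesis s2 : forall i, s i * s i = 1.
Hypothesis Gb : forall i j, G (b i) (b j) = if i == j then s i else 0.
Hypothesis b_span : forall x, exists k : 'I_m -> R, x = \sum_i k i *: b i.

(** The expansion of x in a pseudo-orthonormal basis, seen through l. *)
Lemma contraction l x : rlinear l -> \sum_i s i * (G x (b i) * l (b i)) = l x.
Proof.
move=> ll; have [k ->] := b_span x; rewrite (rlinear_sum _ ll).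
apply: eq_bigr => i _; rewrite (rlinear_sum _ (Gl (b i))) (bigD1 i)//= big1.
  by rewrite Gb eqxx addr0 -[RHS]mul1r -(s2 i); ring.
by move=> j ji; rewrite Gb (negbTE ji) mulr0.
Qed.

Definition trace (B : V -> V -> R) := \sum_i s i * B (b i) (b i).

Lemma traceD B B' : trace (fun x y => B x y + B' x y) = trace B + trace B'.
Proof. by rewrite -big_split; apply: eq_bigr => i _; rewrite mulrDr. Qed.

Lemma traceZ k B : trace (fun x y => k * B x y) = k * trace B.
Proof. by rewrite mulr_sumr; apply: eq_bigr => i _; rewrite mulrCA. Qed.

Lemma traceN B : trace (fun x y => - B x y) = - trace B.
Proof. by rewrite -sumrN; apply: eq_bigr => i _; rewrite mulrN. Qed.

Lemma eq_trace B B' : (forall x, B x x = B' x x) -> trace B = trace B'.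
Proof. by move=> BB; apply: eq_bigr => i _; rewrite BB. Qed.

Lemma trace_metric : trace G = m%:R.
Proof.
rewrite -[RHS]mulr1 -[X in X%:R]card_ord -sumr_const mulr_suml.
by apply: eq_bigr => i _; rewrite Gb eqxx s2 mul1r.
Qed.

Hypothesis GC : forall x y, G x y = G y x.

(** A skew endomorphism can be moved across a trace, with a sign: expand f (b i)
in the basis and exchange the sums. *)
Lemma trace_skew (B : V -> V -> R) (f : V -> V) :
  (forall x y, G (f x) y = - G x (f y)) ->
  (forall y, rlinear (B^~ y)) -> (forall x, rlinear (B x)) ->
  trace (fun x y => B (f x) y) = - trace (fun x y => B x (f y)).
Proof.
move=> fG Bl Br; rewrite -sumrN.
have -> : trace (fun x y => B (f x) y) =
    \sum_i \sum_j s i * (s j * (G (f (b i)) (b j) * B (b j) (b i))).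
  by apply: eq_bigr => i _; rewrite -mulr_sumr (contraction _ (Bl (b i))).
rewrite exchange_big; apply: eq_bigr => j _ /=.
rewrite -(contraction (f (b j)) (Br (b j))) mulr_sumr -sumrN.
by apply: eq_bigr => i _; rewrite fG GC; ring.
Qed.

End trace.

(** * Contact pseudo-metric manifolds *)

(** The algebra behind the fact that an almost complex structure J is parallel if
it is integrable and its fundamental form is closed, with B in the role of
g((nabla_X J) Y, Z).  By the last hypothesis
P X Y Z = B (J X) Y Z + B X Y (J Z) is symmetric in X and Y, and it is skew in Y
and Z, so P = 0; then two instances of the cyclic identity add up to
2 B X Y (J Z) = 0. *)
Lemma integrable_closed_eq0 (R : realType) (F : Type) (J : F -> F)
    (B : F -> F -> F -> R) :
  (forall X Y Z, B X Y Z = - B X Z Y) ->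
  (forall X Y Z, B X Y Z + B Y Z X + B Z X Y = 0) ->
  (forall X Y Z, B X (J Y) Z = B X Y (J Z)) ->
  (forall X Y Z, B (J X) Y Z + B X Y (J Z) = B (J Y) X Z + B Y X (J Z)) ->
  forall X Y Z, B X Y (J Z) = 0.
Proof.
move=> skew cyc BJ int X Y Z.
pose P X Y Z := B (J X) Y Z + B X Y (J Z).
have Ps X' Y' Z' : P X' Y' Z' = P Y' X' Z' by exact: int.
have Pa X' Y' Z' : P X' Y' Z' = - P X' Z' Y'.
  by rewrite /P (skew (J X')) (skew X') BJ opprD.
have P0 X' Y' Z' : P X' Y' Z' = 0.
  have := Pa X' Y' Z'; rewrite (Ps X' Z') (Pa Z') (Ps Z' Y') (Pa Y' Z' X') (Ps Y' X').
  lra.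
have J1 X' Y' Z' : B (J X') Y' Z' = - B X' Y' (J Z').
  by apply/eqP; rewrite -addr_eq0; apply/eqP; exact: P0.
have := cyc X Y (J Z); have := cyc Z X (J Y); rewrite !BJ !J1.
lra.
Qed.

Section contact_geometry.
Context {R : realType} {E : normedModType R} (c : coordinates E)
        (M : manifold E).
Variables (phi : tensor11 M) (xi : vfield M) (eta : oneform M)
          (g : pseudo_metric M) (eps : R).
Hypothesis Hc : contact_pseudo_metric phi xi eta g eps.
Variable nabla : vfield M -> vfield M -> vfield M.
Hypothesis LC : levi_civita g nabla.
Variable tau : tensor11 M.
Hypothesis tauE : forall X Y : vfield M,
  metric_app g (tensor_app tau X) Y = lie_metric xi g X Y.
Implicit Types (X Y Z W : vfield M) (p : M).
Local Notation Phi := (tensor_app phi).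
Local Notation Tau := (tensor_app tau).
Local Notation Eta := (form_app eta).

Let ac : almost_contact_pseudo_metric phi xi eta g eps.
Proof. by case: Hc. Qed.
Let dEta X Y : dform eta X Y = metric_app g X (Phi Y).
Proof. by case: Hc. Qed.

Let phi2 p (x : tangent M p) : phi p (phi p x) = - x + eta p x *: xi p.
Proof. exact: (acpm_phi2 ac). Qed.
Let eta_xi p : eta p (xi p) = 1.
Proof. exact: (acpm_eta_xi ac). Qed.
Let phi_xi p : phi p (xi p) = 0.
Proof. exact: (acpm_phi_xi ac). Qed.
Let eta_phi p (x : tangent M p) : eta p (phi p x) = 0.
Proof. exact: (acpm_eta_phi ac). Qed.

Lemma eps_sqr : eps * eps = 1.
Proof. by case: (acpm_sign ac) => ->; rewrite ?mulrNN mulr1. Qed.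

Lemma metric_xil p (y : tangent M p) : g p (xi p) y = eps * eta p y.
Proof.
have := acpm_compat ac (xi p) y.
by rewrite phi_xi metric0l eta_xi mulr1 => /esym/eqP; rewrite subr_eq0 => /eqP.
Qed.

Lemma metric_xir p (y : tangent M p) : g p y (xi p) = eps * eta p y.
Proof. by rewrite Defs.metric_sym metric_xil. Qed.

Lemma etaE p (y : tangent M p) : eta p y = eps * g p (xi p) y.
Proof. by rewrite metric_xil mulrA eps_sqr mul1r. Qed.

Lemma phi_skew p (x y : tangent M p) : g p (phi p x) y = - g p x (phi p y).
Proof.
have := acpm_compat ac (phi p x) y.
rewrite phi2 !metricE metric_xil !eta_phi; lra.
Qed.

Lemma dEtaE X Y p :
  X p (Eta Y) - Y p (Eta X) - eta p (bracket X Y p) = 2 * g p (X p) (phi p (Y p)).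
Proof.
have /(congr1 (fun f : smooth_fun M => f p)) := dEta X Y.
rewrite /dform metric_appE tensor_appE !smooth_funE !vappE form_appE => <-.
by rewrite mulrA divff// mul1r.
Qed.

Lemma derive_eta X Y p : X p (Eta Y) =
  eps * (g p (nabla X xi p) (Y p) + g p (xi p) (nabla X Y p)).
Proof.
have -> : Eta Y = eps *: metric_app g xi Y.
  by apply: smooth_fun_ext => q; rewrite smooth_funZ metric_appE form_appE etaE.
by rewrite derivationZ (nabla_metricE LC).
Qed.

Lemma metric_tau X Y p : g p (tau p (X p)) (Y p) =
  g p (nabla X xi p) (Y p) + g p (X p) (nabla Y xi p).
Proof.
have /(congr1 (fun f : smooth_fun M => f p)) := tauE X Y.
rewrite /lie_metric !smooth_funE !metric_appE tensor_appE vappE => ->.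
rewrite (nabla_metricE LC) !(bracket_nabla LC) !(vfieldE, metricE); lra.
Qed.

(** tau is the symmetric part of nabla xi, up to a factor 2, and d eta = Phi fixes
the skew part. *)
Lemma nabla_xi X : nabla X xi = 2^-1 *: Tau X - eps *: Phi X.
Proof.
apply: (vfield_metric_inj (g := g) c) => Z p.
have := metric_tau X Z p; have := dEtaE X Z p.
rewrite !derive_eta (bracket_nabla LC) !(vfieldE, formE, metricE, tensor_appE) !metric_xil.
rewrite phi_skew (Defs.metric_sym g (X p) (nabla Z xi p)).
by case: (acpm_sign ac) => -> *; lra.
Qed.

Lemma tau_sym p (x y : tangent M p) : g p (tau p x) y = g p x (tau p y).
Proof.
have [X <-] := field_extension c x; have [Y <-] := field_extension c y.
rewrite (Defs.metric_sym g (X p)) !metric_tau.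
by rewrite (Defs.metric_sym g (Y p)) (Defs.metric_sym g (X p)) addrC.
Qed.

Lemma metric_nabla_xi_xi X p : g p (nabla X xi p) (xi p) = 0.
Proof.
have := nabla_metricE LC X xi xi p.
have -> : metric_app g xi xi = eps *: (1 : smooth_fun M).
  by apply: smooth_fun_ext => q; rewrite metric_appE metric_xil eta_xi.
rewrite derivationZ derivation1 mulr0 (Defs.metric_sym g (xi p)); lra.
Qed.

(** The contact condition d eta (xi, Z) = g(xi, phi Z) = 0, since g(xi, xi) is
constant. *)
Lemma nabla_xi_xi : nabla xi xi = 0.
Proof.
apply: (vfield_metric_inj (g := g) c) => Z p; rewrite vfield0 metric0l.
have := dEtaE xi Z p; rewrite !derive_eta (bracket_nabla LC).
rewrite !(vfieldE, formE) !metric_xil eta_phi.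
have := metric_nabla_xi_xi Z p; rewrite !metric_xir.
by case: (acpm_sign ac) => -> *; lra.
Qed.

Lemma tau_xi p : tau p (xi p) = 0.
Proof.
have := nabla_xi xi; rewrite nabla_xi_xi => /(congr1 (fun X : vfield M => X p)).
rewrite !vfieldE !tensor_appE phi_xi scaler0 subr0 => /esym/eqP.
by rewrite scaler_eq0 invr_eq0 (pnatr_eq0 _ 2)/= => /eqP.
Qed.

Lemma eta_tau p (x : tangent M p) : eta p (tau p x) = 0.
Proof. by rewrite etaE -tau_sym tau_xi metric0l mulr0. Qed.

Lemma tau_phi_phi p (x : tangent M p) : tau p (phi p (phi p x)) = - tau p x.
Proof. by rewrite phi2 !tensorE tau_xi scaler0 addr0. Qed.

(** The form T(X;Y,Z) of nabla phi. *)
Definition cov_phi X Y Z p : R := g p (covariant nabla X phi Y p) (Z p).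

Lemma cov_phiE X Y Z p :
  cov_phi X Y Z p = g p (nabla X (Phi Y) p) (Z p) - g p (phi p (nabla X Y p)) (Z p).
Proof. by rewrite /cov_phi /covariant !(vfieldE, metricE). Qed.

Lemma cov_phi_skew X Y Z p : cov_phi X Y Z p = - cov_phi X Z Y p.
Proof.
have e : metric_app g (Phi Y) Z = - metric_app g Y (Phi Z).
  by apply: smooth_fun_ext => q; rewrite smooth_funN !metric_appE phi_skew.
have := nabla_metricE LC X (Phi Y) Z p.
rewrite e derivationN (nabla_metricE LC) !cov_phiE !tensor_appE !phi_skew.
rewrite (Defs.metric_sym g _ (Y p)) (Defs.metric_sym g (nabla X Z p) (phi p (Y p))) phi_skew.
lra.
Qed.

(** d (d eta) = 0 by the Jacobi identity, and d eta is Phi. *)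
Lemma d_contact X Y Z p :
  X p (metric_app g Y (Phi Z)) - g p (bracket X Y p) (phi p (Z p))
  + (Y p (metric_app g Z (Phi X)) - g p (bracket Y Z p) (phi p (X p)))
  + (Z p (metric_app g X (Phi Y)) - g p (bracket Z X p) (phi p (Y p))) = 0.
Proof.
have dd (U V W : vfield M) : U p (metric_app g V (Phi W)) =
    2^-1 * (U p (vapp V (Eta W)) - U p (vapp W (Eta V)) - U p (Eta (bracket V W))).
  by rewrite -dEta /dform derivationZ !derivationB.
have bb (U V W : vfield M) : g p (bracket U V p) (phi p (W p)) = 2^-1 *
    (U p (vapp V (Eta W)) - V p (vapp U (Eta W)) - W p (Eta (bracket U V))
     - eta p (bracket (bracket U V) W p)).
  by have := dEtaE (bracket U V) W p; rewrite bracketE; lra.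
have := congr1 (fun U : vfield M => eta p (U p)) (jacobi X Y Z).
rewrite !(vfieldE, formE) !dd !bb; lra.
Qed.

Lemma cov_phi_cyclic X Y Z p : cov_phi X Y Z p + cov_phi Y Z X p + cov_phi Z X Y p = 0.
Proof.
have := d_contact X Y Z p.
have e (U V W : vfield M) : U p (metric_app g V (Phi W)) =
  - cov_phi U V W p + g p (nabla U V p) (phi p (W p)) + g p (V p) (phi p (nabla U W p)).
  rewrite (nabla_metricE LC) cov_phi_skew cov_phiE !tensor_appE.
  rewrite (Defs.metric_sym g (V p)) (Defs.metric_sym g (V p) (phi p _)); lra.
rewrite !e !(bracket_nabla LC) !(vfieldE, metricE).
have s U V W : g p (U p) (phi p (nabla V W p)) = - g p (nabla V W p) (phi p (U p)).
  by rewrite Defs.metric_sym phi_skew.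
rewrite !s; lra.
Qed.

(** The covariant derivative of phi^2 = - I + eta xi. *)
Lemma cov_phi_phi X Y Z p : cov_phi X (Phi Y) Z p - cov_phi X Y (Phi Z) p =
  eta p (Z p) * g p (Y p) (nabla X xi p) + eta p (Y p) * g p (nabla X xi p) (Z p).
Proof.
have P2 : Phi (Phi Y) = fscale (Eta Y) xi - Y.
  by apply: vfield_ext => q; rewrite !(vfieldE, tensor_appE, form_appE) phi2 addrC.
rewrite !cov_phiE P2 (nablaBr LC) (nabla_leibniz LC) !(vfieldE, metricE, tensor_appE).
rewrite !vappE !form_appE derive_eta !metric_xil.
rewrite (phi_skew (nabla X (Phi Y) p)) (phi_skew (nabla X Y p)) phi2.
rewrite !metricE metric_xir (Defs.metric_sym g (Y p)).
by case: (acpm_sign ac) => ->; ring.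
Qed.

Lemma cov_phi_xir X Y p : cov_phi X Y xi p = - g p (nabla X xi p) (phi p (Y p)).
Proof.
rewrite cov_phi_skew cov_phiE (_ : Phi xi = 0); last first.
  by apply: vfield_ext => q; rewrite tensor_appE phi_xi.
by rewrite (nabla0r LC) vfield0 metric0l sub0r phi_skew !opprK.
Qed.

Lemma nabla_xi_metric X p (y : tangent M p) : g p (nabla X xi p) y =
  2^-1 * g p (tau p (X p)) y - eps * g p (phi p (X p)) y.
Proof. by rewrite nabla_xi !(vfieldE, metricE) !tensor_appE. Qed.

(** In the cyclic identity for xi, X and Y the two terms other than
T(xi;X,Y) are known from nabla_xi; the part of nabla xi along phi cancels. *)
Lemma cov_phi_xi X Y p : cov_phi xi X Y p =
  - 2^-1 * (g p (tau p (phi p (X p))) (Y p) + g p (phi p (tau p (X p))) (Y p)).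
Proof.
have := cov_phi_cyclic xi X Y p; rewrite cov_phi_xir (cov_phi_skew Y) cov_phi_xir !nabla_xi_metric.
have -> : g p (tau p (X p)) (phi p (Y p)) = - g p (phi p (tau p (X p))) (Y p).
  by rewrite phi_skew opprK.
rewrite (tau_sym (Y p)) (Defs.metric_sym g (Y p) (tau p _)).
rewrite (Defs.metric_sym g (phi p (Y p)) (phi p (X p))); lra.
Qed.

(** nabla_xi phi anticommutes with phi by cov_phi_phi, since nabla_xi xi = 0.  By
cov_phi_xi it is a multiple of tau phi + phi tau, and this identity is what the
anticommutation amounts to. *)
Lemma tau_phi_tau p (x : tangent M p) : phi p (tau p (phi p x)) = tau p x.
Proof.
have [X <-] := field_extension c x; apply: (metric_inj c (g := g)) => Z.
have := cov_phi_phi xi X Z p; rewrite nabla_xi_xi !vfield0 !(metric0l, metric0r) !mulr0 addr0.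
rewrite !cov_phi_xi !tensor_appE tau_phi_phi metricNl.
have -> : g p (tau p (phi p (X p))) (phi p (Z p)) =
    - g p (phi p (tau p (phi p (X p)))) (Z p) by rewrite phi_skew opprK.
have -> : g p (phi p (tau p (X p))) (phi p (Z p)) = g p (tau p (X p)) (Z p).
  by rewrite (acpm_compat ac) eta_tau mulr0 mul0r subr0.
lra.
Qed.

Lemma phi_tau p (x : tangent M p) : phi p (tau p x) = - tau p (phi p x).
Proof. by rewrite -tau_phi_tau phi2 eta_tau scale0r addr0. Qed.

Lemma cov_phi_xi_eq0 X Y p : cov_phi xi X Y p = 0.
Proof. by rewrite cov_phi_xi phi_tau metricNl subrr mulr0. Qed.

Lemma covariant_xi_phi X : covariant nabla xi phi X = 0.
Proof.
by apply: (vfield_metric_inj (g := g) c) => Z p; rewrite vfield0 metric0l; exact: cov_phi_xi_eq0.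
Qed.

Lemma phi_eq0 p (x : tangent M p) : phi p x = 0 -> x = eta p x *: xi p.
Proof.
move=> x0; have := phi2 x; rewrite x0 tensor0 => /esym/eqP.
by rewrite addrC subr_eq0 => /eqP.
Qed.

Lemma tau_eq0 p (x : tangent M p) : phi p (tau p x) = 0 -> tau p x = 0.
Proof. by move=> /phi_eq0; rewrite eta_tau scale0r. Qed.

(** Replace brackets by covariant derivatives: the term nabla_xi phi vanishes, and
the rest is the commutator of phi and nabla xi. *)
Lemma lie_phi X : lie_tensor xi phi X = Phi (Tau X).
Proof.
apply: vfield_ext => p.
have := congr1 (fun U : vfield M => U p) (covariant_xi_phi X).
rewrite /covariant /lie_tensor !(bracket_nabla LC) tensor_appB !nabla_xi.
rewrite !(vfieldE, tensor_appE) !(tensorE, vfieldE, tensor_appE) phi_tau.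
move=> /eqP; rewrite subr_eq0 => /eqP ->.
move: (phi p (nabla xi X p)) (tau p _) (phi p (phi p _)) => u v w.
by apply: tangent_ext => f; rewrite !tangentE; lra.
Qed.

Lemma contact_h_phi_tau X : contact_h phi xi X = 2^-1 *: Phi (Tau X).
Proof. by rewrite /contact_h lie_phi. Qed.

Lemma contact_h_sqr X : contact_h phi xi (contact_h phi xi X) = (4^-1 : R) *: Tau (Tau X).
Proof.
apply: vfield_ext => p; rewrite !contact_h_phi_tau !vfieldE !(tensor_appE, vfieldE, tensorE).
rewrite scalerA phi_tau phi2 eta_tau scale0r addr0 !tensorE opprK.
by congr (_ *: _); lra.
Qed.

(** * Codazzi tensors *)

Section codazzi.
Hypothesis tau_codazzi : codazzi nabla tau.

Lemma covariant_xi_tau X :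
  covariant nabla xi tau X = eps *: Tau (Phi X) - 2^-1 *: Tau (Tau X).
Proof.
rewrite tau_codazzi /covariant (_ : Tau xi = 0); last first.
  by apply: vfield_ext => p; rewrite tensor_appE tau_xi.
rewrite (nabla0r LC) sub0r nabla_xi; apply: vfield_ext => p.
by rewrite !(vfieldE, tensor_appE) !(vfieldE, tensorE) opprB.
Qed.

(** Both terms of covariant_xi_tau are known to behave under phi: nabla_xi tau
and tau phi anticommute with phi, but tau^2 commutes with it. *)
Lemma tau_sqr p (x : tangent M p) : tau p (tau p x) = 0.
Proof.
have [X <-] := field_extension c x.
have nPhi Y : nabla xi (Phi Y) = Phi (nabla xi Y).
  by apply/eqP; rewrite -subr_eq0; apply/eqP; exact: covariant_xi_phi.
have aPhi Y : Tau (Phi Y) = - Phi (Tau Y).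
  by apply: vfield_ext => q; rewrite vfieldN !tensor_appE phi_tau opprK.
have anti : covariant nabla xi tau (Phi X) = - Phi (covariant nabla xi tau X).
  rewrite /covariant nPhi !aPhi (nablaNr LC) nPhi tensor_appB opprB.
  by rewrite opprK addrC.
have := congr1 (fun U : vfield M => U p) anti.
rewrite !covariant_xi_tau !(vfieldE, tensor_appE) !(vfieldE, tensorE, tensor_appE).
rewrite tau_phi_phi tau_phi_tau.
have -> : tau p (tau p (phi p (X p))) = phi p (tau p (tau p (X p))).
  by rewrite [in RHS]phi_tau phi_tau !tensorE opprK.
move: (tau p (X p)) => y h; apply: tau_eq0.
apply: tangent_ext => f; have := congr1 (fun v : tangent M p => v f) h.
by rewrite !tangentE => *; lra.
Qed.

Lemma codazzi_contact_h_sqr X : contact_h phi xi (contact_h phi xi X) = 0.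
Proof.
rewrite contact_h_sqr; apply: vfield_ext => p.
by rewrite vfieldZ !tensor_appE tau_sqr scaler0.
Qed.

(** R(X,Y) xi = (nabla_X A) Y - (nabla_Y A) X for A = nabla xi.  The part of A along
tau drops out by the Codazzi equation, and the cyclic identity rewrites the part
along phi. *)
Lemma codazzi_curvature_xi X Y Z p :
  g p (curvature nabla X Y xi p) (Z p) = eps * cov_phi Z X Y p.
Proof.
have cod := congr1 (fun U : vfield M => g p (U p) (Z p)) (tau_codazzi X Y).
have := cov_phi_cyclic X Y Z p; rewrite (cov_phi_skew Y Z).
move: cod; rewrite /curvature !nabla_xi (bracket_nabla LC) !(nablaBr LC) !(nablaZr LC).
rewrite !tensor_appB /covariant !(vfieldE, metricE, cov_phiE) !tensor_appE.
by case: (acpm_sign ac) => -> *; lra.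
Qed.

End codazzi.

(** * Normality *)

(** The identity (nabla_X phi) Y = g(X,Y) xi - eps eta(Y) X, paired with Z. *)
Definition sasakian_identity : Prop := forall X Y Z p,
  cov_phi X Y Z p = g p (X p) (Y p) * (eps * eta p (Z p)) - eps * eta p (Y p) * g p (X p) (Z p).

(** At Y = xi the identity computes phi (nabla_X xi); comparison with nabla_xi
gives phi tau = 0. *)
Lemma sasakian_identity_tau : sasakian_identity -> forall p (x : tangent M p), tau p x = 0.
Proof.
move=> pp p x; apply: tau_eq0; have [X <-] := field_extension c x.
apply: (metric_inj c (g := g)) => Z.
have := pp X xi Z p; rewrite cov_phi_skew cov_phi_xir nabla_xi_metric metric_xir eta_xi.
have -> : g p (tau p (X p)) (phi p (Z p)) = - g p (phi p (tau p (X p))) (Z p).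
  by rewrite phi_skew opprK.
rewrite (acpm_compat ac) metric0l.
case: (acpm_sign ac) => -> *; lra.
Qed.

Lemma normality_tensorE X Y Z p : g p (normality_tensor phi xi eta X Y p) (Z p) =
  cov_phi (Phi X) Y Z p - cov_phi (Phi Y) X Z p - cov_phi Y X (Phi Z) p + cov_phi X Y (Phi Z) p
  + 2 * eps * g p (X p) (phi p (Y p)) * eta p (Z p).
Proof.
have := dEtaE X Y p.
rewrite /normality_tensor !cov_phiE !(bracket_nabla LC) !tensor_appB.
rewrite !(vfieldE, metricE, smooth_funE, vappE, form_appE, tensor_appE).
have s x : g p x (phi p (Z p)) = - g p (phi p x) (Z p) by rewrite phi_skew opprK.
rewrite !formE !s !phi2 !(metricE, metric_xil) => h.
have -> : X p (Eta Y) - Y p (Eta X) = 2 * g p (X p) (phi p (Y p))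
    + (eta p (nabla X Y p) - eta p (nabla Y X p)) by lra.
ring.
Qed.

Lemma sasakian_identity_lie_phi : sasakian_identity -> forall X, lie_tensor xi phi X = 0.
Proof.
move=> pp X; rewrite lie_phi; apply: vfield_ext => p.
by rewrite !tensor_appE (sasakian_identity_tau pp) tensor0.
Qed.

Lemma sasakian_identity_normality : sasakian_identity ->
  forall X Y, normality_tensor phi xi eta X Y = 0.
Proof.
move=> pp X Y; apply: (vfield_metric_inj (g := g) c) => Z p.
rewrite normality_tensorE !pp !tensor_appE !eta_phi vfield0 metric0l.
rewrite !phi_skew (Defs.metric_sym g (Y p) (phi p (X p))) phi_skew; ring.
Qed.

Lemma contact_normality_form X Y : normality_form phi eta X Y = 0.
Proof.
have Eta0 Z : Eta (Phi Z) = 0.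
  by apply: smooth_fun_ext => p; rewrite form_appE tensor_appE eta_phi.
apply: smooth_fun_ext => p; rewrite /normality_form !smooth_funE !vappE !form_appE.
have := dEtaE (Phi X) Y p; have := dEtaE (Phi Y) X p.
rewrite !Eta0 !derivation0 !tensor_appE !(acpm_compat ac).
by rewrite (Defs.metric_sym g (Y p)) => *; lra.
Qed.

Lemma contact_lie_form X : lie_form xi eta X = 0.
Proof.
apply: smooth_fun_ext => p; rewrite /lie_form !smooth_funE !vappE form_appE.
have := dEtaE xi X p; rewrite metric_xil eta_phi !mulr0 (_ : Eta xi = 1).
  by rewrite derivation1 => *; lra.
by apply: smooth_fun_ext => q; rewrite form_appE eta_xi.
Qed.

Lemma cov_phi_xim X Z p : cov_phi X xi Z p = g p (nabla X xi p) (phi p (Z p)).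
Proof. by rewrite cov_phi_skew cov_phi_xir opprK. Qed.

(** The normality tensor at (X, xi) is phi (L_xi phi) X, and L_xi phi = phi tau. *)
Lemma normality_tensor_xi X : normality_tensor phi xi eta X xi = - Tau X.
Proof.
have T0 Y Z p : cov_phi 0 Y Z p = 0.
  by rewrite cov_phiE !(nabla0l LC) vfield0 tensor0 !metric0l subr0.
have Phi_xi : Phi xi = 0 by apply: vfield_ext => p; rewrite tensor_appE phi_xi.
apply: (vfield_metric_inj (g := g) c) => Z p.
rewrite normality_tensorE Phi_xi T0 cov_phi_xi_eq0 !cov_phi_xim !nabla_xi_metric !tensor_appE.
rewrite phi_xi metric0r vfieldN metricNl tensor_appE.
have s x z : g p x (phi p z) = - g p (phi p x) z by rewrite phi_skew opprK.
rewrite !s tau_phi_tau (phi2 (tau p (X p))) eta_tau scale0r addr0 metricNl; lra.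
Qed.

(** normality_tensor_xi gives tau = 0.  Then the difference B of the two sides of
the identity satisfies the hypotheses of integrable_closed_eq0: these are linear
relations, which the right-hand side satisfies too.  The component of B along xi
is read off from nabla xi = - eps phi. *)
Lemma sasakian_identity_of_normality :
  (forall X Y, normality_tensor phi xi eta X Y = 0) -> sasakian_identity.
Proof.
move=> nt.
have tau0 p (x : tangent M p) : tau p x = 0.
  have [X <-] := field_extension c x.
  have := congr1 (fun U : vfield M => U p) (normality_tensor_xi X).
  by rewrite nt vfieldN tensor_appE => /esym/eqP; rewrite oppr_eq0 => /eqP.
have nx X p y : g p (nabla X xi p) y = - eps * g p (phi p (X p)) y.
  by rewrite nabla_xi_metric tau0 metric0l mulr0 sub0r mulNr.
move=> X Y Z p.
pose B X Y Z := cov_phi X Y Z p -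
  (g p (X p) (Y p) * (eps * eta p (Z p)) - eps * eta p (Y p) * g p (X p) (Z p)).
have B0 X' Y' Z' : B X' Y' (Phi Z') = 0.
  apply: (integrable_closed_eq0 (J := tensor_app phi)) => {X Y Z X' Y' Z'} X Y Z.
  - by rewrite /B cov_phi_skew; ring.
  - have := cov_phi_cyclic X Y Z p; rewrite /B.
    rewrite (Defs.metric_sym g (Y p) (X p)) (Defs.metric_sym g (Z p) (Y p)).
    rewrite (Defs.metric_sym g (Z p) (X p)) => h.
    by rewrite -[RHS]h; ring.
  - have := cov_phi_phi X Y Z p; rewrite /B (Defs.metric_sym g (Y p)) !nx !tensor_appE !eta_phi.
    rewrite !phi_skew => /eqP; rewrite subr_eq => /eqP ->; ring.
  have := congr1 (fun U : vfield M => g p (U p) (Z p)) (nt X Y).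
  rewrite vfield0 metric0l normality_tensorE /B !tensor_appE !eta_phi.
  rewrite !phi_skew (Defs.metric_sym g (Y p) (X p)).
  rewrite (Defs.metric_sym g (Y p) (phi p (X p))) phi_skew => h.
  apply/eqP; rewrite -subr_eq0 -[X in _ == X]h; apply/eqP; ring.
have := B0 X Y (Phi Z); rewrite /B.
have -> : cov_phi X Y (Phi (Phi Z)) p = - cov_phi X Y Z p + eta p (Z p) * cov_phi X Y xi p.
  by rewrite /cov_phi !tensor_appE phi2 metricDr metricNr metricZr.
rewrite cov_phi_xir nx !tensor_appE phi2 !formE !metricE eta_xi metric_xir.
rewrite (acpm_compat ac).
case: (acpm_sign ac) => -> h; lra.
Qed.

Lemma sasakian_identity_codazzi : sasakian_identity -> codazzi nabla tau.
Proof.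
move=> pp; have tau0 X : Tau X = 0.
  by apply: vfield_ext => p; rewrite tensor_appE (sasakian_identity_tau pp).
by move=> X Y; rewrite /covariant !tau0 !(nabla0r LC).
Qed.

Lemma codazzi_sasakian_identity : codazzi nabla tau ->
  ((forall X Y, curvature nabla X Y xi = fscale (Eta Y) X - fscale (Eta X) Y)
   <-> sasakian_identity).
Proof.
move=> cod; split=> [RE X Y Z p|pp X Y].
  have := codazzi_curvature_xi cod Y Z X p; rewrite RE !(vfieldE, metricE).
  rewrite !form_appE !(Defs.metric_sym g (X p)).
  case: (acpm_sign ac) => -> h; lra.
apply: (vfield_metric_inj (g := g) c) => Z p.
rewrite (codazzi_curvature_xi cod) pp !(vfieldE, metricE) !form_appE.
rewrite !(Defs.metric_sym g (Z p)).
case: (acpm_sign ac) => ->; lra.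
Qed.

Lemma sasakian_iff_identity : sasakian_pseudo_metric phi xi eta g eps <-> sasakian_identity.
Proof.
split=> [[_ intJ]|pp].
  by apply: sasakian_identity_of_normality; exact: (normality_of_integrable c phi2 phi_xi intJ).
split=> //; apply: (integrable_of_normality c phi2 eta_xi phi_xi eta_phi).
- exact: sasakian_identity_normality.
- exact: contact_normality_form.
- exact: sasakian_identity_lie_phi.
- exact: contact_lie_form.
Qed.

Lemma sasakian_iff_curvature_codazzi :
  sasakian_pseudo_metric phi xi eta g eps <->
  (forall X Y, curvature nabla X Y xi = fscale (Eta Y) X - fscale (Eta X) Y) /\
  codazzi nabla tau.
Proof.
rewrite sasakian_iff_identity; split=> [pp|[RE cod]].
  by have cod := sasakian_identity_codazzi pp; split=> //; apply/codazzi_sasakian_identity.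
exact/codazzi_sasakian_identity.
Qed.

(** * The divergence of phi and the Ricci operator *)

Section pointwise.
Variable q : M.
Implicit Types (x y z w : tangent M q).

Definition extension x : vfield M := projT1 (cid (field_extension c x)).

Lemma extensionK x : extension x q = x.
Proof. exact: projT2 (cid (field_extension c x)). Qed.

Definition cov_phi_at x y z : R :=
  g q (covariant nabla (extension x) phi (extension y) q) z.

(** T is tensorial in Z by definition, hence in Y by skewness, hence in X by the
cyclic identity. *)
Lemma cov_phi_atE X Y Z : cov_phi X Y Z q = cov_phi_at (X q) (Y q) (Z q).
Proof.
have T3 (U V W W' : vfield M) : W q = W' q -> cov_phi U V W q = cov_phi U V W' q.
  by rewrite /cov_phi => ->.
have T2 (U V V' W : vfield M) : V q = V' q -> cov_phi U V W q = cov_phi U V' W q.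
  by move=> VV; rewrite cov_phi_skew (T3 _ _ _ _ VV) -cov_phi_skew.
have T1 (U U' V W : vfield M) : U q = U' q -> cov_phi U V W q = cov_phi U' V W q.
  move=> UU; have := cov_phi_cyclic U V W q; have := cov_phi_cyclic U' V W q.
  rewrite (T3 _ _ _ _ UU) (T2 _ _ _ _ UU) => h1 h2; lra.
rewrite (T1 X (extension (X q))) ?extensionK//.
by rewrite (T2 _ Y (extension (Y q))) ?extensionK.
Qed.

Lemma cov_phi_at_skew x y z : cov_phi_at x y z = - cov_phi_at x z y.
Proof.
rewrite -(extensionK x) -(extensionK y) -(extensionK z) -!cov_phi_atE.
exact: cov_phi_skew.
Qed.

Lemma cov_phi_at_cyclic x y z : cov_phi_at x y z + cov_phi_at y z x + cov_phi_at z x y = 0.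
Proof.
rewrite -(extensionK x) -(extensionK y) -(extensionK z) -!cov_phi_atE.
exact: cov_phi_cyclic.
Qed.

Definition nabla_xi_at x : tangent M q := 2^-1 *: tau q x - eps *: phi q x.
Local Notation A := nabla_xi_at.

Lemma cov_phi_at_phi x y z : cov_phi_at x (phi q y) z - cov_phi_at x y (phi q z) =
  eta q z * g q y (A x) + eta q y * g q (A x) z.
Proof.
have := cov_phi_phi (extension x) (extension y) (extension z) q.
rewrite !cov_phi_atE !tensor_appE nabla_xi !vfieldE !tensor_appE !extensionK.
exact.
Qed.

Lemma cov_phi_at_xi_r x y : cov_phi_at x y (xi q) = - g q (A x) (phi q y).
Proof.
have := cov_phi_xir (extension x) (extension y) q.
by rewrite cov_phi_atE nabla_xi !vfieldE !tensor_appE !extensionK.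
Qed.

Lemma cov_phi_at_linear_r x y : rlinear (cov_phi_at x y).
Proof. by move=> k z w; rewrite /cov_phi_at metricDr metricZr. Qed.

Lemma cov_phi_at_linear_m x z : rlinear (fun y => cov_phi_at x y z).
Proof. by move=> k y w; rewrite 3!(cov_phi_at_skew x _ z) cov_phi_at_linear_r; ring. Qed.

Lemma cov_phi_at_linear_l y z : rlinear (fun x => cov_phi_at x y z).
Proof.
move=> k x w; have e u : cov_phi_at u y z = - cov_phi_at y z u - cov_phi_at z u y.
  by have := cov_phi_at_cyclic u y z; lra.
by rewrite !e (cov_phi_at_linear_r y z) (cov_phi_at_linear_m z y); ring.
Qed.

Lemma metric_linear_l z : rlinear (fun x => g q x z).
Proof. by move=> k x y; rewrite metricDl metricZl. Qed.

Lemma metric_linear_r x : rlinear (g q x).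
Proof. by move=> k y z; rewrite metricDr metricZr. Qed.

Section frame.
Variables (m : nat) (b : 'I_m -> tangent M q) (s : 'I_m -> R).
Hypothesis s2 : forall i, s i * s i = 1.
Hypothesis gb : forall i j, g q (b i) (b j) = if i == j then s i else 0.
Hypothesis b_span : forall x, exists k : 'I_m -> R, x = \sum_i k i *: b i.
Local Notation tr := (trace b s).

Let contract l x : rlinear l -> \sum_i s i * (g q x (b i) * l (b i)) = l x.
Proof. exact: (contraction (G := g q) metric_linear_l s2 gb b_span). Qed.

Let trace_phi (B : tangent M q -> tangent M q -> R) :
  (forall y, rlinear (B^~ y)) -> (forall x, rlinear (B x)) ->
  tr (fun x y => B (phi q x) y) = - tr (fun x y => B x (phi q y)).
Proof.
apply: (trace_skew (G := g q) metric_linear_l s2 gb b_span).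
  exact: Defs.metric_sym.
exact: phi_skew.
Qed.

Lemma trace_eta_l l : rlinear l -> tr (fun x y => eta q x * l y) = eps * l (xi q).
Proof.
move=> ll; rewrite -(contract (xi q) ll) mulr_sumr; apply: eq_bigr => i _.
by rewrite etaE; ring.
Qed.

Lemma trace_phi_phi : tr (fun x y => g q (phi q (phi q x)) y) = 1 - m%:R.
Proof.
have -> : tr (fun x y => g q (phi q (phi q x)) y) =
    tr (fun x y => - g q x y + eta q x * g q (xi q) y).
  by apply: eq_trace => x; rewrite phi2 !metricE.
rewrite traceD traceN (trace_metric s2 gb) (trace_eta_l (metric_linear_r _)).
by rewrite metric_xil eta_xi mulr1 eps_sqr addrC.
Qed.

Let tau_linear_l z : rlinear (fun x => g q (tau q x) z).
Proof. by move=> k x y; rewrite !tensorE metricDl metricZl. Qed.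

Lemma trace_phi_tau : tr (fun x y => g q (phi q (tau q x)) y) = 0.
Proof.
have := trace_phi (B := fun x y => g q (tau q x) y) tau_linear_l
  (fun x => metric_linear_r _).
have -> : tr (fun x y => g q (tau q (phi q x)) y) =
    - tr (fun x y => g q (phi q (tau q x)) y).
  by rewrite -traceN; apply: eq_trace => x; rewrite phi_tau metricNl opprK.
have -> : tr (fun x y => g q (tau q x) (phi q y)) =
    - tr (fun x y => g q (phi q (tau q x)) y).
  by rewrite -traceN; apply: eq_trace => x; rewrite phi_skew opprK.
move=> h; lra.
Qed.

(** Since tau = phi tau phi, moving phi across the trace shows that tau and - tau
have the same trace. *)
Lemma trace_tau : tr (fun x y => g q (tau q x) y) = 0.
Proof.
have Br x : rlinear (fun y => g q (tau q x) (phi q y)).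
  by move=> k y z; rewrite !tensorE metricDr metricZr.
have := trace_phi (B := fun x y => g q (tau q x) (phi q y))
  (fun y => tau_linear_l _) Br.
have -> : tr (fun x y => g q (tau q x) (phi q (phi q y))) =
    - tr (fun x y => g q (tau q x) y).
  by rewrite -traceN; apply: eq_trace => x; rewrite phi2 !metricE metric_xir eta_tau; ring.
have -> : tr (fun x y => g q (tau q (phi q x)) (phi q y)) =
    - tr (fun x y => g q (tau q x) y).
  rewrite -traceN; apply: eq_trace => x.
  by rewrite -[LHS]opprK -phi_skew tau_phi_tau.
move=> h; lra.
Qed.

Lemma trace_phi_metric : tr (fun x y => g q (phi q x) y) = 0.
Proof.
rewrite /trace big1// => i _; rewrite (_ : g q _ _ = 0) ?mulr0//.
have := phi_skew (b i) (b i).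
by rewrite (Defs.metric_sym g (b i) (phi q _)) => *; lra.
Qed.

Lemma trace_nabla_xi : tr (fun x y => g q (A x) y) = 0.
Proof.
have -> : tr (fun x y => g q (A x) y) =
    tr (fun x y => 2^-1 * g q (tau q x) y + - eps * g q (phi q x) y).
  by apply: eq_trace => x; rewrite /nabla_xi_at !metricE mulNr.
by rewrite traceD !traceZ trace_tau trace_phi_metric !mulr0 addr0.
Qed.

Definition div_phi y : R := tr (fun x z => cov_phi_at x z y).

Lemma div_phi_xi : div_phi (xi q) = eps * (m%:R - 1).
Proof.
have -> : div_phi (xi q) = tr (fun x y => 2^-1 * g q (phi q (tau q x)) y
    + - eps * g q (phi q (phi q x)) y).
  apply: eq_trace => x; rewrite cov_phi_at_xi_r /nabla_xi_at.
  by rewrite !metricE !phi_skew; ring.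
rewrite traceD !traceZ trace_phi_tau trace_phi_phi; ring.
Qed.

Lemma nabla_xi_at_xi : A (xi q) = 0.
Proof. by rewrite /nabla_xi_at tau_xi phi_xi !scaler0 subr0. Qed.

Lemma metric_nabla_xi_at x : g q (A x) (xi q) = 0.
Proof. by rewrite /nabla_xi_at !metricE !metric_xir eta_tau eta_phi; ring. Qed.

Lemma nabla_xi_at_linear_l z : rlinear (fun x => g q (A x) z).
Proof.
by move=> k x y; rewrite /nabla_xi_at !tensorE !metricE; ring.
Qed.

(** Moving phi across the trace turns T(phi x; x, w) into - T(x; phi x, w).  By the
cyclic identity these two forms differ by T(w; x, phi x), which cov_phi_at_phi
computes and whose trace is zero. *)
Lemma trace_phi_covariant w : tr (fun x y => cov_phi_at x (phi q y) w) = 0.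
Proof.
have e : tr (fun x y => cov_phi_at x (phi q y) w) =
    tr (fun x y => cov_phi_at (phi q x) y w + eta q x * g q (A w) y).
  apply: eq_trace => x.
  have := cov_phi_at_cyclic x (phi q x) w; have := cov_phi_at_phi w x x.
  rewrite (cov_phi_at_skew w (phi q x) x) (cov_phi_at_skew (phi q x) w x).
  rewrite (Defs.metric_sym g x (A w)) => h1 h2; lra.
have := trace_phi (B := fun x y => cov_phi_at x y w) (fun y => cov_phi_at_linear_l y w)
  (fun x => cov_phi_at_linear_m x w).
move: e; rewrite traceD (trace_eta_l (metric_linear_r _)) metric_nabla_xi_at.
move=> h1 h2; lra.
Qed.

Lemma div_phi_phi w : div_phi (phi q w) = 0.
Proof.
have -> : div_phi (phi q w) = tr (fun x y => cov_phi_at x (phi q y) w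
    + (- eta q w * g q (A x) y + - (eta q x * g q (A y) w))).
  apply: eq_trace => x; have := cov_phi_at_phi x x w.
  rewrite (Defs.metric_sym g x (A x)) => h; lra.
rewrite !traceD traceZ traceN trace_phi_covariant trace_nabla_xi.
rewrite (trace_eta_l (nabla_xi_at_linear_l w)) nabla_xi_at_xi metric0l; ring.
Qed.

Lemma div_phiE y : div_phi y = eps * (m%:R - 1) * eta q y.
Proof.
have e x z : cov_phi_at x z y =
    - 1 * cov_phi_at x z (phi q (phi q y)) + eta q y * cov_phi_at x z (xi q).
  by rewrite phi2 /cov_phi_at metricDr metricNr metricZr; ring.
have -> : div_phi y = - 1 * div_phi (phi q (phi q y)) + eta q y * div_phi (xi q).
  by rewrite /div_phi -!traceZ -traceD; apply: eq_trace => x; exact: e.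
by rewrite div_phi_phi div_phi_xi; ring.
Qed.

End frame.

End pointwise.

Section ricci.
Hypothesis tau_codazzi : codazzi nabla tau.

(** By the symmetry of the curvature under exchange of pairs, xi can be moved into
the slot in which codazzi_curvature_xi applies. *)
Lemma codazzi_curvature_diag W Y p :
  g p (curvature nabla W xi Y p) (W p) = eps * cov_phi W W Y p.
Proof.
rewrite (curvature_pair_sym LC) (curvature_skewr LC) Defs.metric_sym.
by rewrite (codazzi_curvature_xi tau_codazzi) cov_phi_skew mulrN opprK.
Qed.

Lemma codazzi_ricci_xi m (Q : tensor11 M) : is_ricci_operator m g nabla Q ->
  tensor_app Q xi = (eps * (m%:R - 1)) *: xi.
Proof.
move=> Ric; apply: (vfield_metric_inj (g := g) c) => Y q.
have [U [e [s [Uq [_ s1 eo esp] SE]]]] := Ric q.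
have s2 i : s i * s i = 1 by case: (s1 i) => ->; rewrite ?mulrNN mulr1.
have -> : g q (tensor_app Q xi q) (Y q) =
    \sum_i s i * g q (curvature nabla (e i) xi Y q) (e i q).
  exact: SE.
have -> : \sum_i s i * g q (curvature nabla (e i) xi Y q) (e i q) =
    eps * div_phi (fun i => e i q) s (Y q).
  rewrite mulr_sumr; apply: eq_bigr => i _.
  by rewrite codazzi_curvature_diag cov_phi_atE mulrCA.
rewrite (div_phiE s2 (eo q Uq) (esp q Uq)) vfieldZ metricZl metric_xil; ring.
Qed.

End ricci.

End contact_geometry.

Theorem theorem4p2 (R : realType) (n : nat)
    (M : manifold 'rV[R]_(2 * n).+1) (M_connected : connected [set: M])
    (phi : tensor11 M) (xi : vfield M) (eta : oneform M)
    (g : pseudo_metric M) (eps : R)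
    (M_contact : contact_pseudo_metric phi xi eta g eps)
    (nabla : vfield M -> vfield M -> vfield M)
    (nabla_LC : levi_civita g nabla)
    (tau : tensor11 M)
    (tauE : forall X Y : vfield M, metric_app g (tensor_app tau X) Y = lie_metric xi g X Y) :
  (codazzi nabla tau ->
     (forall X : vfield M, contact_h phi xi (contact_h phi xi X) = 0) /\
     (forall Q : tensor11 M, is_ricci_operator (2 * n).+1 g nabla Q ->
        tensor_app Q xi = (2 * eps * n%:R) *: xi)) /\
  (sasakian_pseudo_metric phi xi eta g eps <->
     (forall X Y : vfield M,
        curvature nabla X Y xi = fscale (form_app eta Y) X - fscale (form_app eta X) Y) /\
     codazzi nabla tau).
Proof.
pose c := @coordinates_row R (2 * n).+1.
split; last exact: (sasakian_iff_curvature_codazzi c M_contact nabla_LC tauE).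
move=> tau_codazzi; split=> [X|Q QE].
  exact: (codazzi_contact_h_sqr c M_contact nabla_LC tauE tau_codazzi).
rewrite (codazzi_ricci_xi c M_contact nabla_LC tauE tau_codazzi QE).
by congr (_ *: _); rewrite -natr1 addrK natrM; ring.
Qed.
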